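(* For each $m\ge 0$, the elements $r^{i}$, $0\le i\le 2m$, form a $\mathbb{Z}/2$-basis of $M_{4m}$. Consequently $M=\mathbb{Z}/2[r]$. Furthermore the elements $r^{2k}(r^{2}+r)$, $k\ge 0$, form a $\mathbb{Z}/2$-basis of $M(\mathrm{odd})$.
   Context: For even $k\ge 0$, $M_{k}$ is the set of $f\in\mathbb{Z}/2[[x]]$ for which there is a (holomorphic) modular form of weight $k$ for $\Gamma_{0}(5)$ whose expansion at infinity (in $x=e^{2\pi i z}$) lies in $\mathbb{Z}[[x]]$ and reduces mod $2$ to $f$. One has $M_{0}\subset M_{4}\subset M_{8}\subset\cdots$; $M=\bigcup_{m}M_{4m}$, and $M(\mathrm{odd})=M\cap x\,\mathbb{Z}/2[[x^{2}]]$. Let $r=\sum_{n>0}(x^{n^{2}}+x^{2n^{2}}+x^{5n^{2}}+x^{10n^{2}})\in\mathbb{Z}/2[[x]]$. *)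

(* Defs.v *)
From Stdlib Require Import Reals ZArith Arith List.
From Coquelicot Require Import Coquelicot.
Open Scope R_scope.

Definition in_H (z : C) : Prop := 0 < Im z.

(* x = e^{2 pi i z} *)
Definition qexp (z : C) : C :=
  (exp (- (2 * PI * Im z)) * cos (2 * PI * Re z),
   exp (- (2 * PI * Im z)) * sin (2 * PI * Re z)).

Definition moeb (a b c d : Z) (z : C) : C :=
  ((RtoC (IZR a) * z + RtoC (IZR b)) / (RtoC (IZR c) * z + RtoC (IZR d)))%C.

Definition jfac (c d : Z) (k : nat) (z : C) : C :=
  Cpow (RtoC (IZR c) * z + RtoC (IZR d))%C k.

Definition in_SL2Z (a b c d : Z) : Prop := (a * d - b * c = 1)%Z.
Definition in_Gamma0_5 (a b c d : Z) : Prop := in_SL2Z a b c d /\ (5 | c)%Z.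

(* holomorphic modular form of weight k for Gamma_0(5):
   - complex differentiable at every point of the upper half plane,
   - f(gamma z) = (cz+d)^k f(z) for gamma in Gamma_0(5),
   - holomorphic at all cusps: for every gamma in SL2(Z), the slashed function
     (cz+d)^{-k} f(gamma z) stays bounded as Im z -> +oo. *)
Definition modular_form_G05 (k : nat) (f : C -> C) : Prop :=
  (forall z, in_H z -> ex_derive f z) /\
  (forall a b c d z, in_Gamma0_5 a b c d -> in_H z ->
      f (moeb a b c d z) = (jfac c d k z * f z)%C) /\
  (forall a b c d, in_SL2Z a b c d ->
      exists Mb B : R, forall z, B < Im z ->
        Cmod (f (moeb a b c d z)) <= Mb * Cmod (jfac c d k z)).

Definition has_qexpansion (f : C -> C) (a : nat -> Z) : Prop :=
  forall z, in_H z ->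
    is_series (fun n => (RtoC (IZR (a n)) * Cpow (qexp z) n)%C) (f z).

(* ---------- Z/2[[x]] side: power series are coefficient functions nat -> bool
   (false = 0, true = 1; addition = xorb, multiplication = andb) ---------- *)

Definition ps := nat -> bool.

Fixpoint xsum (n : nat) (g : nat -> bool) : bool :=
  match n with
  | O => g O
  | S n' => xorb (xsum n' g) (g n)
  end.

Definition ps_add (f g : ps) : ps := fun n => xorb (f n) (g n).
Definition ps_mul (f g : ps) : ps := fun n => xsum n (fun j => andb (f j) (g (n - j)%nat)).
Definition ps_one : ps := fun n => Nat.eqb n 0.
Fixpoint ps_pow (f : ps) (i : nat) : ps :=
  match i with O => ps_one | S i' => ps_mul (ps_pow f i') f end.
Definition ps_scale (c : bool) (f : ps) : ps := fun n => andb c (f n).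
Definition lincomb (c : nat -> bool) (d : nat) (b : nat -> ps) : ps :=
  fun n => xsum d (fun i => ps_scale (c i) (b i) n).

Definition Mk (k : nat) (f : ps) : Prop :=
  exists (F : C -> C) (a : nat -> Z),
    modular_form_G05 k F /\ has_qexpansion F a /\ forall n, Z.odd (a n) = f n.

Definition Mall (f : ps) : Prop := exists m, Mk (4 * m) f.
Definition Modd (f : ps) : Prop := Mall f /\ forall n, f (2 * n)%nat = false.

(* r = sum_{n>0} (x^{n^2} + x^{2n^2} + x^{5n^2} + x^{10n^2}) *)
Definition r : ps := fun N =>
  xsum N (fun n =>
    if Nat.eqb n 0 then false else
    xorb (xorb (Nat.eqb N (n * n)) (Nat.eqb N (2 * (n * n))))
         (xorb (Nat.eqb N (5 * (n * n))) (Nat.eqb N (10 * (n * n))))).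

Definition ps_eq (f g : ps) : Prop := forall n, f n = g n.

(* Main.v *)
(* With P = 1 - 24 sum sigma(n) q^n (the Eisenstein series of weight 2), the partial fraction
   expansion of the cotangent gives P(-1/z) = z^2 P(z) + 6 z / (pi i). Differentiating this law gives
   the form E4 = P^2 - 12 theta P of weight 4, and integrating it shows that
   exp(2 pi i phi), phi' = P, is a nowhere vanishing form of weight 12. From E4(z), E4(5z) and
   (5 P(5z) - P(z)) / 4 one builds integral forms of weight 4 for Gamma_0(5) that vanish at infinity to
   order 0, 1, 2, have odd leading coefficients there and reduce to 1, r, r^2, because sigma(n) is odd
   exactly when n is a square or twice a square. Their products give forms of weight 4m reducing to
   r^i, i <= 2m, with odd leading coefficient at x^i.

   An integral form of weight 4m can be reduced by these, after multiplication by odd integers, to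
   one that vanishes to order > 2m at infinity, and such a form f is zero (Sturm's bound):
   h = |f|^2 |eta(z)|^(4m+6) / |eta(5z)|^(20m+6) is invariant under Gamma_0(5), tends to 0 at both
   cusps, and is |q| times the square of the modulus of a holomorphic function of q. The Schwarz lemma
   in q bounds h by |q| sup h, and since h is small near the cusp 0 while every other point is
   equivalent to one with Im z bounded below, sup h <= c sup h with c < 1.

   Finally r^2 + r is odd and squares are even, so writing r^(2k+1) = r^(2k) (r^2 + r) + r^(2k+2)
   splits an element of M into its odd and even parts. *)

Require Import Defs.
From Stdlib Require Import Reals ZArith Arith List.
From Stdlib Require Import Lra Lia Psatz Bool FunctionalExtensionality.
From Coquelicot Require Import Coquelicot.
Open Scope R_scope.
Set Bullet Behavior "Strict Subproofs".

(** * Complex series *)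

(** Membership in M_k provides an expansion at infinity only; at the cusp 0 a form is merely
    bounded, so the decay of h there must come from the eta quotient alone. Its exponents are
    forced. If |F|^2 is multiplied by |eta(z)|^A and divided by |eta(5z)|^B, invariance requires A -
    B = -16m, and order exactly 1 at infinity for F starting at q^(2m+1) requires A - 5B = -96m -
    24; hence A = 4m + 6 and B = 20m + 6, and the order left at the cusp 0 is 1/5. Only absolute
    values of eta occur, so its multiplier system never has to be determined. The factor |q| makes
    the maximum principle a strict contraction, so the supremum of h need not be attained. The bound
    2m itself is weight 4m times index 6 divided by 12. Averages over roots of unity replace contour
    integrals in the maximum principle, and Herglotz's duplication argument yields the partial
    fractions of the cotangent. *)

Fixpoint csum (u : nat -> C) (n : nat) : C :=
  match n with O => RtoC 0 | S p => (csum u p + u p)%C end.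

Definition clim (u : nat -> C) (l : C) : Prop :=
  forall eps, 0 < eps -> exists N, forall n, (N <= n)%nat -> Cmod (u n - l)%C < eps.

Definition cser (u : nat -> C) (l : C) : Prop := clim (csum u) l.

(** Total, as [Series] is; the value carries meaning only where [asum] or [cser] is known. *)
Definition CS (u : nat -> C) : C :=
  (Series (fun n => Re (u n)), Series (fun n => Im (u n))).

Definition asum (u : nat -> C) : Prop := ex_series (fun n => Cmod (u n)).

Lemma Cmod_minus_sym a b : Cmod (a - b)%C = Cmod (b - a)%C.
Proof. rewrite <- Cmod_opp. f_equal. ring. Qed.

Lemma Cmod_triang_inv a b : Cmod a - Cmod b <= Cmod (a - b)%C.
Proof.
  assert (H := Cmod_triangle (a - b)%C b).
  replace (a - b + b)%C with a in H by ring. lra.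
Qed.

Lemma clim_const c : clim (fun _ => c) c.
Proof.
  intros e He; exists O; intros n _.
  replace (c - c)%C with (RtoC 0) by ring. rewrite Cmod_0; lra.
Qed.

Lemma clim_ext_ev u v l :
  (exists N, forall n, (N <= n)%nat -> u n = v n) -> clim u l -> clim v l.
Proof.
  intros [N HN] H e He. destruct (H e He) as [N' H'].
  exists (N + N')%nat; intros n Hn. rewrite <- HN by lia. apply H'; lia.
Qed.

Lemma clim_ext u v l : (forall n, u n = v n) -> clim u l -> clim v l.
Proof. intros H; apply clim_ext_ev; exists O; auto. Qed.

Lemma clim_plus u v a b : clim u a -> clim v b -> clim (fun n => u n + v n)%C (a + b)%C.
Proof.
  intros H1 H2 e He.
  destruct (H1 (e/2)) as [N1 K1]; [lra|]. destruct (H2 (e/2)) as [N2 K2]; [lra|].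
  exists (N1 + N2)%nat; intros n Hn.
  replace (u n + v n - (a + b))%C with ((u n - a) + (v n - b))%C by ring.
  eapply Rle_lt_trans; [apply Cmod_triangle|].
  specialize (K1 n ltac:(lia)); specialize (K2 n ltac:(lia)); lra.
Qed.

Lemma clim_scal c u a : clim u a -> clim (fun n => c * u n)%C (c * a)%C.
Proof.
  intros H e He.
  assert (Hc : 0 < Cmod c + 1) by (generalize (Cmod_ge_0 c); lra).
  destruct (H (e / (Cmod c + 1))) as [N K].
  { apply Rdiv_lt_0_compat; lra. }
  exists N; intros n Hn. replace (c * u n - c * a)%C with (c * (u n - a))%C by ring.
  rewrite Cmod_mult. specialize (K n Hn).
  apply Rle_lt_trans with ((Cmod c + 1) * Cmod (u n - a)).
  { apply Rmult_le_compat_r; [apply Cmod_ge_0 | lra]. }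
  apply Rlt_le_trans with ((Cmod c + 1) * (e / (Cmod c + 1))).
  { apply Rmult_lt_compat_l; lra. }
  right; field; lra.
Qed.

Lemma clim_opp u a : clim u a -> clim (fun n => - u n)%C (- a)%C.
Proof.
  intros H. apply clim_ext with (fun n => (-(1)) * u n)%C. intros; ring.
  replace (- a)%C with ((-(1)) * a)%C by ring. now apply clim_scal.
Qed.

Lemma clim_minus u v a b : clim u a -> clim v b -> clim (fun n => u n - v n)%C (a - b)%C.
Proof. intros H1 H2. unfold Cminus. apply clim_plus; auto. now apply clim_opp. Qed.

Lemma clim_bounded u a : clim u a -> exists B, forall n, Cmod (u n) <= B.
Proof.
  intros H. destruct (H 1 Rlt_0_1) as [N HN].
  assert (HB : exists B, forall n, (n < N)%nat -> Cmod (u n) <= B).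
  { clear HN. induction N as [|N [B HB]].
    - exists 0; intros; lia.
    - exists (Rmax B (Cmod (u N))); intros n Hn.
      destruct (Nat.eq_dec n N) as [->|]; [apply Rmax_r|].
      eapply Rle_trans; [apply HB; lia | apply Rmax_l]. }
  destruct HB as [B HB]. exists (Rmax B (Cmod a + 1)); intros n.
  destruct (le_lt_dec N n) as [L|L].
  - eapply Rle_trans; [|apply Rmax_r]. specialize (HN n L).
    assert (T := Cmod_triang_inv (u n) a). lra.
  - eapply Rle_trans; [apply HB; auto | apply Rmax_l].
Qed.

Lemma clim_unique u a b : clim u a -> clim u b -> a = b.
Proof.
  intros H1 H2. apply Ceq_minus. apply Cmod_eq_0.
  destruct (Rle_lt_or_eq_dec 0 _ (Cmod_ge_0 (a - b)%C)) as [L|E]; [|lra]. exfalso.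
  set (e := Cmod (a - b)%C) in *.
  destruct (H1 (e/2)) as [N1 K1]; [lra|]. destruct (H2 (e/2)) as [N2 K2]; [lra|].
  specialize (K1 (N1+N2)%nat ltac:(lia)). specialize (K2 (N1+N2)%nat ltac:(lia)).
  assert (T := Cmod_triangle (a - u (N1+N2)%nat)%C (u (N1+N2)%nat - b)%C).
  replace (a - u (N1 + N2)%nat + (u (N1 + N2)%nat - b))%C with (a - b)%C in T by ring.
  rewrite (Cmod_minus_sym a (u _)) in T. unfold e in *; lra.
Qed.

Lemma clim_Cmod_le u l B : (exists N, forall n, (N <= n)%nat -> Cmod (u n) <= B) -> clim u l -> Cmod l <= B.
Proof.
  intros [N HN] H. apply Rnot_lt_le; intros L.
  destruct (H (Cmod l - B)) as [N' H']; [lra|].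
  specialize (H' (N+N')%nat ltac:(lia)). specialize (HN (N+N')%nat ltac:(lia)).
  rewrite Cmod_minus_sym in H'.
  assert (T := Cmod_triang_inv l (u (N+N')%nat)). lra.
Qed.

Lemma clim_mult u v a b : clim u a -> clim v b -> clim (fun n => u n * v n)%C (a * b)%C.
Proof.
  intros H1 H2. destruct (clim_bounded v b H2) as [B HB].
  apply clim_ext with (fun n => (u n - a) * v n + a * v n)%C; [intros; ring|].
  replace (a * b)%C with (0 + a * b)%C by ring. apply clim_plus; [|now apply clim_scal].
  intros e He. assert (HB0 : 0 <= B) by (eapply Rle_trans; [apply Cmod_ge_0 | apply (HB O)]).
  destruct (H1 (e / (B + 1))) as [N HN]. { apply Rdiv_lt_0_compat; lra. }
  exists N; intros n Hn. replace ((u n - a) * v n - 0)%C with ((u n - a) * v n)%C by ring.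
  rewrite Cmod_mult. specialize (HN n Hn).
  apply Rle_lt_trans with (Cmod (u n - a) * (B+1)).
  { apply Rmult_le_compat_l; [apply Cmod_ge_0|]. specialize (HB n); lra. }
  apply Rlt_le_trans with (e / (B+1) * (B+1)); [apply Rmult_lt_compat_r; lra|].
  right; field; lra.
Qed.

Lemma clim_inv u a : a <> RtoC 0 -> clim u a -> clim (fun n => / u n)%C (/ a)%C.
Proof.
  intros Ha H e He. assert (P := proj1 (Cmod_gt_0 a) Ha).
  destruct (H (Cmod a / 2)) as [N1 K1]; [lra|].
  destruct (H (e * (Cmod a * Cmod a / 2))) as [N2 K2].
  { apply Rmult_lt_0_compat; auto. nra. }
  exists (N1 + N2)%nat; intros n Hn.
  specialize (K1 n ltac:(lia)); specialize (K2 n ltac:(lia)).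
  assert (L : Cmod a / 2 < Cmod (u n)).
  { assert (T := Cmod_triang_inv a (u n)). rewrite Cmod_minus_sym in K1. lra. }
  assert (Hu : u n <> RtoC 0). { apply Cmod_gt_0. lra. }
  replace (/ u n - / a)%C with (- (u n - a) / (u n * a))%C by (field; auto).
  rewrite Cmod_div by (apply Cmult_neq_0; auto). rewrite Cmod_opp, Cmod_mult.
  apply Rmult_lt_reg_r with (Cmod (u n) * Cmod a); [nra|].
  unfold Rdiv. rewrite Rmult_assoc, Rinv_l, Rmult_1_r by nra.
  eapply Rlt_le_trans; [exact K2|]. apply Rmult_le_compat_l; [lra|]. nra.
Qed.

Lemma clim_subseq u l (s : nat -> nat) :
  (forall n, (n <= s n)%nat) -> clim u l -> clim (fun n => u (s n)) l.
Proof.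
  intros Hs H e He. destruct (H e He) as [N HN]. exists N; intros n Hn.
  apply HN. specialize (Hs n); lia.
Qed.

Lemma clim_Re u l : clim u l -> is_lim_seq (fun n => Re (u n)) (Re l).
Proof.
  intros H. apply is_lim_seq_spec. intros e. destruct (H e (cond_pos e)) as [N HN].
  exists N; intros n Hn. eapply Rle_lt_trans; [|apply (HN n Hn)].
  eapply Rle_trans; [|apply re_le_Cmod]. apply Req_le. f_equal.
Qed.

Lemma im_le_Cmod c : Rabs (Im c) <= Cmod c.
Proof. eapply Rle_trans; [|apply Rmax_Cmod]. apply Rmax_r. Qed.

Lemma clim_Im u l : clim u l -> is_lim_seq (fun n => Im (u n)) (Im l).
Proof.
  intros H. apply is_lim_seq_spec. intros e. destruct (H e (cond_pos e)) as [N HN].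
  exists N; intros n Hn. eapply Rle_lt_trans; [|apply (HN n Hn)].
  eapply Rle_trans; [|apply im_le_Cmod]. apply Req_le. f_equal.
Qed.

Lemma Cmod_le_Re_Im c : Cmod c <= Rabs (Re c) + Rabs (Im c).
Proof.
  assert (E : c = (RtoC (Re c) + RtoC (Im c) * Ci)%C).
  { destruct c as [x y]. unfold Re, Im, RtoC, Ci, Cplus, Cmult; simpl; f_equal; ring. }
  rewrite E at 1. eapply Rle_trans; [apply Cmod_triangle|].
  rewrite Cmod_mult, !Cmod_R, Cmod_Ci. lra.
Qed.

Lemma clim_pair u l :
  is_lim_seq (fun n => Re (u n)) (Re l) -> is_lim_seq (fun n => Im (u n)) (Im l) -> clim u l.
Proof.
  intros H1 H2 e He. apply is_lim_seq_spec in H1, H2.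
  assert (He2 : 0 < e/2) by lra.
  destruct (H1 (mkposreal _ He2)) as [N1 K1]. destruct (H2 (mkposreal _ He2)) as [N2 K2].
  exists (N1+N2)%nat; intros n Hn. specialize (K1 n ltac:(lia)); specialize (K2 n ltac:(lia)).
  simpl in K1, K2. eapply Rle_lt_trans; [apply Cmod_le_Re_Im|].
  change (Rabs (Re (u n) - Re l) + Rabs (Im (u n) - Im l) < e). lra.
Qed.

Lemma csum_Re u n : Re (csum u (S n)) = sum_n (fun k => Re (u k)) n.
Proof.
  induction n as [|n IH].
  - rewrite sum_O. simpl. unfold Re, RtoC; simpl. ring.
  - rewrite sum_Sn, <- IH. reflexivity.
Qed.

Lemma csum_Im u n : Im (csum u (S n)) = sum_n (fun k => Im (u k)) n.
Proof.
  induction n as [|n IH].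
  - rewrite sum_O. simpl. unfold Im, RtoC; simpl. ring.
  - rewrite sum_Sn, <- IH. reflexivity.
Qed.

Lemma clim_incr u l : clim (fun n => u (S n)) l -> clim u l.
Proof.
  intros H e He. destruct (H e He) as [N HN]. exists (S N); intros n Hn.
  destruct n as [|n]; [lia|]. apply HN; lia.
Qed.

Lemma cser_CS u l : cser u l -> CS u = l.
Proof.
  intros H. unfold cser in H. apply (clim_subseq _ _ S) in H; [|intros; lia].
  assert (H1 := clim_Re _ _ H). assert (H2 := clim_Im _ _ H).
  unfold CS. destruct l as [x y]. f_equal; apply is_series_unique.
  - apply is_lim_seq_ext with (2 := H1). intros; apply csum_Re.
  - apply is_lim_seq_ext with (2 := H2). intros; apply csum_Im.
Qed.

Lemma asum_cser u : asum u -> cser u (CS u).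
Proof.
  intros H. unfold cser. apply clim_incr.
  assert (E1 : ex_series (fun n => Re (u n))).
  { apply ex_series_Rabs. apply @ex_series_le with (2 := H). intros n.
    unfold norm; simpl; unfold abs; simpl. rewrite Rabs_Rabsolu. apply re_le_Cmod. }
  assert (E2 : ex_series (fun n => Im (u n))).
  { apply ex_series_Rabs. apply @ex_series_le with (2 := H). intros n.
    unfold norm; simpl; unfold abs; simpl. rewrite Rabs_Rabsolu. apply im_le_Cmod. }
  apply Series_correct in E1, E2. apply clim_pair.
  - apply is_lim_seq_ext with (2 := E1). intros; now rewrite csum_Re.
  - apply is_lim_seq_ext with (2 := E2). intros; now rewrite csum_Im.
Qed.

Lemma is_series_cser (u : nat -> C) (l : C) : is_series u l <-> cser u l.
Proof.
  assert (E : forall n, sum_n u n = csum u (S n)).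
  { induction n as [|n IH]. rewrite sum_O. simpl. now rewrite Cplus_0_l.
    rewrite sum_Sn, IH. reflexivity. }
  split.
  - intros H. apply clim_incr. intros e He.
    assert (L : locally (l : C_NormedModule) (fun y : C => Cmod (y - l)%C < e)).
    { assert (T := @locally_ball_norm _ C_NormedModule l (mkposreal e He)).
      eapply filter_imp; [|exact T]. intros y Hy. exact Hy. }
    destruct (H _ L) as [N HN]. exists N; intros n Hn. rewrite <- E. apply HN; auto.
  - intros H P HP. apply (@locally_norm_le_locally _ C_NormedModule) in HP.
    destruct HP as [e He]. destruct (H e (cond_pos e)) as [N HN].
    exists N; intros n Hn. apply He. unfold ball_norm. rewrite E. apply (HN (S n)). lia.
Qed.

Lemma csum_ext u v n : (forall k, (k < n)%nat -> u k = v k) -> csum u n = csum v n.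
Proof.
  induction n; intros H; simpl; auto. rewrite IHn, H; auto.
Qed.

Lemma csum_plus u v n : csum (fun k => u k + v k)%C n = (csum u n + csum v n)%C.
Proof. induction n; simpl. ring. rewrite IHn; ring. Qed.

Lemma csum_scal c u n : csum (fun k => c * u k)%C n = (c * csum u n)%C.
Proof. induction n; simpl. ring. rewrite IHn; ring. Qed.

Lemma csum_0 u n : (forall k, (k < n)%nat -> u k = RtoC 0) -> csum u n = RtoC 0.
Proof. induction n; intros H; simpl; auto. rewrite IHn, H; auto. ring. Qed.

Lemma csum_Sl u n : csum u (S n) = (u O + csum (fun k => u (S k)) n)%C.
Proof. induction n. simpl; ring. change (csum u (S (S n))) with (csum u (S n) + u (S n))%C. rewrite IHn. simpl; ring. Qed.

Lemma csum_app u n m : csum u (n + m) = (csum u n + csum (fun k => u (n + k)%nat) m)%C.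
Proof.
  induction m. rewrite Nat.add_0_r; simpl; ring.
  rewrite Nat.add_succ_r. simpl. rewrite IHm. ring.
Qed.

Lemma csum_Cmod_S u n : Cmod (csum u (S n)) <= sum_n (fun k => Cmod (u k)) n.
Proof.
  induction n.
  - rewrite sum_O. simpl. rewrite Cplus_0_l; lra.
  - rewrite sum_Sn. eapply Rle_trans; [apply Cmod_triangle|]. apply Rplus_le_compat_r, IHn.
Qed.

Lemma csum_double (u : nat -> nat -> C) n m :
  csum (fun i => csum (fun j => u i j) m) n = csum (fun j => csum (fun i => u i j) n) m.
Proof.
  induction n; simpl. symmetry; apply csum_0; auto. rewrite IHn, <- csum_plus. reflexivity.
Qed.

Lemma cser_plus u v a b : cser u a -> cser v b -> cser (fun n => u n + v n)%C (a + b)%C.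
Proof.
  intros H1 H2. eapply clim_ext; [|apply clim_plus; [exact H1|exact H2]].
  intros; simpl; now rewrite csum_plus.
Qed.

Lemma cser_scal c u a : cser u a -> cser (fun n => c * u n)%C (c * a)%C.
Proof. intros H. eapply clim_ext; [|apply clim_scal; exact H]. intros; simpl; now rewrite csum_scal. Qed.

Lemma cser_ext u v a : (forall n, u n = v n) -> cser u a -> cser v a.
Proof. intros E. apply clim_ext. intros; now apply csum_ext. Qed.

Lemma cser_unique u a b : cser u a -> cser u b -> a = b.
Proof. apply clim_unique. Qed.

Lemma cser_decr u a : cser u a -> cser (fun n => u (S n)) (a - u O)%C.
Proof.
  intros H. apply (clim_subseq _ _ S) in H; [|intros; lia].
  eapply clim_ext; [|apply clim_minus; [exact H|apply (clim_const (u O))]].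
  intros n; cbv beta. rewrite csum_Sl. ring.
Qed.

Lemma CS_ext u v : (forall n, u n = v n) -> CS u = CS v.
Proof. intros E. unfold CS. f_equal; apply Series_ext; intros; now rewrite E. Qed.

Lemma asum_le u (a : nat -> R) : (forall n, Cmod (u n) <= a n) -> ex_series a -> asum u.
Proof.
  intros H Ha. apply @ex_series_le with (2 := Ha). intros n. unfold norm; simpl; unfold abs; simpl.
  rewrite Rabs_pos_eq by apply Cmod_ge_0. apply H.
Qed.

Lemma sum_n_le_Series (a : nat -> R) n : (forall k, 0 <= a k) -> ex_series a -> sum_n a n <= Series a.
Proof.
  intros Hp Ha. apply Series_correct in Ha.
  apply (is_lim_seq_incr_compare (sum_n a)); auto.
  intros k. rewrite sum_Sn. unfold plus; simpl. generalize (Hp (S k)); lra.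
Qed.

Lemma csum_le_Series u (a : nat -> R) n :
  (forall k, Cmod (u k) <= a k) -> ex_series a -> Cmod (csum u n) <= Series a.
Proof.
  intros H Ha.
  assert (Hp : forall k, 0 <= a k) by (intros k; eapply Rle_trans; [apply Cmod_ge_0|apply H]).
  destruct n as [|n].
  - simpl. rewrite Cmod_0. eapply Rle_trans; [|apply (sum_n_le_Series a 0 Hp Ha)]. rewrite sum_O; auto.
  - eapply Rle_trans; [apply csum_Cmod_S|].
    eapply Rle_trans; [|apply (sum_n_le_Series a n Hp Ha)].
    apply sum_n_m_le. auto.
Qed.

Lemma CS_le_Series u (a : nat -> R) :
  (forall k, Cmod (u k) <= a k) -> ex_series a -> Cmod (CS u) <= Series a.
Proof.
  intros H Ha. apply clim_Cmod_le with (csum u).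
  - exists O; intros; now apply csum_le_Series.
  - apply asum_cser. eapply asum_le; eauto.
Qed.

Lemma series_tail_small (a : nat -> R) : ex_series a -> forall e, 0 < e -> exists N, forall n, (N <= n)%nat ->
   Rabs (Series (fun k => a (n + k)%nat)) < e.
Proof.
  intros Ha e He. destruct Ha as [l Hl]. assert (H : is_lim_seq (sum_n a) l) by exact Hl. apply is_lim_seq_spec in H.
  destruct (H (mkposreal e He)) as [N HN]. exists (S N); intros n Hn.
  assert (E := Series_incr_n a n ltac:(lia) (ex_intro _ l Hl)).
  rewrite (is_series_unique _ _ Hl) in E.
  specialize (HN (pred n) ltac:(lia)). simpl in HN.
  rewrite <- sum_n_Reals in E.
  replace (Series (fun k => a (n + k)%nat)) with (- (sum_n a (pred n) - l)) by lra.
  now rewrite Rabs_Ropp.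
Qed.

Lemma CS_tail (u : nat -> C) (a : nat -> R) N :
  (forall m, Cmod (u m) <= a m) -> ex_series a ->
  Cmod (CS u - csum u N)%C <= Series (fun k => a (N + k)%nat).
Proof.
  intros Hu Ha. assert (Ha' : ex_series (fun k => a (N + k)%nat)) by now apply ex_series_incr_n.
  replace (CS u - csum u N)%C with (CS (fun k => u (N + k)%nat)).
  - apply (CS_le_Series _ (fun k => a (N + k)%nat)); auto.
  - apply cser_CS.
    assert (H : cser u (CS u)) by (apply asum_cser; eapply asum_le; eauto).
    apply (clim_subseq _ _ (fun k => N + k)%nat) in H; [|intros; lia].
    eapply clim_ext; [|apply clim_minus; [exact H|apply (clim_const (csum u N))]].
    intros k; cbv beta. rewrite csum_app. ring.
Qed.

(** Dominated convergence for series: the tails of all [v k] and of [w] are below e/4 by the common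
    majorant, and only finitely many terms have to converge. The cotangent expansion, the Lambert
    series, [fubini] and the Cauchy product all use it. *)
Lemma tannery (v : nat -> nat -> C) (w : nat -> C) (a : nat -> R) :
  ex_series a ->
  (forall k m, Cmod (v k m) <= a m) ->
  (forall m, clim (fun k => v k m) (w m)) ->
  clim (fun k => CS (v k)) (CS w).
Proof.
  intros Ha Hv Hw.
  assert (Hw' : forall m, Cmod (w m) <= a m).
  { intros m. apply clim_Cmod_le with (fun k => v k m); auto. exists O; auto. }
  intros e He.
  destruct (series_tail_small a Ha (e/4)) as [N HN]; [lra|].
  specialize (HN N (Nat.le_refl _)).
  assert (F : clim (fun k => csum (v k) N) (csum w N)).
  { clear HN. induction N; simpl; [apply clim_const|]. now apply clim_plus. }
  destruct (F (e/4)) as [K HK]; [lra|]. exists K; intros n Hn. specialize (HK n Hn).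
  assert (T : forall u, (forall m, Cmod (u m) <= a m) -> Cmod (CS u - csum u N)%C <= e/4).
  { intros u Hu. eapply Rle_trans; [apply (CS_tail u a N Hu Ha)|].
    eapply Rle_trans; [apply Rle_abs|]. lra. }
  assert (T1 := T (v n) (Hv n)). assert (T2 := T w Hw').
  replace (CS (v n) - CS w)%C with ((CS (v n) - csum (v n) N) + ((csum (v n) N - csum w N) + (csum w N - CS w)))%C by ring.
  eapply Rle_lt_trans; [apply Cmod_triangle|]. 
  assert (Q := Cmod_triangle (csum (v n) N - csum w N) (csum w N - CS w)).
  rewrite (Cmod_minus_sym (csum w N)) in Q. lra.
Qed.

(** * Complex derivatives and the exponential *)

(** The difference quotient is cleared of its denominator, so h = 0 needs no exception;
    [cder_is_derive] translates to the derivative of the statement. *)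
Definition cder (f : C -> C) (z l : C) : Prop :=
  forall e, 0 < e -> exists d, 0 < d /\ forall h, Cmod h < d ->
    Cmod (f (z + h)%C - f z - l * h)%C <= e * Cmod h.

Lemma cder_is_derive f z l : cder f z l <-> @is_derive C_AbsRing C_NormedModule f z l.
Proof.
  split.
  - intros H. split; [apply is_linear_scal_l|].
    intros x Hx. apply (@is_filter_lim_locally_unique C_AbsRing (AbsRing_NormedModule C_AbsRing)) in Hx. subst x.
    intros e. destruct (H e (cond_pos e)) as [d [Hd Hh]].
    exists (mkposreal d Hd). intros y Hy. change (Cmod (y - z)%C < d) in Hy.
    specialize (Hh (y - z)%C Hy).
    assert (Ey : forall w : C, (z + (w - z))%C = w) by (intros; ring). rewrite Ey in Hh.
    change (Cmod (f y - f z - (y - z) * l)%C <= e * Cmod (y - z)%C).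
    now rewrite (Cmult_comm _ l).
  - intros [_ H] e He.
    specialize (H z (fun P HP => HP) (mkposreal e He)). destruct H as [d Hd].
    exists d; split; [apply cond_pos|]. intros h Hh.
    specialize (Hd (z + h)%C).
    assert (B : Cmod (z + h - z)%C < d). { now replace (z + h - z)%C with h by ring. }
    specialize (Hd B). change (Cmod (f (z + h)%C - f z - (z + h - z) * l)%C <= e * Cmod (z + h - z)%C) in Hd.
    replace (z + h - z)%C with h in Hd by ring. now rewrite (Cmult_comm l).
Qed.

Lemma cder_ext_loc f g z l :
  (exists d, 0 < d /\ forall h, Cmod h < d -> f (z + h)%C = g (z + h)%C) -> cder f z l -> cder g z l.
Proof.
  intros [d [Hd E]] H e He. destruct (H e He) as [d' [Hd' K]].
  exists (Rmin d d'); split; [apply Rmin_glb_lt; auto|]. intros h Hh.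
  assert (h1 : Cmod h < d) by (eapply Rlt_le_trans; [exact Hh|apply Rmin_l]).
  assert (h2 : Cmod h < d') by (eapply Rlt_le_trans; [exact Hh|apply Rmin_r]).
  rewrite <- E by auto. assert (E0 := E (RtoC 0)). rewrite Cplus_0_r in E0.
  rewrite <- E0 by (rewrite Cmod_0; auto). auto.
Qed.

Lemma cder_ext f g z l : (forall x, f x = g x) -> cder f z l -> cder g z l.
Proof. intros E. apply cder_ext_loc. exists 1; split; [lra|auto]. Qed.

Lemma cder_const c z : cder (fun _ => c) z (RtoC 0).
Proof.
  intros e He; exists 1; split; [lra|]. intros h _.
  replace (c - c - RtoC 0 * h)%C with (RtoC 0) by ring. rewrite Cmod_0.
  apply Rmult_le_pos; [lra|apply Cmod_ge_0].
Qed.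

Lemma cder_id z : cder (fun x => x) z (RtoC 1).
Proof.
  intros e He; exists 1; split; [lra|]. intros h _.
  replace (z + h - z - RtoC 1 * h)%C with (RtoC 0) by ring. rewrite Cmod_0.
  apply Rmult_le_pos; [lra|apply Cmod_ge_0].
Qed.

Lemma cder_plus f g z a b : cder f z a -> cder g z b -> cder (fun x => f x + g x)%C z (a + b)%C.
Proof.
  intros H1 H2 e He. destruct (H1 (e/2)) as [d1 [P1 K1]]; [lra|]. destruct (H2 (e/2)) as [d2 [P2 K2]]; [lra|].
  exists (Rmin d1 d2); split; [apply Rmin_glb_lt; auto|]. intros h Hh.
  specialize (K1 h (Rlt_le_trans _ _ _ Hh (Rmin_l _ _))). specialize (K2 h (Rlt_le_trans _ _ _ Hh (Rmin_r _ _))).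
  replace (f (z + h) + g (z + h) - (f z + g z) - (a + b) * h)%C
    with ((f (z + h) - f z - a * h) + (g (z + h) - g z - b * h))%C by ring.
  eapply Rle_trans; [apply Cmod_triangle|]. lra.
Qed.

Lemma cder_lip f z a : cder f z a -> exists d, 0 < d /\ forall h, Cmod h < d ->
  Cmod (f (z + h) - f z)%C <= (Cmod a + 1) * Cmod h.
Proof.
  intros H. destruct (H 1 Rlt_0_1) as [d [P K]]. exists d; split; auto. intros h Hh.
  specialize (K h Hh). replace (f (z + h) - f z)%C with ((f (z + h) - f z - a * h) + a * h)%C by ring.
  eapply Rle_trans; [apply Cmod_triangle|]. rewrite Cmod_mult. lra.
Qed.

Lemma cder_comp f g z a b : cder g z b -> cder f (g z) a -> cder (fun x => f (g x)) z (a * b)%C.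
Proof.
  intros Hg Hf e He.
  set (A := Cmod a). set (B := Cmod b + 1).
  assert (PA : 0 <= A) by apply Cmod_ge_0. assert (PB : 0 < B) by (unfold B; generalize (Cmod_ge_0 b); lra).
  destruct (Hf (e / (2 * B))) as [d1 [P1 K1]]. { apply Rdiv_lt_0_compat; lra. }
  destruct (Hg (e / (2 * (A + 1)))) as [d2 [P2 K2]]. { apply Rdiv_lt_0_compat; lra. }
  destruct (cder_lip g z b Hg) as [d3 [P3 K3]].
  assert (P4 : 0 < d1 / B) by (apply Rdiv_lt_0_compat; lra).
  exists (Rmin (d1 / B) (Rmin d2 d3)); split; [repeat apply Rmin_glb_lt; auto|]. intros h Hh.
  assert (h1 := Rlt_le_trans _ _ _ Hh (Rmin_l _ _)). assert (h23 := Rlt_le_trans _ _ _ Hh (Rmin_r _ _)).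
  assert (h2 := Rlt_le_trans _ _ _ h23 (Rmin_l _ _)). assert (h3 := Rlt_le_trans _ _ _ h23 (Rmin_r _ _)).
  specialize (K2 h h2). specialize (K3 h h3). fold B in K3.
  set (k := (g (z + h) - g z)%C) in *.
  assert (Kk : Cmod k < d1).
  { eapply Rle_lt_trans; [exact K3|]. apply Rmult_lt_reg_r with (/ B); [now apply Rinv_0_lt_compat|].
    replace (B * Cmod h * / B) with (Cmod h) by (field; lra). exact h1. }
  specialize (K1 k Kk). replace (g z + k)%C with (g (z + h)%C) in K1 by (unfold k; ring).
  replace (f (g (z + h)) - f (g z) - a * b * h)%C
    with ((f (g (z + h)) - f (g z) - a * k) + a * (k - b * h))%C by ring.
  eapply Rle_trans; [apply Cmod_triangle|]. rewrite Cmod_mult. fold A.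
  assert (Q := Cmod_ge_0 h).
  assert (S1 : e / (2 * B) * Cmod k <= e / 2 * Cmod h).
  { apply Rle_trans with (e / (2 * B) * (B * Cmod h)).
    apply Rmult_le_compat_l; auto. apply Rlt_le, Rdiv_lt_0_compat; lra. right; field; lra. }
  assert (S2 : A * Cmod (k - b * h) <= e / 2 * Cmod h).
  { apply Rle_trans with ((A + 1) * (e / (2 * (A + 1)) * Cmod h)).
    - apply Rmult_le_compat; auto; [apply Cmod_ge_0|lra].
    - right; field; lra. }
  lra.
Qed.

Lemma cder_sqr z : cder (fun x => x * x)%C z (2 * z)%C.
Proof.
  intros e He; exists e; split; auto. intros h Hh.
  replace ((z + h) * (z + h) - z * z - 2 * z * h)%C with (h * h)%C by ring.
  rewrite Cmod_mult. apply Rmult_le_compat_r; [apply Cmod_ge_0|lra].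
Qed.

Lemma cder_scal c f z a : cder f z a -> cder (fun x => c * f x)%C z (c * a)%C.
Proof.
  intros H. apply (cder_comp (fun x => c * x)%C); auto.
  intros e He; exists 1; split; [lra|]. intros h _.
  replace (c * (f z + h) - c * f z - c * h)%C with (RtoC 0) by ring. rewrite Cmod_0.
  apply Rmult_le_pos; [lra|apply Cmod_ge_0].
Qed.

Lemma cder_minus f g z a b : cder f z a -> cder g z b -> cder (fun x => f x - g x)%C z (a - b)%C.
Proof.
  intros H1 H2. apply cder_ext with (fun x => f x + (-(1)) * g x)%C; [intros; ring|].
  replace (a - b)%C with (a + (-(1)) * b)%C by ring. apply cder_plus; auto. now apply cder_scal.
Qed.

Lemma RtoC_neq0 x : x <> 0 -> RtoC x <> RtoC 0.
Proof. intros H E; apply H. now apply RtoC_inj in E. Qed.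

(* Polarisation reduces products to squares. *)
Lemma cder_mult f g z a b : cder f z a -> cder g z b -> cder (fun x => f x * g x)%C z (a * g z + f z * b)%C.
Proof.
  intros H1 H2.
  assert (N2 : RtoC 2 <> RtoC 0) by (apply RtoC_neq0; lra).
  assert (N4 : RtoC 4 <> RtoC 0) by (apply RtoC_neq0; lra).
  apply cder_ext with (fun x => / 4 * ((f x + g x) * (f x + g x) - (f x - g x) * (f x - g x)))%C.
  { intros; field; auto. }
  replace (a * g z + f z * b)%C
    with (/ 4 * (2 * (f z + g z) * (a + b) - 2 * (f z - g z) * (a - b)))%C by (field; auto).
  apply cder_scal, cder_minus.
  - apply (cder_comp (fun x => x * x)%C (fun x => f x + g x)%C); [now apply cder_plus | apply cder_sqr].
  - apply (cder_comp (fun x => x * x)%C (fun x => f x - g x)%C); [now apply cder_minus | apply cder_sqr].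
Qed.

Lemma cder_inv z : z <> RtoC 0 -> cder (fun x => / x)%C z (- / (z * z))%C.
Proof.
  intros Hz e He. assert (P := proj1 (Cmod_gt_0 z) Hz). set (r := Cmod z) in *.
  assert (Pe : 0 < e * (r * r * r) / 2). { assert (0 < r * r * r) by (apply Rmult_lt_0_compat; nra). nra. }
  exists (Rmin (r / 2) (e * (r * r * r) / 2)); split; [apply Rmin_glb_lt; lra|]. intros h Hh.
  assert (h1 := Rlt_le_trans _ _ _ Hh (Rmin_l _ _)). assert (h2 := Rlt_le_trans _ _ _ Hh (Rmin_r _ _)).
  assert (L : r / 2 < Cmod (z + h)%C).
  { assert (T := Cmod_triang_inv z (-h)%C). rewrite Cmod_opp in T. replace (z - - h)%C with (z + h)%C in T by ring.
    fold r in T. lra. }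
  assert (Hw : (z + h)%C <> RtoC 0) by (apply Cmod_gt_0; lra).
  replace (/ (z + h) - / z - - / (z * z) * h)%C with (h * h / (z * z * (z + h)))%C by (field; auto).
  rewrite Cmod_div by (repeat apply Cmult_neq_0; auto). rewrite !Cmod_mult. fold r.
  assert (Q := Cmod_ge_0 h).
  apply Rmult_le_reg_r with (r * r * Cmod (z + h)%C); [apply Rmult_lt_0_compat; nra|].
  unfold Rdiv. rewrite Rmult_assoc, Rinv_l, Rmult_1_r.
  2:{ apply Rgt_not_eq. apply Rmult_lt_0_compat; nra. }
  replace (e * Cmod h * (r * r * Cmod (z + h)%C)) with (Cmod h * (e * (r * r * Cmod (z + h)%C))) by ring.
  apply Rmult_le_compat_l; auto. apply Rle_trans with (e * (r * r * r) / 2); [lra|].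
  replace (e * (r * r * r) / 2) with (e * (r * r * (r / 2))) by field.
  apply Rmult_le_compat_l; [lra|]. apply Rmult_le_compat_l; [nra|lra].
Qed.

Lemma cder_unique f z a b : cder f z a -> cder f z b -> a = b.
Proof.
  intros H1 H2. apply cder_is_derive in H1, H2. apply is_C_derive_unique in H1, H2. congruence.
Qed.

(** The half plane is convex, so f can be followed along the segment from z to w, where its real and
    imaginary parts (the two choices of [p]) are real functions with derivative 0. *)
Lemma cder_zero_const (f : C -> C) : (forall z, in_H z -> cder f z (RtoC 0)) ->
  forall z w, in_H z -> in_H w -> f z = f w.
Proof.
  intros H z w Hz Hw. set (v := (w - z)%C).
  assert (HH : forall t, 0 <= t <= 1 -> in_H (z + RtoC t * v)%C).
  { intros t Ht. unfold in_H in *. unfold v. destruct z as [x y], w as [x' y']. unfold Im in *; simpl in *. nra. }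
  assert (L : forall (p : C -> R), (forall c, Rabs (p c) <= Cmod c) -> (forall a b, p (a - b)%C = p a - p b) ->
            p (f z) = p (f w)).
  { intros p Hp Lp.
    assert (E : p (f (z + RtoC 0 * v)%C) = p (f (z + RtoC 1 * v)%C)).
    { apply (eq_is_derive (fun t => p (f (z + RtoC t * v)%C))); [|lra].
      intros t Ht. split; [apply @is_linear_scal_l|].
      intros x Hx. apply (@is_filter_lim_locally_unique R_AbsRing (AbsRing_NormedModule R_AbsRing)) in Hx. subst x.
      intros e. set (V := Cmod v + 1). assert (PV : 0 < V) by (unfold V; generalize (Cmod_ge_0 v); lra).
      destruct (H _ (HH t Ht) (e / V)) as [d [Hd K]].
      { apply Rdiv_lt_0_compat; auto. apply cond_pos. }
      assert (Hd' : 0 < d / V) by (apply Rdiv_lt_0_compat; auto).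
      exists (mkposreal _ Hd'). intros s Hs. change (Rabs (s - t) < d / V) in Hs.
      change (Rabs ((p (f (z + RtoC s * v)%C) - p (f (z + RtoC t * v)%C)) - (s - t) * 0) <= e * Rabs (s - t)).
      rewrite Rmult_0_r, Rminus_0_r, <- Lp.
      specialize (K (RtoC (s - t) * v)%C).
      assert (M : Cmod (RtoC (s - t) * v)%C <= Rabs (s - t) * V).
      { rewrite Cmod_mult, Cmod_R. apply Rmult_le_compat_l; [apply Rabs_pos|unfold V; lra]. }
      replace (z + RtoC t * v + RtoC (s - t) * v)%C with (z + RtoC s * v)%C in K by (rewrite RtoC_minus; ring).
      eapply Rle_trans; [apply Hp|].
      rewrite Cmult_0_l in K. unfold Cminus at 1 in K. rewrite Copp_0, Cplus_0_r in K.
      eapply Rle_trans; [apply K|].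
      - eapply Rle_lt_trans; [exact M|]. apply Rmult_lt_reg_r with (/ V); [now apply Rinv_0_lt_compat|].
        replace (Rabs (s - t) * V * / V) with (Rabs (s - t)) by (field; lra). exact Hs.
      - apply Rle_trans with (e / V * (Rabs (s - t) * V)).
        + apply Rmult_le_compat_l; auto. apply Rlt_le, Rdiv_lt_0_compat; auto; apply cond_pos.
        + right; field; lra. }
    replace (z + RtoC 0 * v)%C with z in E by ring. replace (z + RtoC 1 * v)%C with w in E by (unfold v; ring).
    exact E. }
  assert (E1 := L Re re_le_Cmod (fun a b => eq_refl)).
  assert (E2 := L Im im_le_Cmod (fun a b => eq_refl)).
  destruct (f z), (f w); simpl in *. now f_equal.
Qed.

Lemma qexp_plus z w : qexp (z + w)%C = (qexp z * qexp w)%C.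
Proof.
  unfold qexp. destruct z as [x y], w as [x' y']. unfold Re, Im, Cplus, Cmult; simpl.
  replace (-(2 * PI * (y + y'))) with (-(2*PI*y) + -(2*PI*y')) by ring.
  replace (2 * PI * (x + x')) with (2*PI*x + 2*PI*x') by ring.
  rewrite exp_plus, cos_plus, sin_plus. f_equal; ring.
Qed.

Lemma qexp_0 : qexp (RtoC 0) = RtoC 1.
Proof. unfold qexp, RtoC, Re, Im; simpl. rewrite !Rmult_0_r, Ropp_0, exp_0, cos_0, sin_0. f_equal; ring. Qed.

Lemma qexp_1 : qexp (RtoC 1) = RtoC 1.
Proof.
  unfold qexp, RtoC, Re, Im; simpl. rewrite !Rmult_0_r, Ropp_0, exp_0, Rmult_1_r, cos_2PI, sin_2PI. f_equal; ring.
Qed.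

Lemma qexp_half : qexp (RtoC (1/2)) = RtoC (-1).
Proof.
  unfold qexp, RtoC, Re, Im; simpl. rewrite !Rmult_0_r, Ropp_0, exp_0.
  replace (2 * PI * (1/2)) with PI by field. rewrite cos_PI, sin_PI. f_equal; ring.
Qed.

Lemma Cmod_qexp z : Cmod (qexp z) = exp (- (2 * PI * Im z)).
Proof.
  assert (P := exp_pos (- (2 * PI * Im z))).
  assert (E : Cmod (qexp z) ^ 2 = exp (- (2 * PI * Im z)) ^ 2).
  { rewrite Cmod2_alt. unfold qexp, Re at 1, Im at 2. simpl.
    set (a := exp _). set (t := 2 * PI * Re z).
    assert (Q := sin2_cos2 t). unfold Rsqr in Q. 
    replace (a * cos t * (a * cos t * 1) + a * sin t * (a * sin t * 1)) with (a * a * (sin t * sin t + cos t * cos t)) by ring.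
    rewrite Q; ring. }
  apply Rsqr_inj; auto using Cmod_ge_0; [lra|]. unfold Rsqr. simpl in E. lra.
Qed.

Lemma qexp_nz z : qexp z <> RtoC 0.
Proof. apply Cmod_gt_0. rewrite Cmod_qexp. apply exp_pos. Qed.

Lemma qexp_opp z : (qexp (- z) = / qexp z)%C.
Proof.
  assert (E : (qexp z * qexp (- z) = 1)%C) by (rewrite <- qexp_plus, Cplus_opp_r, qexp_0; auto).
  assert (N := qexp_nz z). replace (qexp (-z)%C) with (qexp z * qexp (- z) / qexp z)%C by (field; auto).
  rewrite E; field; auto.
Qed.

Lemma qexp_pow z n : (qexp z ^ n = qexp (RtoC (INR n) * z))%C.
Proof.
  induction n as [|n IH]. simpl. now rewrite Cmult_0_l, qexp_0.
  rewrite Cpow_S, IH, S_INR, RtoC_plus, <- qexp_plus. f_equal. ring.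
Qed.

Lemma qexp_INR n : qexp (RtoC (INR n)) = RtoC 1.
Proof. rewrite <- (Cmult_1_r (RtoC (INR n))), <- qexp_pow, qexp_1. apply Cpow_1_l. Qed.

Lemma qexp_IZR n : qexp (RtoC (IZR n)) = RtoC 1.
Proof.
  destruct (Z_le_gt_dec 0 n) as [L|L].
  - rewrite <- (Z2Nat.id n) by auto. rewrite <- INR_IZR_INZ. apply qexp_INR.
  - replace (RtoC (IZR n)) with (- RtoC (IZR (- n)))%C by (rewrite opp_IZR, RtoC_opp; ring).
    rewrite qexp_opp. rewrite <- (Z2Nat.id (- n)) by lia. rewrite <- INR_IZR_INZ, qexp_INR. field.
Qed.

Lemma exp_taylor1 x : Rabs x <= 1/2 -> Rabs (exp x - 1 - x) <= 2 * (x * x).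
Proof.
  intros H. assert (H' := Rabs_le_between x (1/2)). destruct H' as [H' _]. specialize (H' H).
  assert (A := exp_ineq1_le x). assert (B := exp_ineq1_le (-x)).
  assert (E : exp x * exp (-x) = 1) by (rewrite <- exp_plus, Rplus_opp_r; apply exp_0).
  rewrite Rabs_pos_eq by lra.
  assert (exp x * (1 - x) <= 1). { rewrite <- E. apply Rmult_le_compat_l; [apply Rlt_le, exp_pos|lra]. }
  assert (exp x - 1 - x <= exp x * (x * x)) by (assert (0 < exp x) by apply exp_pos; nra).
  assert (exp x <= 2) by nra.
  nra.
Qed.

Lemma sin_le_Rabs x : Rabs (sin x) <= Rabs x.
Proof.
  destruct (MVT_gen sin 0 x cos) as [c [_ E]].
  - intros; apply is_derive_sin.
  - intros; apply continuity_sin.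
  - rewrite sin_0, !Rminus_0_r in E. rewrite E, Rabs_mult.
    rewrite <- (Rmult_1_l (Rabs x)) at 2. apply Rmult_le_compat_r; [apply Rabs_pos|].
    apply Rabs_le. generalize (COS_bound c); lra.
Qed.

Lemma cos_taylor1 x : Rabs (cos x - 1) <= x * x / 2.
Proof.
  assert (E : cos x - 1 = - (2 * (sin (x/2) * sin (x/2)))).
  { replace x with (2 * (x/2)) at 1 by field. rewrite cos_2a_sin. ring. }
  rewrite E, Rabs_Ropp. assert (S := sin_le_Rabs (x/2)).
  rewrite Rabs_pos_eq by nra.
  assert (Q : sin (x/2) * sin (x/2) <= (x/2) * (x/2)).
  { apply Rsqr_le_abs_1 in S. exact S. }
  lra.
Qed.

Lemma sin_taylor1 x : Rabs x <= 1 -> Rabs (sin x - x) <= x * x / 2.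
Proof.
  intros H.
  destruct (MVT_gen (fun t => sin t - t) 0 x (fun t => cos t - 1)) as [c [Hc E]].
  - intros. apply (is_derive_minus (V:=R_NormedModule) sin (fun t => t)); [apply is_derive_sin|apply @is_derive_id].
  - intros. apply continuity_pt_minus; [apply continuity_sin|apply continuity_pt_id].
  - rewrite sin_0, !Rminus_0_r in E. rewrite E, Rabs_mult.
    assert (B := cos_taylor1 c).
    assert (Cc : c * c <= x * x).
    { destruct (Rle_dec 0 x); [rewrite Rmin_left, Rmax_right in Hc by lra|rewrite Rmin_right, Rmax_left in Hc by lra]; nra. }
    apply Rle_trans with (x * x / 2 * 1); [|lra].
    apply Rmult_le_compat; auto using Rabs_pos. lra.
Qed.

Definition twopii : C := (RtoC (2 * PI) * Ci)%C.

Lemma qexp_taylor1 : exists d K, 0 < d /\ 0 < K /\ forall h, Cmod h < d ->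
  Cmod (qexp h - 1 - twopii * h)%C <= K * (Cmod h * Cmod h).
Proof.
  assert (PP := PI_RGT_0).
  (* The radius keeps M = 2 pi |h| below 1/2, the range of [exp_taylor1]. The constant is 25 (2
     pi)^2, while the two components are bounded by 4 M^2 and 10 M^2. *)
  exists (1 / (4 * PI)), (100 * (PI * PI)). split; [|split].
  - apply Rdiv_lt_0_compat; lra.
  - nra.
  - intros h Hh. eapply Rle_trans; [apply Cmod_le_Re_Im|].
    set (t := 2 * PI * Re h). set (s := 2 * PI * Im h).
    assert (m := Cmod_ge_0 h).
    assert (HB : 2 * PI * Cmod h <= 1/2).
    { apply Rmult_lt_compat_l with (r := 2 * PI) in Hh; [|lra].
      replace (2 * PI * (1 / (4 * PI))) with (1/2) in Hh by (field; lra). lra. }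
    assert (Ht : Rabs t <= 2 * PI * Cmod h).
    { unfold t. rewrite Rabs_mult, (Rabs_pos_eq (2 * PI)) by lra. apply Rmult_le_compat_l; [lra|apply re_le_Cmod]. }
    assert (Hs : Rabs s <= 2 * PI * Cmod h).
    { unfold s. rewrite Rabs_mult, (Rabs_pos_eq (2 * PI)) by lra. apply Rmult_le_compat_l; [lra|apply im_le_Cmod]. }
    set (M := 2 * PI * Cmod h) in *. assert (PM : 0 <= M) by (unfold M; nra).
    replace (100 * (PI * PI) * (Cmod h * Cmod h)) with (25 * (M * M)) by (unfold M; ring).
    replace (Re (qexp h - 1 - twopii * h)%C) with (exp (-s) * cos t - 1 + s).
    2:{ unfold s, t, qexp, twopii; destruct h; unfold Re, Im; simpl. ring. }
    replace (Im (qexp h - 1 - twopii * h)%C) with (exp (-s) * sin t - t).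
    2:{ unfold s, t, qexp, twopii; destruct h; unfold Re, Im; simpl. ring. }
    assert (E := exp_taylor1 (-s)). rewrite Rabs_Ropp in E. specialize (E ltac:(lra)).
    assert (Cc := cos_taylor1 t). assert (Ss := sin_taylor1 t ltac:(lra)).
    assert (t2 : t * t <= M * M). { apply Rsqr_le_abs_1. now rewrite (Rabs_pos_eq M). }
    assert (s2 : s * s <= M * M). { apply Rsqr_le_abs_1. now rewrite (Rabs_pos_eq M). }
    assert (b1 := proj1 (Rabs_le_between _ _) E). assert (b2 := proj1 (Rabs_le_between _ _) Cc).
    assert (b3 := proj1 (Rabs_le_between _ _) Ss).
    assert (b4 := proj1 (Rabs_le_between _ _) Ht). assert (b5 := proj1 (Rabs_le_between _ _) Hs).
    set (a := exp (-s)) in *. assert (pa := exp_pos (-s)). fold a in pa.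
    assert (a2 : a <= 2) by nra.
    assert (B1 : Rabs (a * cos t - 1 + s) <= 4 * (M * M)).
    { replace (a * cos t - 1 + s) with ((a - 1 - - s) + a * (cos t - 1)) by ring.
      eapply Rle_trans; [apply Rabs_triang|]. rewrite Rabs_mult, (Rabs_pos_eq a) by lra.
      assert (a * Rabs (cos t - 1) <= 2 * (M * M / 2)) by (apply Rmult_le_compat; auto using Rabs_pos; lra). lra. }
    assert (B2 : Rabs (a * sin t - t) <= 10 * (M * M)).
    { replace (a * sin t - t) with (a * (sin t - t) + (a - 1) * t) by ring.
      eapply Rle_trans; [apply Rabs_triang|]. rewrite !Rabs_mult, (Rabs_pos_eq a) by lra.
      assert (a * Rabs (sin t - t) <= 2 * (M * M / 2)) by (apply Rmult_le_compat; auto using Rabs_pos; lra).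
      assert (Rabs (a - 1) <= 3 * M). { apply Rabs_le. nra. }
      assert (Rabs (a - 1) * Rabs t <= 3 * M * M) by (apply Rmult_le_compat; auto using Rabs_pos). lra. }
    lra.
Qed.

Lemma cder_qexp z : cder qexp z (twopii * qexp z)%C.
Proof.
  intros e He. destruct qexp_taylor1 as [d [K [Pd [PK HK]]]].
  assert (Pq := proj1 (Cmod_gt_0 _) (qexp_nz z)).
  assert (P : 0 < e / (K * Cmod (qexp z))) by (apply Rdiv_lt_0_compat; auto; nra).
  exists (Rmin d (e / (K * Cmod (qexp z)))); split; [apply Rmin_glb_lt; auto|]. intros h Hh.
  assert (h1 := Rlt_le_trans _ _ _ Hh (Rmin_l _ _)). assert (h2 := Rlt_le_trans _ _ _ Hh (Rmin_r _ _)).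
  specialize (HK h h1). rewrite qexp_plus.
  replace (qexp z * qexp h - qexp z - twopii * qexp z * h)%C with (qexp z * (qexp h - 1 - twopii * h))%C by ring.
  rewrite Cmod_mult. assert (Q := Cmod_ge_0 h).
  apply Rle_trans with (Cmod (qexp z) * (K * (Cmod h * Cmod h))); [apply Rmult_le_compat_l; lra|].
  replace (Cmod (qexp z) * (K * (Cmod h * Cmod h))) with ((K * Cmod (qexp z)) * Cmod h * Cmod h) by ring.
  apply Rmult_le_compat_r; auto.
  apply Rle_trans with ((K * Cmod (qexp z)) * (e / (K * Cmod (qexp z)))).
  - apply Rmult_le_compat_l; [nra|lra].
  - right; field; lra.
Qed.

(** * Partial fractions of the cotangent *)

(** Compared with the telescoping series of 2 (1/n - 1/(n+1)). *)
Lemma ex_series_inv_sq : ex_series (fun n => / (INR (S n) * INR (S n))).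
Proof.
  assert (H : ex_series (fun n => 2 * (/ INR (S n) - / INR (S (S n))))).
  { apply @ex_series_scal_l with (c := 2). exists 1.
    assert (L : is_lim_seq (fun n => 1 - / INR (S (S n))) (1 - 0)).
    { apply is_lim_seq_minus'; [apply is_lim_seq_const|].
      apply (is_lim_seq_inv (fun n => INR (S (S n))) p_infty); [|easy].
      apply (is_lim_seq_incr_1 (fun n => INR (S n))), (is_lim_seq_incr_1 INR), is_lim_seq_INR. }
    rewrite Rminus_0_r in L.
    apply (is_lim_seq_ext _ (sum_n (fun n => / INR (S n) - / INR (S (S n)))) 1) in L; [exact L|].
    induction n.
    - rewrite sum_O. simpl; lra.
    - rewrite sum_Sn, <- IHn. unfold plus; simpl. ring. }
  apply @ex_series_le with (2 := H). intros n.
  change (Rabs (/ (INR (S n) * INR (S n))) <= 2 * (/ INR (S n) - / INR (S (S n)))).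
  assert (P : 1 <= INR (S n)) by (rewrite S_INR; generalize (pos_INR n); lra).
  rewrite (S_INR (S n)). set (x := INR (S n)) in *.
  rewrite Rabs_pos_eq. 2: apply Rlt_le, Rinv_0_lt_compat; nra.
  replace (2 * (/ x - / (x + 1))) with (2 / (x * (x + 1))) by (field; lra).
  apply Rmult_le_reg_r with (x * x * (x + 1)). nra.
  replace (/ (x * x) * (x * x * (x + 1))) with (x + 1) by (field; lra).
  replace (2 / (x * (x + 1)) * (x * x * (x + 1))) with (2 * x) by (field; lra). lra.
Qed.

Lemma INR_S_ge1 n : 1 <= INR (S n).
Proof. rewrite S_INR; generalize (pos_INR n); lra. Qed.

Lemma inv_sq_nonneg n : 0 <= / (INR (S n) * INR (S n)).
Proof. generalize (INR_S_ge1 n); intros. apply Rlt_le, Rinv_0_lt_compat; nra. Qed.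

Lemma CS_finite u N : (forall j, (N <= j)%nat -> u j = RtoC 0) -> CS u = csum u N.
Proof.
  intros H. apply cser_CS. unfold cser. apply clim_ext_ev with (fun _ => csum u N); [|apply clim_const].
  exists N; intros n Hn. replace n with (N + (n - N))%nat by lia. rewrite csum_app.
  rewrite (csum_0 (fun k => u (N + k)%nat)). ring. intros; apply H; lia.
Qed.

Lemma csum_rev u n : csum (fun j => u (n - 1 - j)%nat) n = csum u n.
Proof.
  revert u; induction n as [|n IH]; intros u; [reflexivity|].
  rewrite csum_Sl. replace (S n - 1 - 0)%nat with n by lia.
  rewrite (csum_ext _ (fun j => u (n - 1 - j)%nat)).
  - rewrite IH. simpl. ring.
  - intros k Hk. f_equal. lia.
Qed.

(* [cotq w] is cot(pi w), written in terms of q = exp(2 pi i w). *)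
Definition cotq (w : C) : C := (Ci * (qexp w + 1) / (qexp w - 1))%C.

Lemma qexp_double w : (qexp (2 * w) = qexp w * qexp w)%C.
Proof. rewrite <- qexp_plus. f_equal; ring. Qed.

Lemma qexp_half_neq w : qexp w <> RtoC 1 -> qexp (w / 2)%C <> RtoC 1.
Proof.
  intros H E. apply H. replace w with (2 * (w / 2))%C by (field; apply RtoC_neq0; lra).
  rewrite qexp_double, E. ring.
Qed.

Lemma qexp_plus1 w : qexp (w + 1)%C = qexp w.
Proof. rewrite qexp_plus, qexp_1. ring. Qed.

Lemma qexp_plus_INR w n : qexp (w + INR n)%C = qexp w.
Proof. rewrite qexp_plus, qexp_INR. ring. Qed.

Lemma C2_nz : RtoC 2 <> RtoC 0.
Proof. apply RtoC_neq0; lra. Qed.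

(** Adding 1/2 to z/2 changes the sign of e = [qexp (z / 2)], so the duplication formula becomes a
    rational identity in e. *)
Lemma cotq_double z : qexp z <> RtoC 1 ->
  (cotq z = / 2 * (cotq (z / 2) + cotq ((z + 1) / 2)))%C.
Proof.
  intros H. assert (N2 := C2_nz).
  assert (E1 : qexp z = (qexp (z / 2) * qexp (z / 2))%C).
  { rewrite <- qexp_double. f_equal. field; auto. }
  assert (E2 : qexp ((z + 1) / 2)%C = (- qexp (z / 2))%C).
  { replace ((z + 1) / 2)%C with (z / 2 + RtoC (1/2))%C.
    - rewrite qexp_plus, qexp_half. ring.
    - rewrite RtoC_div by lra. field; auto. }
  unfold cotq. rewrite E2. rewrite E1 in *. set (e := qexp (z / 2)%C) in *.
  assert (A : (e - 1)%C <> RtoC 0).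
  { intros E. apply H. apply Ceq_minus in E. rewrite E. ring. }
  assert (B : (e + 1)%C <> RtoC 0).
  { intros E. apply H. replace e with (- (1))%C. ring. apply Ceq_minus. 
    replace (- (1) - e)%C with (- (e + 1))%C by ring. rewrite E. ring. }
  field. repeat split; auto.
  - replace (- e - 1)%C with (- (e + 1))%C by ring. intros E. apply B. 
    replace (e + 1)%C with (- - (e + 1))%C by ring. rewrite E. ring.
  - replace (e * e - 1)%C with ((e - 1) * (e + 1))%C by ring. now apply Cmult_neq_0.
Qed.

Lemma INR_pow2_pos k : 0 < INR (2 ^ k).
Proof. apply lt_0_INR. induction k; simpl; lia. Qed.

Lemma RtoC_pow2_nz k : RtoC (INR (2 ^ k)) <> RtoC 0.
Proof. apply RtoC_neq0. generalize (INR_pow2_pos k); lra. Qed.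

Lemma qexp_dyadic_neq z k : qexp z <> RtoC 1 -> qexp (z / INR (2 ^ k))%C <> RtoC 1.
Proof.
  intros H. induction k.
  - simpl. replace (z / 1)%C with z by (field; apply RtoC_neq0; lra). exact H.
  - apply qexp_half_neq in IHk. intros E; apply IHk. rewrite <- E. f_equal.
    replace (2 ^ S k)%nat with (2 * 2 ^ k)%nat by (simpl; lia). rewrite mult_INR, RtoC_mult.
    simpl (INR 2). replace (RtoC (1+1)) with (RtoC 2) by (f_equal; lra). field. apply RtoC_pow2_nz.
Qed.

Lemma cotq_dyadic z k : qexp z <> RtoC 1 ->
  (INR (2 ^ k) * cotq z = csum (fun j => cotq ((z + INR j) / INR (2 ^ k))) (2 ^ k))%C.
Proof.
  intros H. assert (N2 := C2_nz). induction k as [|k IH].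
  - simpl. unfold Cdiv. rewrite Cplus_0_l, Cplus_0_r, Cmult_1_l. f_equal. field.
  - replace (2 ^ S k)%nat with (2 * 2 ^ k)%nat by (simpl; lia). set (h := (2 ^ k)%nat) in *.
    assert (Nh : RtoC (INR h) <> RtoC 0) by apply RtoC_pow2_nz.
    rewrite mult_INR, RtoC_mult. simpl (INR 2). replace (RtoC (1 + 1)) with (RtoC 2) by (f_equal; lra).
    rewrite <- Cmult_assoc, IH. replace (2 * h)%nat with (h + h)%nat by lia.
    rewrite csum_app, <- csum_plus, <- csum_scal. apply csum_ext. intros j _.
    rewrite cotq_double.
    + rewrite plus_INR, RtoC_plus.
      replace ((z + INR j) / INR h / 2)%C with ((z + INR j) / (2 * INR h))%C by (field; auto).
      replace (((z + INR j) / INR h + 1) / 2)%C with ((z + (INR h + INR j)) / (2 * INR h))%C by (field; auto).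
      field; auto.
    + apply qexp_dyadic_neq. now rewrite qexp_plus_INR.
Qed.

(** By the period 1 of [cotq], the 2h shifts in [cotq_dyadic] may be taken from -h to h - 1. This
    pairs j with -j, as in the partial fractions, and leaves the shifts 0 and -h unpaired. *)
Lemma cotq_dyadic_sym z k : qexp z <> RtoC 1 ->
  let h := (2 ^ k)%nat in
  (2 * INR h * cotq z = cotq (z / (2 * INR h)) +
    csum (fun j => cotq ((z + INR (S j)) / (2 * INR h)) + cotq ((z - INR (S j)) / (2 * INR h))) (h - 1)
    + cotq (z / (2 * INR h) - / 2))%C.
Proof.
  intros H h. assert (N2 := C2_nz). assert (Nh : RtoC (INR h) <> RtoC 0) by apply RtoC_pow2_nz.
  assert (E := cotq_dyadic z (S k) H).
  replace (2 ^ S k)%nat with (2 * h)%nat in E by (unfold h; simpl; lia).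
  rewrite mult_INR, RtoC_mult in E. simpl (INR 2) in E. replace (RtoC (1 + 1)) with (RtoC 2) in E by (f_equal; lra).
  rewrite E. replace (2 * h)%nat with (h + h)%nat by lia. rewrite csum_app. clear E.
  assert (Hh : h <> O).
  { generalize (INR_pow2_pos k); fold h; intros Q; intros Q'; rewrite Q' in Q; simpl in Q; lra. }
  clearbody h.
  rewrite <- (csum_rev (fun k0 => cotq ((z + INR (h + k0)%nat) / (2 * INR h))%C) h).
  rewrite (csum_ext (fun j => cotq ((z + INR (h + (h - 1 - j))%nat) / (2 * INR h))%C)
             (fun j => cotq ((z - INR (S j)) / (2 * INR h))%C)).
  - destruct h as [|h']; [easy|]. replace (S h' - 1)%nat with h' by lia.
    rewrite (csum_Sl (fun j => cotq ((z + INR j) / (2 * INR (S h')))%C)). simpl (INR 0). rewrite Cplus_0_r.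
    rewrite csum_plus.
    replace (z / (2 * INR (S h')) - / 2)%C with ((z - INR (S h')) / (2 * INR (S h')))%C by (field; auto).
    change (csum (fun j => cotq ((z - INR (S j)) / (2 * INR (S h')))%C) (S h'))
      with (csum (fun j => cotq ((z - INR (S j)) / (2 * INR (S h')))%C) h' + cotq ((z - INR (S h')) / (2 * INR (S h'))))%C.
    ring.
  - intros j Hj.
    replace (cotq ((z + INR (h + (h - 1 - j))%nat) / (2 * INR h))%C)
      with (cotq ((z - INR (S j)) / (2 * INR h) + 1)%C).
    + unfold cotq. now rewrite qexp_plus1.
    + f_equal. replace (h + (h - 1 - j))%nat with (2 * h - S j)%nat by lia.
      rewrite minus_INR, mult_INR by lia. rewrite RtoC_minus, RtoC_mult. simpl (INR 2).
      replace (RtoC (1 + 1)) with (RtoC 2) by (f_equal; lra). field; auto.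
Qed.

(** At x = 12/5 the factor 1 - x^2/6 is exactly 1/25. The range contains 3 pi/5 already by the crude
    bound pi <= 4. *)
Lemma sin_lower x : 0 <= x -> x <= 12/5 -> x <= PI -> x / 25 <= sin x.
Proof.
  intros H0 H1 H2. destruct (SIN x H0 H2) as [L _]. eapply Rle_trans; [|exact L].
  unfold sin_lb, sin_approx, sin_term; simpl.
  assert (0 <= x ^ 5 /120 - x^7 / 5040).
  { replace (x ^ 5 /120 - x^7 / 5040) with (x * ((x * x) * (x * x)) * ((42 - x * x) / 5040)) by field.
    apply Rmult_le_pos; [apply Rmult_le_pos; nra|]. nra. }
  assert (x / 25 <= x - x ^ 3 / 6). { replace (x - x ^ 3 / 6) with (x * (1 - x * x / 6)) by field. nra. }
  lra.
Qed.

(** For w = u + iv and a = |qexp w|, |qexp w - 1|^2 = (1 - a)^2 + 4 a sin(pi u)^2; the first term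
    controls v, the second u. The rectangle meets the integers only at 0 and contains every (z +
    j)/(2h) with |j| <= h and 10 |z| < h. *)
Lemma qexp_minus1_lower w : Rabs (Re w) <= 3/5 -> Rabs (Im w) <= 1/10 -> Cmod w / 100 <= Cmod (qexp w - 1)%C.
Proof.
  intros Hu Hv. assert (PP := PI_RGT_0). assert (P4 := PI_4). assert (P3 := PI2_3_2). unfold PI2 in P3.
  assert (Q : (Cmod w / 100) ^ 2 <= Cmod (qexp w - 1)%C ^ 2).
  { unfold Rdiv. rewrite Rpow_mult_distr, !Cmod2_alt.
    set (u := Re w) in *. set (v := Im w) in *.
    set (a := exp (- (2 * PI * v))).
    replace (Re (qexp w - 1)%C) with (a * cos (2 * PI * u) - 1).
    2:{ unfold a, u, v, qexp; destruct w; unfold Re, Im; simpl; ring. }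
    replace (Im (qexp w - 1)%C) with (a * sin (2 * PI * u)).
    2:{ unfold a, u, v, qexp; destruct w; unfold Re, Im; simpl; ring. }
    assert (SC := sin2_cos2 (2 * PI * u)). unfold Rsqr in SC.
    assert (Cc : cos (2 * PI * u) = 1 - 2 * sin (PI * u) * sin (PI * u)).
    { rewrite <- cos_2a_sin. f_equal; ring. }
    replace ((a * cos (2 * PI * u) - 1) ^ 2 + (a * sin (2 * PI * u)) ^ 2)
      with ((1 - a) * (1 - a) + 4 * a * (sin (PI * u) * sin (PI * u))).
    2:{ replace ((a * cos (2 * PI * u) - 1) ^ 2 + (a * sin (2 * PI * u)) ^ 2)
          with (a * a * (sin (2 * PI * u) * sin (2 * PI * u) + cos (2 * PI * u) * cos (2 * PI * u)) - 2 * a * cos (2 * PI * u) + 1) by ring.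
        rewrite SC, Cc. ring. }
    assert (Bv := proj1 (Rabs_le_between _ _) Hv). assert (Bu := proj1 (Rabs_le_between _ _) Hu).
    set (s := 2 * PI * v) in *. assert (Bs : -(4/5) <= s <= 4/5) by (unfold s; nra).
    assert (A1 := exp_ineq1_le (-s)). fold a in A1.
    assert (a15 : 1/5 <= a) by lra.
    assert (Ea : a * exp s = 1) by (unfold a; rewrite <- exp_plus, Rplus_opp_l; apply exp_0).
    assert (A2 := exp_ineq1_le s).
    assert (D : s * s / 25 <= (1 - a) * (1 - a)).
    { destruct (Rle_dec 0 s).
      - assert (s / 5 <= 1 - a) by nra. nra.
      - assert (- s <= a - 1) by lra. nra. }
    assert (Sn : (PI * u / 25) * (PI * u / 25) <= sin (PI * u) * sin (PI * u)).
    { destruct (Rle_dec 0 u).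
      - assert (PI * u / 25 <= sin (PI * u)) by (apply sin_lower; nra).
        assert (0 <= PI * u / 25) by nra. nra.
      - assert (T : PI * (-u) / 25 <= sin (PI * (-u))) by (apply sin_lower; nra).
        replace (PI * - u) with (- (PI * u)) in T by ring. rewrite sin_neg in T.
        assert (0 <= - (PI * u) / 25) by nra. nra. }
    assert (S2 : 36 * (v * v) <= s * s).
    { unfold s. replace (2 * PI * v * (2 * PI * v)) with ((4 * (PI * PI)) * (v * v)) by ring.
      apply Rmult_le_compat_r; nra. }
    assert (S3 : 9 * (u * u) / 625 <= sin (PI * u) * sin (PI * u)).
    { eapply Rle_trans; [|exact Sn].
      replace (PI * u / 25 * (PI * u / 25)) with ((PI * PI) * (u * u) / 625) by field.
      assert (0 <= u * u) by nra. assert (9 <= PI * PI) by nra. nra. }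
    assert (0 <= u * u) by nra. assert (0 <= v * v) by nra. simpl. nra. }
  apply Rsqr_incr_0.
  - unfold Rsqr. simpl in Q. lra.
  - generalize (Cmod_ge_0 w); lra.
  - apply Cmod_ge_0.
Qed.

Lemma cder_seq f z l (x : nat -> C) : cder f z l -> clim x (RtoC 0) -> (forall k, x k <> RtoC 0) ->
  clim (fun k => ((f (z + x k) - f z) / x k)%C) l.
Proof.
  intros Hf Hx Nx e He. destruct (Hf (e/2)) as [d [Pd K]]; [lra|].
  destruct (Hx d Pd) as [N HN]. exists N; intros n Hn. specialize (HN n Hn).
  replace (x n - 0)%C with (x n) in HN by ring. specialize (K _ HN).
  assert (P := proj1 (Cmod_gt_0 _) (Nx n)).
  replace ((f (z + x n) - f z) / x n - l)%C with ((f (z + x n) - f z - l * x n) / x n)%C by (field; auto).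
  rewrite Cmod_div by auto. apply Rle_lt_trans with (e/2); [|lra].
  apply Rmult_le_reg_r with (Cmod (x n)); auto. unfold Rdiv at 1. rewrite Rmult_assoc, Rinv_l, Rmult_1_r by lra. exact K.
Qed.

Lemma cder_cont_seq f z l (x : nat -> C) : cder f z l -> clim x (RtoC 0) -> clim (fun k => f (z + x k)%C) (f z).
Proof.
  intros Hf Hx e He. destruct (cder_lip _ _ _ Hf) as [d [Pd K]].
  set (A := Cmod l + 1) in *. assert (PA : 0 < A) by (unfold A; generalize (Cmod_ge_0 l); lra).
  assert (P : 0 < Rmin d (e / A)) by (apply Rmin_glb_lt; auto; apply Rdiv_lt_0_compat; auto).
  destruct (Hx _ P) as [N HN]. exists N; intros n Hn. specialize (HN n Hn).
  replace (x n - 0)%C with (x n) in HN by ring.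
  assert (h1 := Rlt_le_trans _ _ _ HN (Rmin_l _ _)). assert (h2 := Rlt_le_trans _ _ _ HN (Rmin_r _ _)).
  eapply Rle_lt_trans; [apply K; auto|]. apply Rmult_lt_reg_r with (/ A); [now apply Rinv_0_lt_compat|].
  replace (A * Cmod (x n) * / A) with (Cmod (x n)) by (field; lra). exact h2.
Qed.

Lemma pow2_gt k : (k < 2 ^ k)%nat.
Proof. induction k; simpl; lia. Qed.

Lemma clim_pow2 c : clim (fun k => (c / (2 * INR (2 ^ k)))%C) (RtoC 0).
Proof.
  intros e He. destruct (nfloor_ex (Cmod c / e)) as [N [_ HN]].
  { apply Rmult_le_pos; [apply Cmod_ge_0|]. apply Rlt_le, Rinv_0_lt_compat; auto. }
  exists (S N); intros n Hn. replace (c / (2 * INR (2 ^ n)) - 0)%C with (c / (2 * INR (2 ^ n)))%C by ring.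
  assert (P := INR_pow2_pos n).
  rewrite Cmod_div by (apply Cmult_neq_0; [apply C2_nz|apply RtoC_pow2_nz]).
  rewrite Cmod_mult, !Cmod_R, !Rabs_pos_eq by lra.
  assert (L : INR (S N) <= INR (2 ^ n)). { apply le_INR. generalize (pow2_gt n); lia. }
  rewrite S_INR in L.
  apply Rmult_lt_reg_r with (2 * INR (2 ^ n)); [lra|].
  unfold Rdiv. rewrite Rmult_assoc, Rinv_l, Rmult_1_r by lra.
  apply Rlt_le_trans with (e * (INR N + 1)); [|nra].
  apply Rmult_lt_compat_l with (r := e) in HN; auto.
  replace (e * (Cmod c / e)) with (Cmod c) in HN by (field; lra). exact HN.
Qed.

Lemma nonint_nz z n : qexp z <> RtoC 1 -> (z + RtoC (IZR n))%C <> RtoC 0.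
Proof.
  intros H E. apply H. replace z with (RtoC (IZR (- n))). apply qexp_IZR.
  replace z with (z + IZR n - IZR n)%C by ring. rewrite E, opp_IZR, RtoC_opp. ring.
Qed.

Lemma nonint_plus_nz z n : qexp z <> RtoC 1 -> (z + INR n)%C <> RtoC 0.
Proof. intros H. rewrite INR_IZR_INZ. now apply nonint_nz. Qed.

Lemma nonint_minus_nz z n : qexp z <> RtoC 1 -> (z - INR n)%C <> RtoC 0.
Proof.
  intros H. rewrite INR_IZR_INZ. replace (z - IZR (Z.of_nat n))%C with (z + IZR (- Z.of_nat n))%C.
  now apply nonint_nz. rewrite opp_IZR, RtoC_opp. ring.
Qed.

Lemma nonint_z_nz z : qexp z <> RtoC 1 -> z <> RtoC 0.
Proof. intros H E. apply H. rewrite E. apply qexp_0. Qed.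

(** For j + 1 > 2|z| the triangle inequality gives the constant 1/2; the finitely many other terms
    are nonzero and contribute a minimum. *)
Lemma linear_lower z : qexp z <> RtoC 1 -> exists d, 0 < d /\ forall j,
   d * INR (S j) <= Cmod (z + INR (S j))%C /\ d * INR (S j) <= Cmod (z - INR (S j))%C.
Proof.
  intros H.
  assert (F : forall N, exists d, 0 < d /\ forall j, (j < N)%nat ->
     d * INR (S j) <= Cmod (z + INR (S j))%C /\ d * INR (S j) <= Cmod (z - INR (S j))%C).
  { induction N as [|N [d [Pd K]]].
    - exists 1; split; [lra|]. intros; lia.
    - assert (P1 := proj1 (Cmod_gt_0 _) (nonint_plus_nz z (S N) H)).
      assert (P2 := proj1 (Cmod_gt_0 _) (nonint_minus_nz z (S N) H)).
      set (a := Cmod (z + INR (S N))%C) in *. set (b := Cmod (z - INR (S N))%C) in *.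
      assert (Q := INR_S_ge1 N).
      assert (T : forall c, 0 < c -> 0 < c / INR (S N)) by (intros; apply Rdiv_lt_0_compat; lra).
      exists (Rmin d (Rmin (a / INR (S N)) (b / INR (S N)))).
      split; [repeat apply Rmin_glb_lt; auto|].
      intros j Hj. assert (R := INR_S_ge1 j).
      assert (L1 := Rmin_l d (Rmin (a / INR (S N)) (b / INR (S N)))).
      assert (L2 := Rmin_r d (Rmin (a / INR (S N)) (b / INR (S N)))).
      assert (L3 := Rmin_l (a / INR (S N)) (b / INR (S N))).
      assert (L4 := Rmin_r (a / INR (S N)) (b / INR (S N))).
      set (m := Rmin d _) in *.
      destruct (Nat.eq_dec j N) as [->|Ne].
      + fold a b. split.
        * apply Rle_trans with (a / INR (S N) * INR (S N)); [apply Rmult_le_compat_r; lra|right; field; lra].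
        * apply Rle_trans with (b / INR (S N) * INR (S N)); [apply Rmult_le_compat_r; lra|right; field; lra].
      + destruct (K j ltac:(lia)) as [K1 K2].
        split; (eapply Rle_trans; [|eassumption]); apply Rmult_le_compat_r; lra. }
  destruct (nfloor_ex (2 * Cmod z)) as [N [_ HN]]; [generalize (Cmod_ge_0 z); lra|].
  destruct (F N) as [d [Pd K]]. exists (Rmin d (1/2)); split; [apply Rmin_glb_lt; lra|].
  intros j. assert (L1 := Rmin_l d (1/2)). assert (L2 := Rmin_r d (1/2)). assert (Q := INR_S_ge1 j).
  destruct (le_lt_dec N j) as [L|L].
  - assert (LL : INR N + 1 <= INR (S j)) by (rewrite S_INR; apply le_INR in L; lra).
    assert (A : Cmod (INR (S j)) = INR (S j)) by (rewrite Cmod_R, Rabs_pos_eq; lra).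
    assert (T1 := Cmod_triang_inv (INR (S j)) (-z)%C). assert (T2 := Cmod_triang_inv (INR (S j)) z).
    rewrite Cmod_opp in T1. rewrite (Cmod_minus_sym (INR (S j)) z) in T2.
    replace (INR (S j) - - z)%C with (z + INR (S j))%C in T1 by ring.
    rewrite A in *. set (m := Rmin d (1/2)) in *. split; nra.
  - destruct (K j L) as [K1 K2].
    split; (eapply Rle_trans; [|eassumption]); apply Rmult_le_compat_r; lra.
Qed.

Lemma qexp_lip : exists d K, 0 < d /\ 0 < K /\ forall h, Cmod h < d -> Cmod (qexp h - 1)%C <= K * Cmod h.
Proof.
  destruct (cder_lip _ _ _ (cder_qexp (RtoC 0))) as [d [Pd K]].
  exists d, (Cmod (twopii * qexp 0) + 1). split; [auto|split].
  - generalize (Cmod_ge_0 (twopii * qexp 0)%C); lra.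
  - intros h Hh. specialize (K h Hh). rewrite Cplus_0_l, qexp_0 in K. rewrite qexp_0. exact K.
Qed.

(** The numerator sees only a + b. For the pair (z + j)/(2h), (z - j)/(2h) this is z/h, whose
    smallness gives the summable bound of order 1/j^2. *)
Lemma cotq_pair a b : qexp a <> RtoC 1 -> qexp b <> RtoC 1 ->
  (cotq a + cotq b = 2 * Ci * (qexp (a + b) - 1) / ((qexp a - 1) * (qexp b - 1)))%C.
Proof.
  intros Ha Hb. unfold cotq. rewrite qexp_plus. field.
  split; intros E; [apply Hb|apply Ha]; now apply Ceq_minus.
Qed.

Lemma twopii_nz : twopii <> RtoC 0.
Proof. apply Cmult_neq_0; [apply RtoC_neq0; generalize PI_RGT_0; lra|]. apply Ci_nz. Qed.

Lemma cotq_small (x : nat -> C) : clim x (RtoC 0) -> (forall k, qexp (x k) <> RtoC 1) ->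
  clim (fun k => x k * cotq (x k))%C (/ PI)%C.
Proof.
  intros Hx Nx.
  assert (Nx0 : forall k, x k <> RtoC 0) by (intros k; now apply nonint_z_nz).
  assert (NP : RtoC PI <> RtoC 0) by (apply RtoC_neq0; generalize PI_RGT_0; lra).
  apply clim_ext with (fun k => (Ci * (qexp (0 + x k) + 1)) * / ((qexp (0 + x k) - qexp 0) / x k))%C.
  - intros k. rewrite Cplus_0_l, qexp_0. unfold cotq. field. repeat split; auto.
    intros E; apply (Nx k); now apply Ceq_minus.
  - replace (/ PI)%C with ((Ci * (qexp 0 + 1)) * / (twopii * qexp 0))%C.
    + apply clim_mult.
      * apply clim_scal, clim_plus; [|apply clim_const]. eapply cder_cont_seq; eauto using cder_qexp.
      * apply clim_inv; [apply Cmult_neq_0; [apply twopii_nz|apply qexp_nz]|].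
        eapply cder_seq; eauto using cder_qexp.
    + rewrite qexp_0. unfold twopii. rewrite RtoC_mult. field. repeat split; auto using Ci_nz, C2_nz.
Qed.

Lemma asum_inv_sq_bound u K : (forall j, Cmod (u j) <= K * / (INR (S j) * INR (S j))) -> asum u.
Proof.
  intros H. apply (asum_le u _ H). apply @ex_series_scal_l with (c := K). apply ex_series_inv_sq.
Qed.

Lemma Cmod_inv_mult_le a b x d : 0 < d -> 0 < x -> d * x <= Cmod a -> d * x <= Cmod b ->
  Cmod (/ (a * b))%C <= / (d * d) * / (x * x).
Proof.
  intros Pd Px Ha Hb. assert (P : 0 < d * x) by nra.
  assert (Na : a <> RtoC 0) by (apply Cmod_gt_0; lra). assert (Nb : b <> RtoC 0) by (apply Cmod_gt_0; lra).
  rewrite Cmod_inv by (now apply Cmult_neq_0). rewrite Cmod_mult.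
  rewrite <- Rinv_mult. apply Rinv_le_contravar; [nra|].
  replace (d * d * (x * x)) with ((d * x) * (d * x)) by ring. apply Rmult_le_compat; lra.
Qed.

(** [cotq_dyadic_sym] is multiplied by pi/(2h) and h runs through powers of two: by [cotq_small]
    each pair tends to its partial fraction, the term of shift 0 tends to 1/z and that of shift -h
    to 0; [cotq_pair] supplies the majorant. *)
Theorem cot_expansion z : qexp z <> RtoC 1 ->
  cser (fun j => / (z + INR (S j)) + / (z - INR (S j)))%C (PI * cotq z - / z)%C.
Proof.
  intros H. assert (PP := PI_RGT_0). assert (NP : RtoC PI <> RtoC 0) by (apply RtoC_neq0; lra).
  assert (Nz := nonint_z_nz z H).
  destruct (linear_lower z H) as [d [Pd Kd]]. destruct qexp_lip as [d1 [K1 [Pd1 [PK1 HK1]]]].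
  (* h > 10|z| puts all arguments into the rectangle of [qexp_minus1_lower]; h > |z|/d1 allows
     [qexp_lip] at z/h. *)
  destruct (nfloor_ex (10 * Cmod z + Cmod z / d1)) as [N0 [_ HN0]].
  { assert (0 <= Cmod z) by apply Cmod_ge_0. assert (0 <= Cmod z / d1) by (apply Rmult_le_pos; auto; apply Rlt_le, Rinv_0_lt_compat; auto). lra. }
  set (h := fun k => (2 ^ (k + S N0))%nat).
  assert (Hh : forall k, 10 * Cmod z + Cmod z / d1 < INR (h k)).
  { intros k. eapply Rlt_le_trans; [exact HN0|]. rewrite <- S_INR. apply le_INR.
    unfold h. generalize (pow2_gt (k + S N0)); lia. }
  assert (Nh : forall k, RtoC (INR (h k)) <> RtoC 0) by (intros; apply RtoC_pow2_nz).
  assert (N2h : forall k, (2 * INR (h k))%C <> RtoC 0) by (intros; apply Cmult_neq_0; auto using C2_nz).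
  assert (Hlim : forall c, clim (fun k => (c / (2 * INR (h k)))%C) (RtoC 0)).
  { intros c. apply (clim_subseq (fun k => c / (2 * INR (2 ^ k)))%C _ (fun k => k + S N0)%nat); [intros; lia|].
    apply clim_pow2. }
  assert (Ndy : forall w k, qexp w <> RtoC 1 -> qexp (w / (2 * INR (h k)))%C <> RtoC 1).
  { intros w k Hw. replace (w / (2 * INR (h k)))%C with (w / INR (2 ^ S (k + S N0)))%C.
    - now apply qexp_dyadic_neq.
    - replace (2 ^ S (k + S N0))%nat with (2 * h k)%nat by (unfold h; simpl; lia).
      rewrite mult_INR, RtoC_mult. simpl (INR 2). now replace (RtoC (1 + 1)) with (RtoC 2) by (f_equal; lra). }
  (* Extending the finite sums by zero gives all k the same index range, as [tannery] requires. *)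
  set (v := fun k j => if (j <? h k - 1)%nat then
     (PI / (2 * INR (h k)) * (cotq ((z + INR (S j)) / (2 * INR (h k))) + cotq ((z - INR (S j)) / (2 * INR (h k)))))%C
     else RtoC 0).
  set (w := fun j => (/ (z + INR (S j)) + / (z - INR (S j)))%C).
  assert (Zp : forall j, qexp (z + INR (S j))%C <> RtoC 1) by (intros; now rewrite qexp_plus_INR).
  assert (Zm : forall j, qexp (z - INR (S j))%C <> RtoC 1).
  { intros j. replace (qexp (z - INR (S j))%C) with (qexp z); auto.
    rewrite <- (qexp_plus_INR (z - INR (S j))%C (S j)). f_equal; ring. }
  assert (T : clim (fun k => CS (v k)) (CS w)).
  (* 40000 is the square of the 200 in the lower bound |z + j|/(200 h) for each denominator; the
     powers of h cancel. *)
  { apply tannery with (fun j => (40000 * PI * K1 * Cmod z * / (d * d)) * / (INR (S j) * INR (S j))).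
    - apply @ex_series_scal_l with (c := 40000 * PI * K1 * Cmod z * / (d * d)). apply ex_series_inv_sq.
    - intros k j. unfold v. assert (PH := Hh k). assert (Q := INR_S_ge1 j).
      assert (PZ := proj1 (Cmod_gt_0 _) Nz).
      assert (PZd : 0 < Cmod z / d1) by (now apply Rdiv_lt_0_compat).
      destruct (Nat.ltb_spec j (h k - 1)) as [L|L].
      2:{ rewrite Cmod_0. apply Rmult_le_pos; [|apply inv_sq_nonneg].
          apply Rmult_le_pos; [|apply Rlt_le, Rinv_0_lt_compat; nra].
          apply Rmult_le_pos; [apply Rmult_le_pos; lra|lra]. }
      assert (Pj : INR (S j) <= INR (h k)) by (apply le_INR; lia).
      set (H2 := INR (h k)) in *. assert (PH2 : 0 < H2) by (generalize (Cmod_ge_0 z); lra).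
      assert (NH2 : RtoC H2 <> RtoC 0) by apply Nh. assert (N2H2 : (2 * H2)%C <> RtoC 0) by apply N2h. assert (N2 := C2_nz).
      assert (C2H : Cmod (2 * H2)%C = 2 * H2) by (rewrite Cmod_mult, !Cmod_R, !Rabs_pos_eq; lra).
      rewrite cotq_pair by (apply Ndy; auto).
      replace ((z + INR (S j)) / (2 * H2) + (z - INR (S j)) / (2 * H2))%C with (z / H2)%C by (field; auto using C2_nz).
      assert (LB : forall s, (s = INR (S j) \/ s = - INR (S j)) -> qexp ((z + s) / (2 * H2))%C <> RtoC 1 ->
         Cmod (z + s)%C / (200 * H2) <= Cmod (qexp ((z + s) / (2 * H2)) - 1)%C).
      { intros s Hs _. eapply Rle_trans; [|apply qexp_minus1_lower].
        - rewrite Cmod_div by auto. rewrite C2H. right. field. lra.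
        - replace (Re ((z + s) / (2 * H2))%C) with ((Re z + s) / (2 * H2)).
          + rewrite Rabs_div by lra. rewrite (Rabs_pos_eq (2 * H2)) by lra.
            apply Rmult_le_reg_r with (2 * H2); [lra|]. unfold Rdiv at 1. rewrite Rmult_assoc, Rinv_l, Rmult_1_r by lra.
            eapply Rle_trans; [apply Rabs_triang|]. assert (T1 := re_le_Cmod z).
            assert (Rabs s <= H2). { destruct Hs as [->| ->]; rewrite ?Rabs_Ropp, Rabs_pos_eq; lra. }
            lra.
          + rewrite <- RtoC_mult. unfold Cdiv. rewrite <- RtoC_inv by lra. rewrite re_scal_r. reflexivity.
        - replace (Im ((z + s) / (2 * H2))%C) with (Im z / (2 * H2)).
          + rewrite Rabs_div by lra. rewrite (Rabs_pos_eq (2 * H2)) by lra.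
            apply Rmult_le_reg_r with (2 * H2); [lra|]. unfold Rdiv at 1. rewrite Rmult_assoc, Rinv_l, Rmult_1_r by lra.
            assert (T1 := im_le_Cmod z). lra.
          + rewrite <- RtoC_mult. unfold Cdiv. rewrite <- RtoC_inv by lra. rewrite im_scal_r.
            destruct z; unfold Im; simpl. unfold Rdiv; ring. }
      assert (LB1 := LB (INR (S j)) (or_introl eq_refl) (Ndy _ k (Zp j))).
      assert (E : (z - INR (S j))%C = (z + RtoC (- INR (S j)))%C) by (rewrite RtoC_opp; ring).
      assert (LB2 := LB (- INR (S j)) (or_intror eq_refl)). rewrite <- E in LB2. specialize (LB2 (Ndy _ k (Zm j))).
      assert (UB : Cmod (qexp (z / H2) - 1)%C <= K1 * (Cmod z / H2)).
      { replace (Cmod z / H2) with (Cmod (z / H2)%C).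
        - apply HK1. rewrite Cmod_div by auto. rewrite Cmod_R, Rabs_pos_eq by lra.
          apply Rmult_lt_reg_r with (H2 / d1); [apply Rdiv_lt_0_compat; lra|].
          replace (Cmod z / H2 * (H2 / d1)) with (Cmod z / d1) by (field; lra).
          replace (d1 * (H2 / d1)) with H2 by (field; lra). lra.
        - rewrite Cmod_div by auto. rewrite Cmod_R, Rabs_pos_eq by lra. reflexivity. }
      destruct (Kd j) as [k1 k2].
      assert (Pdj : 0 < d * INR (S j)) by nra.
      set (A := (qexp ((z + INR (S j)) / (2 * H2)) - 1)%C) in *. set (B := (qexp ((z - INR (S j)) / (2 * H2)) - 1)%C) in *.
      assert (LA : (d * / (200 * H2)) * INR (S j) <= Cmod A).
      { eapply Rle_trans; [|exact LB1]. unfold Rdiv. rewrite Rmult_assoc, (Rmult_comm (/ _)), <- Rmult_assoc.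
        apply Rmult_le_compat_r; auto. apply Rlt_le, Rinv_0_lt_compat; lra. }
      assert (LBB : (d * / (200 * H2)) * INR (S j) <= Cmod B).
      { eapply Rle_trans; [|exact LB2]. unfold Rdiv. rewrite Rmult_assoc, (Rmult_comm (/ _)), <- Rmult_assoc.
        apply Rmult_le_compat_r; auto. apply Rlt_le, Rinv_0_lt_compat; lra. }
      assert (Pe : 0 < d * / (200 * H2)) by (apply Rmult_lt_0_compat; auto; apply Rinv_0_lt_compat; lra).
      assert (I := Cmod_inv_mult_le A B (INR (S j)) _ Pe ltac:(lra) LA LBB).
      unfold Cdiv at 1 2. rewrite !Cmod_mult, Cmod_Ci, !Cmod_R, (Cmod_inv (2 * H2)%C) by auto.
      rewrite C2H, (Rabs_pos_eq PI), (Rabs_pos_eq 2) by lra. fold H2.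
      apply Rle_trans with (PI * / (2 * H2) * (2 * 1 * (K1 * (Cmod z / H2)) * (/ (d * / (200 * H2) * (d * / (200 * H2))) * / (INR (S j) * INR (S j))))).
      + apply Rmult_le_compat_l. { apply Rmult_le_pos; [lra|]. apply Rlt_le, Rinv_0_lt_compat; lra. }
        apply Rmult_le_compat; auto using Cmod_ge_0.
        * apply Rmult_le_pos; [lra|apply Cmod_ge_0].
        * apply Rmult_le_compat_l; [lra|exact UB].
      + right. field. repeat split; lra.
    - intros j. unfold w.
      apply clim_ext_ev with (fun k => (PI * / (z + INR (S j))) * (((z + INR (S j)) / (2 * INR (h k))) * cotq ((z + INR (S j)) / (2 * INR (h k))))
          + (PI * / (z - INR (S j))) * (((z - INR (S j)) / (2 * INR (h k))) * cotq ((z - INR (S j)) / (2 * INR (h k)))))%C.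
      + exists (S j). intros k Hk. unfold v.
        replace (j <? h k - 1)%nat with true.
        2:{ symmetry; apply Nat.ltb_lt. unfold h. generalize (pow2_gt (k + S N0)); lia. }
        field. repeat split; auto using C2_nz. apply nonint_minus_nz; auto. apply nonint_plus_nz; auto.
      + replace (/ (z + INR (S j)) + / (z - INR (S j)))%C
          with (PI * / (z + INR (S j)) * / PI + PI * / (z - INR (S j)) * / PI)%C.
        * apply clim_plus; apply clim_scal; apply cotq_small; auto.
        * field. repeat split; auto. apply nonint_minus_nz; auto. apply nonint_plus_nz; auto. }
  assert (E : CS w = (PI * cotq z - / z)%C).
  { eapply clim_unique; [exact T|].
    apply clim_ext with (fun k => PI * cotq z - ((PI * / z) * (z / (2 * INR (h k)) * cotq (z / (2 * INR (h k))))
      + (PI / (2 * INR (h k))) * cotq (z / (2 * INR (h k)) - / 2)))%C.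
    - intros k. rewrite (CS_finite _ (h k - 1)%nat).
      2:{ intros j Hj. unfold v. replace (j <? h k - 1)%nat with false; auto. symmetry; apply Nat.ltb_ge; auto. }
      rewrite (csum_ext _ (fun j => (PI / (2 * INR (h k))) * (cotq ((z + INR (S j)) / (2 * INR (h k))) + cotq ((z - INR (S j)) / (2 * INR (h k)))))%C).
      2:{ intros j Hj. unfold v. replace (j <? h k - 1)%nat with true; auto. symmetry; apply Nat.ltb_lt; auto. }
      rewrite csum_scal. assert (D := cotq_dyadic_sym z (k + S N0) H). cbv zeta in D. fold (h k) in D.
      set (X := csum _ _) in *.
      assert (EX : X = (2 * INR (h k) * cotq z - cotq (z / (2 * INR (h k))) - cotq (z / (2 * INR (h k)) - / 2))%C).
      { rewrite D. ring. }
      rewrite EX. field. repeat split; auto using C2_nz.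
    - replace (PI * cotq z - / z)%C with (PI * cotq z - ((PI * / z) * / PI + 0 * cotq (0 - / 2)))%C by (field; auto).
      apply clim_minus; [apply clim_const|]. apply clim_plus.
      + apply clim_scal, cotq_small; auto.
      (* The cotangent at the half shift stays near cot(-pi/2), a finite value, so the factor
         pi/(2h) sends this term to 0. *)
      + apply clim_mult; [apply Hlim|].
        assert (EH : forall x, qexp (x - / 2)%C = (qexp x * RtoC (-1))%C).
        { intros x. rewrite <- qexp_half, <- qexp_plus. rewrite <- (qexp_plus1 (x - / 2)%C). f_equal.
          rewrite RtoC_div by lra. field. }
        assert (CQ : clim (fun k => qexp (z / (2 * INR (h k)))%C) (qexp 0)).
        { apply clim_ext with (fun k => qexp (0 + z / (2 * INR (h k)))%C); [intros; f_equal; ring|].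
          eapply cder_cont_seq; [apply cder_qexp|apply Hlim]. }
        unfold cotq. rewrite EH.
        apply clim_ext with (fun k => (Ci * (qexp (z / (2 * INR (h k))) * RtoC (-1) + 1)) * / (qexp (z / (2 * INR (h k))) * RtoC (-1) + - (1)))%C.
        { intros k. rewrite EH. reflexivity. }
        apply clim_mult.
        * apply clim_scal, clim_plus; [|apply clim_const]. apply clim_mult; [auto|apply clim_const].
        * apply clim_inv. rewrite qexp_0. intros Q. apply (f_equal Re) in Q. unfold Re in Q; simpl in Q. lra.
          apply clim_plus; [|apply clim_const]. apply clim_mult; [auto|apply clim_const]. }
  rewrite <- E. apply asum_cser. apply asum_inv_sq_bound with (2 * Cmod z * / (d * d)).
  intros j. assert (Q := INR_S_ge1 j). destruct (Kd j) as [k1 k2]. unfold w.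
  assert (N1 : (z + INR (S j))%C <> RtoC 0) by (apply nonint_plus_nz; auto).
  assert (N2 : (z - INR (S j))%C <> RtoC 0) by (apply nonint_minus_nz; auto).
  replace (/ (z + INR (S j)) + / (z - INR (S j)))%C with (2 * z * / ((z + INR (S j)) * (z - INR (S j))))%C by (field; auto).
  rewrite !Cmod_mult, Cmod_R, Rabs_pos_eq by lra. rewrite (Rmult_assoc (2 * Cmod z)).
  apply Rmult_le_compat_l; [generalize (Cmod_ge_0 z); lra|]. apply Cmod_inv_mult_le; auto; lra.
Qed.

Lemma cder_cotq z : qexp z <> RtoC 1 -> cder cotq z (4 * PI * qexp z / ((qexp z - 1) * (qexp z - 1)))%C.
Proof.
  intros H. assert (N : (qexp z - 1)%C <> RtoC 0) by (intros E; apply H; now apply Ceq_minus).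
  unfold cotq, Cdiv.
  assert (D1 : cder (fun w => qexp w + - (1))%C z (twopii * qexp z + 0)%C).
  { apply cder_plus; [apply cder_qexp|apply cder_const]. }
  assert (D2 : cder (fun w => qexp w + 1)%C z (twopii * qexp z + 0)%C).
  { apply cder_plus; [apply cder_qexp|apply cder_const]. }
  assert (D3 := cder_comp (fun x => / x)%C _ z _ _ D1 (cder_inv _ N)).
  assert (D4 := cder_mult _ _ _ _ _ (cder_scal Ci _ _ _ D2) D3).
  replace (4 * PI * qexp z * / ((qexp z - 1) * (qexp z - 1)))%C
    with (Ci * (twopii * qexp z + 0) * / (qexp z + - (1)) +
      Ci * (qexp z + 1) * (- / ((qexp z + - (1)) * (qexp z + - (1))) * (twopii * qexp z + 0)))%C; [exact D4|].
  change (qexp z + - (1))%C with (qexp z - 1)%C.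
  unfold twopii. rewrite RtoC_mult.
  assert (I2 : (Ci * Ci = - (1))%C) by (unfold Ci, Cmult, Copp, RtoC; simpl; f_equal; ring).
  set (q := qexp z) in *.
  replace (Ci * (2 * PI * Ci * q + 0) * / (q - 1) + Ci * (q + 1) * (- / ((q - 1) * (q - 1)) * (2 * PI * Ci * q + 0)))%C
    with ((Ci * Ci) * (2 * PI * q * / (q - 1) - (q + 1) * / ((q - 1) * (q - 1)) * (2 * PI * q)))%C by ring.
  rewrite I2. field. exact N.
Qed.

Lemma asum_scal c u : asum u -> asum (fun n => c * u n)%C.
Proof.
  intros H. apply (asum_le _ (fun n => Cmod c * Cmod (u n))).
  - intros; rewrite Cmod_mult; lra.
  - now apply @ex_series_scal_l with (c := Cmod c).
Qed.

Lemma clim_inv_S c : clim (fun k => (c / INR (S k))%C) (RtoC 0).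
Proof.
  intros e He. destruct (nfloor_ex (Cmod c / e)) as [N [_ HN]].
  { apply Rmult_le_pos; [apply Cmod_ge_0|]. apply Rlt_le, Rinv_0_lt_compat; auto. }
  exists N; intros n Hn. replace (c / INR (S n) - 0)%C with (c / INR (S n))%C by ring.
  assert (P := INR_S_ge1 n). assert (L : INR N + 1 <= INR (S n)) by (rewrite S_INR; apply le_INR in Hn; lra).
  rewrite Cmod_div by (apply RtoC_neq0; lra). rewrite Cmod_R, Rabs_pos_eq by lra.
  apply Rmult_lt_reg_r with (INR (S n)); [lra|].
  unfold Rdiv. rewrite Rmult_assoc, Rinv_l, Rmult_1_r by lra.
  apply Rlt_le_trans with (e * (INR N + 1)); [|nra].
  apply Rmult_lt_compat_l with (r := e) in HN; auto.
  replace (e * (Cmod c / e)) with (Cmod c) in HN by (field; lra). exact HN.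
Qed.

(** Termwise derivative of [cot_expansion]. Since the derivative of the left side is known to exist,
    difference quotients along one sequence x_k -> 0 are enough, and in closed form [EV] they have a
    majorant independent of k. *)
Theorem K_expansion z : qexp z <> RtoC 1 ->
  cser (fun j => / ((z + INR (S j)) * (z + INR (S j))) + / ((z - INR (S j)) * (z - INR (S j))))%C
    (- (4 * PI * PI) * qexp z / ((qexp z - 1) * (qexp z - 1)) - / (z * z))%C.
Proof.
  intros H. assert (Nz := nonint_z_nz z H).
  assert (Nq : (qexp z - 1)%C <> RtoC 0) by (intros E; apply H; now apply Ceq_minus).
  destruct (linear_lower z H) as [d [Pd Kd]].
  destruct (cder_lip _ _ _ (cder_qexp z)) as [d1 [Pd1 K1]].
  set (A := Cmod (twopii * qexp z) + 1) in *.
  assert (PA : 0 < A) by (unfold A; generalize (Cmod_ge_0 (twopii * qexp z)%C); lra).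
  assert (PB := proj1 (Cmod_gt_0 _) Nq). set (B := Cmod (qexp z - 1)%C) in *.
  (* d/2 preserves half of the linear lower bound, d1/2 stays within the Lipschitz range of [qexp],
     and B/(2A) keeps [qexp (z + x k)] away from 1. *)
  set (r := Rmin (d / 2) (Rmin (d1 / 2) (B / (2 * A)))).
  assert (Pr : 0 < r). { unfold r. repeat apply Rmin_glb_lt; try lra. apply Rdiv_lt_0_compat; lra. }
  assert (r1 : r <= d / 2) by apply Rmin_l.
  assert (r2 : r <= d1 / 2) by (eapply Rle_trans; [apply Rmin_r|apply Rmin_l]).
  assert (r3 : r <= B / (2 * A)) by (eapply Rle_trans; [apply Rmin_r|apply Rmin_r]).
  set (x := fun k => (r / INR (S k))%C).
  assert (Lx : clim x (RtoC 0)) by apply clim_inv_S.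
  assert (Nx : forall k, x k <> RtoC 0).
  { intros k. unfold x. assert (Q := INR_S_ge1 k). unfold Cdiv. apply Cmult_neq_0.
    apply RtoC_neq0; lra. rewrite <- RtoC_inv by lra. apply RtoC_neq0. apply Rinv_neq_0_compat; lra. }
  assert (Bx : forall k, Cmod (x k) <= r).
  { intros k. unfold x. assert (Q := INR_S_ge1 k). rewrite Cmod_div by (apply RtoC_neq0; lra).
    rewrite !Cmod_R, (Rabs_pos_eq r), (Rabs_pos_eq (INR (S k))) by lra.
    apply Rmult_le_reg_r with (INR (S k)); [lra|]. unfold Rdiv. rewrite Rmult_assoc, Rinv_l, Rmult_1_r by lra. nra. }
  assert (Hx : forall k, qexp (z + x k)%C <> RtoC 1).
  { intros k E. specialize (K1 (x k)). specialize (Bx k).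
    assert (Cmod (x k) < d1) by lra. specialize (K1 H0). rewrite E in K1.
    rewrite Cmod_minus_sym in K1. fold B in K1.
    assert (A * Cmod (x k) <= A * (B / (2 * A))) by (apply Rmult_le_compat_l; lra).
    replace (A * (B / (2 * A))) with (B / 2) in H1 by (field; lra). lra. }
  set (w := fun y j => (/ (y + INR (S j)) + / (y - INR (S j)))%C).
  set (W := fun j => (/ ((z + INR (S j)) * (z + INR (S j))) + / ((z - INR (S j)) * (z - INR (S j))))%C).
  set (V := fun k j => (/ x k * (w z j + (-(1)) * w (z + x k)%C j))%C).
  assert (EV : forall k j, V k j = (/ ((z + x k + INR (S j)) * (z + INR (S j))) + / ((z + x k - INR (S j)) * (z - INR (S j))))%C).
  { intros k j. unfold V, w. field. repeat split; auto;
      try (apply nonint_minus_nz; auto); try (apply nonint_plus_nz; auto). }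
  assert (Low : forall k j, (d/2) * INR (S j) <= Cmod (z + x k + INR (S j))%C /\ (d/2) * INR (S j) <= Cmod (z + x k - INR (S j))%C).
  { intros k j. destruct (Kd j) as [k1 k2]. specialize (Bx k). assert (Q := INR_S_ge1 j).
    assert (T1 := Cmod_triang_inv (z + INR (S j))%C (- x k)%C). rewrite Cmod_opp in T1.
    replace (z + INR (S j) - - x k)%C with (z + x k + INR (S j))%C in T1 by ring.
    assert (T2 := Cmod_triang_inv (z - INR (S j))%C (- x k)%C). rewrite Cmod_opp in T2.
    replace (z - INR (S j) - - x k)%C with (z + x k - INR (S j))%C in T2 by ring. split; nra. }
  assert (BV : forall k j, Cmod (V k j) <= (2 * / (d/2 * (d/2))) * / (INR (S j) * INR (S j))).
  { intros k j. rewrite EV. destruct (Kd j) as [k1 k2]. destruct (Low k j) as [l1 l2]. assert (Q := INR_S_ge1 j).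
    eapply Rle_trans; [apply Cmod_triangle|].
    assert (I1 := Cmod_inv_mult_le (z + x k + INR (S j))%C (z + INR (S j))%C (INR (S j)) (d/2) ltac:(lra) ltac:(lra) l1 ltac:(nra)).
    assert (I2 := Cmod_inv_mult_le (z + x k - INR (S j))%C (z - INR (S j))%C (INR (S j)) (d/2) ltac:(lra) ltac:(lra) l2 ltac:(nra)).
    lra. }
  assert (LL : forall c, c <> RtoC 0 -> clim (fun k => / ((c + x k) * c))%C (/ (c * c))%C).
  { intros c Hc. apply clim_inv; [now apply Cmult_neq_0|]. apply clim_mult; [|apply clim_const].
    rewrite <- (Cplus_0_r c). apply clim_ext with (fun k => c + x k)%C; [intros; ring|].
    apply clim_plus; [apply clim_const|auto]. }
  assert (T : clim (fun k => CS (V k)) (CS W)).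
  { apply tannery with (2 := BV).
    - apply @ex_series_scal_l with (c := 2 * / (d/2 * (d/2))). apply ex_series_inv_sq.
    - intros j. apply clim_ext with (fun k => / ((z + INR (S j) + x k) * (z + INR (S j))) + / ((z - INR (S j) + x k) * (z - INR (S j))))%C.
      + intros k. rewrite EV. f_equal; f_equal; f_equal; ring.
      + unfold W.
        apply clim_plus; apply LL. apply nonint_plus_nz; auto. apply nonint_minus_nz; auto. }
  set (f := fun y => (PI * cotq y - / y)%C).
  assert (EC : forall k, CS (V k) = (-(1) * ((f (z + x k) - f z) / x k))%C).
  { intros k. apply cser_CS. unfold V.
    replace (-(1) * ((f (z + x k) - f z) / x k))%C with (/ x k * (f z + (-(1)) * f (z + x k)))%C by (field; auto).
    apply cser_scal, cser_plus; [apply cot_expansion; auto|]. apply cser_scal. apply cot_expansion; auto. }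
  assert (Df : cder f z (PI * (4 * PI * qexp z / ((qexp z - 1) * (qexp z - 1))) - - / (z * z))%C).
  { apply cder_minus; [apply cder_scal, cder_cotq; auto|now apply cder_inv]. }
  assert (Q := cder_seq f z _ x Df Lx Nx). apply (clim_scal (-(1))) in Q.
  replace (- (4 * PI * PI) * qexp z / ((qexp z - 1) * (qexp z - 1)) - / (z * z))%C with (CS W).
  - apply asum_cser, asum_inv_sq_bound with (2 * / (d/2 * (d/2))).
    intros j. apply clim_Cmod_le with (fun k => V k j).
    + exists O; intros; apply BV.
    + unfold W. apply clim_ext with (fun k => / ((z + INR (S j) + x k) * (z + INR (S j))) + / ((z - INR (S j) + x k) * (z - INR (S j))))%C.
      * intros k. rewrite EV. f_equal; f_equal; f_equal; ring.
      * apply clim_plus; apply LL. apply nonint_plus_nz; auto. apply nonint_minus_nz; auto.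
  - eapply clim_unique; [exact T|]. eapply clim_ext; [intros k; symmetry; apply EC|].
    replace (- (4 * PI * PI) * qexp z / ((qexp z - 1) * (qexp z - 1)) - / (z * z))%C
      with (-(1) * (PI * (4 * PI * qexp z / ((qexp z - 1) * (qexp z - 1))) - - / (z * z)))%C by (field; auto).
    exact Q.
Qed.

Lemma csum_S u n : csum u (S n) = (csum u n + u n)%C.
Proof. reflexivity. Qed.

(* [K_expansion] at z = 1/2 gives the sum over the odd squares. *)
Theorem zeta2 : cser (fun j => / (INR (S j) * INR (S j)))%C (PI * PI / 6)%C.
Proof.
  assert (N2 := C2_nz).
  assert (A : asum (fun j => / (INR (S j) * INR (S j)))%C).
  { apply asum_inv_sq_bound with 1. intros j. assert (Q := INR_S_ge1 j).
    rewrite <- RtoC_mult, <- RtoC_inv by nra. rewrite Cmod_R, Rabs_pos_eq by apply inv_sq_nonneg. lra. }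
  apply asum_cser in A. set (Z := CS _) in A.
  replace (PI * PI / 6)%C with Z; [exact A|].
  assert (H12 : qexp (RtoC (1/2)) <> RtoC 1).
  { rewrite qexp_half. intros E. apply RtoC_inj in E. lra. }
  assert (K := K_expansion (RtoC (1/2)) H12). rewrite qexp_half in K.
  assert (Npos : forall n, RtoC (INR (S n)) <> RtoC 0) by (intros n; apply RtoC_neq0; generalize (INR_S_ge1 n); lra).
  assert (Nodd : forall n, (2 * INR n + 1)%C <> RtoC 0).
  { intros n. rewrite <- RtoC_mult, <- RtoC_plus. apply RtoC_neq0. generalize (pos_INR n); lra. }
  assert (Hh : RtoC (1/2) = (/ 2)%C) by (rewrite RtoC_div by lra; field; auto).
  rewrite Hh in K.
  set (o := fun n : nat => (/ ((2 * INR n + 1) * (2 * INR n + 1)))%C).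
  set (X := (- (4 * PI * PI) * RtoC (-1) / ((RtoC (-1) - 1) * (RtoC (-1) - 1)) - / (/2 * / 2))%C) in K.
  assert (EX : X = (PI * PI - 4)%C).
  { unfold X. field. }
  (* With + the odd squares start at 9, with - at 1; the -4 removes the missing first term. *)
  assert (F : forall n, csum (fun j => / ((/2 + INR (S j)) * (/2 + INR (S j))) + / ((/2 - INR (S j)) * (/2 - INR (S j))))%C n
     = (4 * csum o n + 4 * csum o (S n) - 4)%C).
  { induction n.
    - simpl. unfold o. simpl (INR 0). field.
    - rewrite csum_S, IHn, (csum_S o (S n)), (csum_S o n). unfold o at 3 6. rewrite (S_INR n), RtoC_plus.
      assert (N1 := Nodd n). assert (N3 := Nodd (S n)). rewrite S_INR, RtoC_plus in N3.
      unfold o. rewrite ?S_INR, ?RtoC_plus. field. repeat split; auto.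
      replace (1 - (INR n + 1) * 2)%C with (- (2 * INR n + 1))%C by ring.
      intros E. apply N1. rewrite <- Copp_0, <- E. ring. }
  assert (O : cser o (PI * PI / 8)%C).
  { unfold cser in K. apply (clim_ext _ _ _ F) in K. rewrite EX in K.
    assert (Lo : clim o (RtoC 0)).
    { apply clim_ext with (fun n => (1 / INR (S (2 * n))) * (1 / INR (S (2 * n))))%C.
      - intros n. unfold o. rewrite S_INR, mult_INR, RtoC_plus, RtoC_mult. simpl (INR 2).
        replace (RtoC (1 + 1)) with (RtoC 2) by (f_equal; lra). field. apply Nodd.
      - replace (RtoC 0) with (0 * 0)%C by ring.
        apply clim_mult; (apply (clim_subseq (fun k => (1 / INR (S k))%C) _ (fun n => 2 * n)%nat); [intros; lia|apply clim_inv_S]). }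
    apply clim_ext with (fun n => / 8 * ((4 * csum o n + 4 * csum o (S n) - 4) + (- (4) * o n + 4)))%C.
    - intros n. simpl. field.
    - replace (PI * PI / 8)%C with (/ 8 * (PI * PI - 4 + (- (4) * 0 + 4)))%C by field.
      apply clim_scal, clim_plus; [exact K|]. apply clim_plus; [|apply clim_const]. now apply clim_scal. }
  (* The even squares contribute a quarter of the whole sum, so that Z = Z/4 + pi^2/8. *)
  assert (G : forall n, csum (fun j => / (INR (S j) * INR (S j)))%C (2 * n) =
     (/ 4 * csum (fun j => / (INR (S j) * INR (S j)))%C n + csum o n)%C).
  { induction n.
    - simpl. ring.
    - replace (2 * S n)%nat with (S (S (2 * n))) by lia. rewrite !csum_S.
      rewrite IHn. unfold o at 3.
      assert (N1 := Npos n). assert (N3 := Nodd n).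
      assert (e1 : RtoC (INR (S (2 * n))) = (2 * INR n + 1)%C).
      { rewrite S_INR, mult_INR. simpl (INR 2). rewrite <- RtoC_mult, <- RtoC_plus. f_equal; ring. }
      assert (e2 : RtoC (INR (S (S (2 * n)))) = (2 * INR (S n))%C).
      { rewrite !S_INR, mult_INR. simpl (INR 2). rewrite <- RtoC_mult. f_equal; ring. }
      rewrite e1, e2. field. auto. }
  assert (A2 : clim (fun n => csum (fun j => / (INR (S j) * INR (S j)))%C (2 * n)) Z).
  { apply (clim_subseq _ _ (fun n => 2 * n)%nat); [intros; lia|exact A]. }
  apply (clim_ext _ _ _ G) in A2.
  assert (A3 : clim (fun n => / 4 * csum (fun j => / (INR (S j) * INR (S j)))%C n + csum o n)%C (/ 4 * Z + PI * PI / 8)%C).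
  { apply clim_plus; [apply clim_scal; exact A|exact O]. }
  assert (E := clim_unique _ _ _ A2 A3).
  replace Z with (4 / 3 * (Z - / 4 * Z))%C by field. rewrite E at 1. field.
Qed.

(** * Power series in q *)

(** Radius of convergence at least 1, in absolute form. *)
Definition goodc (a : nat -> C) : Prop :=
  forall rho, 0 <= rho < 1 -> ex_series (fun n => Cmod (a n) * rho ^ n).

Definition pser (a : nat -> C) (w : C) : C := CS (fun n => a n * w ^ n)%C.

Lemma goodc_le a b : (forall n, Cmod (a n) <= Cmod (b n)) -> goodc b -> goodc a.
Proof.
  intros H Hb rho Hr. apply @ex_series_le with (2 := Hb rho Hr). intros n.
  change (Rabs (Cmod (a n) * rho ^ n) <= Cmod (b n) * rho ^ n).
  assert (0 <= rho ^ n) by (apply pow_le; lra).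
  rewrite Rabs_pos_eq by (apply Rmult_le_pos; auto using Cmod_ge_0). apply Rmult_le_compat_r; auto.
Qed.

Lemma goodc_plus a b : goodc a -> goodc b -> goodc (fun n => a n + b n)%C.
Proof.
  intros Ha Hb rho Hr.
  assert (E := @ex_series_plus R_AbsRing R_NormedModule _ _ (Ha rho Hr) (Hb rho Hr)).
  apply @ex_series_le with (2 := E). intros n.
  change (Rabs (Cmod (a n + b n)%C * rho ^ n) <= Cmod (a n) * rho ^ n + Cmod (b n) * rho ^ n).
  assert (0 <= rho ^ n) by (apply pow_le; lra).
  rewrite Rabs_pos_eq by (apply Rmult_le_pos; auto using Cmod_ge_0).
  rewrite <- Rmult_plus_distr_r. apply Rmult_le_compat_r; auto using Cmod_triangle.
Qed.

Lemma goodc_scal c a : goodc a -> goodc (fun n => c * a n)%C.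
Proof.
  intros Ha rho Hr. assert (E := @ex_series_scal_l R_AbsRing R_NormedModule (Cmod c) _ (Ha rho Hr)).
  eapply ex_series_ext; [|exact E]. intros n.
  change (Cmod c * (Cmod (a n) * rho ^ n) = Cmod (c * a n)%C * rho ^ n). rewrite Cmod_mult. symmetry; apply Rmult_assoc.
Qed.

Lemma goodc_ext a b : (forall n, a n = b n) -> goodc a -> goodc b.
Proof. intros E. apply goodc_le. intros n; rewrite E; lra. Qed.

Lemma goodc_1 : goodc (fun _ => RtoC 1).
Proof.
  intros rho Hr. apply ex_series_ext with (fun n => rho ^ n). intros; rewrite Cmod_1; apply eq_sym, Rmult_1_l.
  apply ex_series_geom. rewrite Rabs_pos_eq; lra.
Qed.

(** Bernoulli's n s <= (1 + s)^n absorbs the factor n when rho is enlarged to rho (1 + s) = (1 +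
    rho)/2. *)
Lemma goodc_INR a : goodc a -> goodc (fun n => INR n * a n)%C.
Proof.
  intros H.
  assert (K : forall rho, 0 < rho < 1 -> ex_series (fun n => Cmod (INR n * a n)%C * rho ^ n)).
  { intros rho Hr. set (s := (1 - rho) / (2 * rho)).
    assert (Ps : 0 < s) by (unfold s; apply Rdiv_lt_0_compat; lra).
    assert (Er : rho * (1 + s) = (1 + rho) / 2) by (unfold s; field; lra).
    assert (E := @ex_series_scal_l R_AbsRing R_NormedModule (/ s) _ (H (rho * (1 + s)) ltac:(lra))).
    apply @ex_series_le with (2 := E). intros n.
    change (Rabs (Cmod (INR n * a n)%C * rho ^ n) <= / s * (Cmod (a n) * (rho * (1 + s)) ^ n)).
    assert (Pn := pos_INR n). assert (Pc := Cmod_ge_0 (a n)). assert (Pp : 0 < rho ^ n) by (apply pow_lt; lra).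
    rewrite Cmod_mult, Cmod_R, (Rabs_pos_eq (INR n)) by auto.
    rewrite Rabs_pos_eq by (repeat apply Rmult_le_pos; auto; lra).
    assert (B := poly n s Ps).
    rewrite Rpow_mult_distr.
    replace (/ s * (Cmod (a n) * (rho ^ n * (1 + s) ^ n))) with (Cmod (a n) * rho ^ n * (/ s * (1 + s) ^ n)) by ring.
    replace (INR n * Cmod (a n) * rho ^ n) with (Cmod (a n) * rho ^ n * INR n) by ring.
    apply Rmult_le_compat_l; [apply Rmult_le_pos; lra|].
    apply Rmult_le_reg_l with s; auto. rewrite <- Rmult_assoc, Rinv_r, Rmult_1_l by lra. lra. }
  (* The choice of s divides by rho; passing to m > rho covers rho = 0 as well. *)
  intros rho Hr. set (m := (1 + rho) / 2). assert (Hm : 0 < m < 1) by (unfold m; lra).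
  apply @ex_series_le with (2 := K m Hm). intros n.
  change (Rabs (Cmod (INR n * a n)%C * rho ^ n) <= Cmod (INR n * a n)%C * m ^ n).
  assert (0 <= rho ^ n) by (apply pow_le; lra).
  rewrite Rabs_pos_eq by (apply Rmult_le_pos; auto using Cmod_ge_0).
  apply Rmult_le_compat_l; [apply Cmod_ge_0|]. apply pow_incr. unfold m; lra.
Qed.

Lemma goodc_asum a w : goodc a -> Cmod w < 1 -> asum (fun n => a n * w ^ n)%C.
Proof.
  intros H Hw. eapply ex_series_ext; [|apply (H (Cmod w))].
  - intros n. cbv beta. now rewrite Cmod_mult, Cmod_pow.
  - split; auto using Cmod_ge_0.
Qed.

Lemma pser_cser a w : goodc a -> Cmod w < 1 -> cser (fun n => a n * w ^ n)%C (pser a w).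
Proof. intros; apply asum_cser. now apply goodc_asum. Qed.

(** Second-order Taylor remainder of w^n. The factor rho^2 on the left avoids the exponent n - 2,
    which fails for small n and for rho = 0. *)
Lemma pow_diff_bound (w h : C) rho n : 0 <= rho -> Cmod w <= rho -> Cmod (w + h)%C <= rho ->
  rho * rho * Cmod ((w + h) ^ n - w ^ n - INR n * w ^ (pred n) * h)%C <= INR n * INR n * rho ^ n * (Cmod h * Cmod h).
Proof.
  intros Hr H1 H2. induction n as [|n IH].
  - simpl. replace (1 - 1 - 0 * 1 * h)%C with (RtoC 0) by ring. rewrite Cmod_0; lra.
  - set (E := ((w + h) ^ n - w ^ n - INR n * w ^ (pred n) * h)%C) in *.
    set (F := (INR n * w ^ (pred n) * (h * h))%C).
    assert (EE : ((w + h) ^ S n - w ^ S n - INR (S n) * w ^ (pred (S n)) * h = (w + h) * E + F)%C).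
    { unfold E, F. rewrite !Cpow_S, S_INR, RtoC_plus. simpl pred. destruct n as [|n].
      - simpl. ring.
      - simpl pred. rewrite !Cpow_S. ring. }
    rewrite EE. assert (T := Cmod_triangle ((w + h) * E)%C F). rewrite Cmod_mult in T.
    assert (Pn := pos_INR n). assert (Ph := Cmod_ge_0 h).
    assert (FB : rho * rho * Cmod F <= INR n * rho ^ (S n) * (Cmod h * Cmod h)).
    { unfold F. rewrite !Cmod_mult, Cmod_R, (Rabs_pos_eq _ Pn), Cmod_pow. destruct n as [|n].
      - simpl. rewrite Rmult_0_l, !Rmult_0_l. lra.
      - simpl pred. 
        replace (rho * rho * (INR (S n) * Cmod w ^ n * (Cmod h * Cmod h))) with (INR (S n) * (rho * rho * Cmod w ^ n) * (Cmod h * Cmod h)) by ring.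
        apply Rmult_le_compat_r; [nra|]. apply Rmult_le_compat_l; auto. simpl.
        rewrite <- Rmult_assoc. apply Rmult_le_compat_l; [nra|]. apply pow_incr; auto using Cmod_ge_0. }
    assert (EB : rho * rho * (Cmod (w + h)%C * Cmod E) <= rho * (INR n * INR n * rho ^ n * (Cmod h * Cmod h))).
    { apply Rle_trans with (rho * (rho * rho * Cmod E)); [|apply Rmult_le_compat_l; auto].
      assert (0 <= Cmod E) by apply Cmod_ge_0. assert (Q := Cmod_ge_0 (w + h)%C).
      replace (rho * rho * (Cmod (w + h)%C * Cmod E)) with (Cmod (w + h)%C * (rho * rho * Cmod E)) by ring.
      apply Rmult_le_compat_r; auto. repeat apply Rmult_le_pos; auto. }
    apply Rle_trans with (rho * rho * (Cmod (w + h)%C * Cmod E + Cmod F)).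
    { apply Rmult_le_compat_l; nra. }
    rewrite Rmult_plus_distr_l.
    apply Rle_trans with ((INR n * INR n + INR n) * (rho ^ S n * (Cmod h * Cmod h))).
    { simpl in *. lra. }
    rewrite S_INR. rewrite (Rmult_assoc _ (rho ^ S n)). apply Rmult_le_compat_r; [|nra].
    apply Rmult_le_pos; [apply pow_le; auto|nra].
Qed.

Lemma cder_pser a w : goodc a -> Cmod w < 1 ->
  cder (pser a) w (CS (fun n => INR n * a n * w ^ (pred n))%C).
Proof.
  intros Ha Hw. set (rho := (1 + Cmod w) / 2). assert (Pw := Cmod_ge_0 w).
  assert (Hr : 0 < rho < 1) by (unfold rho; lra).
  assert (Prr : 0 < rho * rho) by (apply Rmult_lt_0_compat; lra).
  assert (G2 := goodc_INR _ (goodc_INR _ Ha)).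
  set (S2 := Series (fun n => Cmod (INR n * (INR n * a n))%C * rho ^ n)).
  assert (X2 : ex_series (fun n => Cmod (INR n * (INR n * a n))%C * rho ^ n)) by (apply G2; lra).
  assert (AD : asum (fun n => INR n * a n * w ^ (pred n))%C).
  { destruct (Req_dec (Cmod w) 0) as [Z|NZ].
    - apply Cmod_eq_0 in Z. subst w.
      assert (EX := @ex_series_incr_n R_AbsRing R_NormedModule (fun n => Cmod (INR n * a n * 0 ^ pred n)%C) 2).
      apply EX. apply ex_series_ext with (fun _ => 0).
      + intros n. change (pred (2 + n)) with (S n). rewrite Cpow_S, Cmult_0_l, Cmult_0_r, Cmod_0. reflexivity.
      + exists 0. apply (is_lim_seq_ext (fun _ => 0) (sum_n (fun _ => 0)) 0); [|apply is_lim_seq_const].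
        intros n. rewrite sum_n_const. ring.
    - assert (A1 := goodc_asum _ w (goodc_INR _ Ha) Hw).
      apply (asum_scal (/ w)%C) in A1. eapply ex_series_ext; [|exact A1].
      intros n. cbv beta. f_equal. destruct n as [|n]; simpl.
      + ring.
      + field. intros Q; apply NZ. rewrite Q; apply Cmod_0. }
  intros e He.
  assert (PS : 0 <= S2).
  { assert (NN : forall n, 0 <= Cmod (INR n * (INR n * a n))%C * rho ^ n).
    { intros n. apply Rmult_le_pos; [apply Cmod_ge_0|apply pow_le; lra]. }
    eapply Rle_trans; [|apply (sum_n_le_Series _ 0 NN X2)]. rewrite sum_O. apply NN. }
  exists (Rmin ((1 - Cmod w) / 2) (e * (rho * rho) / (S2 + 1))).
  assert (Pe : 0 < e * (rho * rho) / (S2 + 1)) by (apply Rdiv_lt_0_compat; [apply Rmult_lt_0_compat; auto|lra]).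
  split; [apply Rmin_glb_lt; lra|]. intros h Hh.
  assert (h1 := Rlt_le_trans _ _ _ Hh (Rmin_l _ _)). assert (h2 := Rlt_le_trans _ _ _ Hh (Rmin_r _ _)).
  assert (Hwh : Cmod (w + h)%C <= rho) by (eapply Rle_trans; [apply Cmod_triangle|unfold rho; lra]).
  assert (Hw' : Cmod w <= rho) by (unfold rho; lra).
  set (E := fun n => ((w + h) ^ n - w ^ n - INR n * w ^ (pred n) * h)%C).
  assert (BE : forall n, Cmod (a n * E n)%C <= (/ (rho * rho) * (Cmod h * Cmod h)) * (Cmod (INR n * (INR n * a n))%C * rho ^ n)).
  { intros n. assert (B := pow_diff_bound w h rho n ltac:(lra) Hw' Hwh). fold (E n) in B.
    rewrite !Cmod_mult, Cmod_R, (Rabs_pos_eq _ (pos_INR n)).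
    apply Rmult_le_reg_l with (rho * rho); [exact Prr|].
    replace (rho * rho * (/ (rho * rho) * (Cmod h * Cmod h) * (INR n * (INR n * Cmod (a n)) * rho ^ n)))
      with (Cmod (a n) * (INR n * INR n * rho ^ n * (Cmod h * Cmod h))) by (field; lra).
    replace (rho * rho * (Cmod (a n) * Cmod (E n))) with (Cmod (a n) * (rho * rho * Cmod (E n))) by ring.
    apply Rmult_le_compat_l; auto using Cmod_ge_0. }
  assert (ES : CS (fun n => a n * E n)%C = (pser a (w + h) - pser a w - CS (fun n => INR n * a n * w ^ pred n) * h)%C).
  { apply cser_CS.
    apply cser_ext with (fun n => a n * (w + h) ^ n + ((-(1)) * (a n * w ^ n) + (- h) * (INR n * a n * w ^ pred n)))%C.
    - intros n; unfold E; ring.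
    - replace (pser a (w + h) - pser a w - CS (fun n => INR n * a n * w ^ pred n) * h)%C
        with (pser a (w + h) + ((-(1)) * pser a w + (- h) * CS (fun n => INR n * a n * w ^ pred n)))%C by ring.
      apply cser_plus; [apply pser_cser; auto; lra|]. apply cser_plus; apply cser_scal; [apply pser_cser; auto|].
      now apply asum_cser. }
  rewrite <- ES.
  eapply Rle_trans; [apply (CS_le_Series _ _ BE)|].
  - apply @ex_series_scal_l with (c := / (rho * rho) * (Cmod h * Cmod h)). exact X2.
  - rewrite Series_scal_l. fold S2. assert (Ph := Cmod_ge_0 h).
    apply Rle_trans with ((/ (rho * rho) * S2 * Cmod h) * Cmod h); [right; ring|].
    apply Rmult_le_compat_r; auto.
    apply Rmult_le_reg_l with (rho * rho); [exact Prr|].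
    replace (rho * rho * (/ (rho * rho) * S2 * Cmod h)) with (S2 * Cmod h) by (field; lra).
    apply Rle_trans with ((S2 + 1) * (e * (rho * rho) / (S2 + 1))).
    + apply Rmult_le_compat; lra.
    + right. field. lra.
Qed.

Definition qs (a : nat -> C) (z : C) : C := pser a (qexp z).

Lemma Cmod_qexp_lt1 z : in_H z -> Cmod (qexp z) < 1.
Proof.
  intros H. rewrite Cmod_qexp, <- exp_0. apply exp_increasing. unfold in_H in H.
  generalize PI_RGT_0; intros. assert (0 < 2 * PI * Im z) by (apply Rmult_lt_0_compat; lra). lra.
Qed.

Lemma qs_cser a z : goodc a -> in_H z -> cser (fun n => a n * qexp z ^ n)%C (qs a z).
Proof. intros; apply pser_cser; auto using Cmod_qexp_lt1. Qed.

Lemma cder_qs a z : goodc a -> in_H z -> cder (qs a) z (twopii * qs (fun n => INR n * a n)%C z)%C.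
Proof.
  intros Ha Hz. assert (D := cder_comp (pser a) qexp z _ _ (cder_qexp z) (cder_pser a _ Ha (Cmod_qexp_lt1 z Hz))).
  replace (twopii * qs (fun n => INR n * a n)%C z)%C
    with (CS (fun n => INR n * a n * qexp z ^ pred n) * (twopii * qexp z))%C; [exact D|].
  set (X := CS _). replace (X * (twopii * qexp z))%C with (twopii * (qexp z * X))%C by ring. f_equal.
  symmetry. apply cser_CS. unfold X.
  assert (A := qs_cser _ z (goodc_INR _ Ha) Hz). 
  assert (N := qexp_nz z).
  replace (CS (fun n => INR n * a n * qexp z ^ pred n)%C) with (/ qexp z * qs (fun n => INR n * a n) z)%C.
  - replace (qexp z * (/ qexp z * qs (fun n => INR n * a n) z))%C with (qs (fun n => INR n * a n)%C z) by (field; auto).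
    exact A.
  - symmetry. apply cser_CS. eapply cser_ext; [|apply cser_scal; exact A].
    intros n. cbv beta. destruct n as [|n]; simpl; [ring|field; auto].
Qed.

Lemma qs_plus a b z : goodc a -> goodc b -> in_H z -> qs (fun n => a n + b n)%C z = (qs a z + qs b z)%C.
Proof.
  intros Ha Hb Hz. apply cser_CS. eapply cser_ext; [|apply cser_plus; apply qs_cser; eauto].
  intros; cbv beta; ring.
Qed.

Lemma qs_scal c a z : goodc a -> in_H z -> qs (fun n => c * a n)%C z = (c * qs a z)%C.
Proof.
  intros Ha Hz. apply cser_CS. eapply cser_ext; [|apply cser_scal, qs_cser; eauto].
  intros; cbv beta; ring.
Qed.

Lemma pser_bounded a rho : goodc a -> 0 <= rho < 1 -> exists B, forall w, Cmod w <= rho -> Cmod (pser a w) <= B.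
Proof.
  intros Ha Hr. exists (Series (fun n => Cmod (a n) * rho ^ n)). intros w Hw.
  apply CS_le_Series; [|now apply Ha]. intros n. rewrite Cmod_mult, Cmod_pow.
  apply Rmult_le_compat_l; [apply Cmod_ge_0|]. apply pow_incr; auto using Cmod_ge_0.
Qed.

Lemma Cmod_qexp_le z y0 : y0 <= Im z -> Cmod (qexp z) <= exp (- (2 * PI * y0)).
Proof.
  intros H. rewrite Cmod_qexp. assert (P := PI_RGT_0).
  destruct H as [H| ->]; [|lra]. apply Rlt_le, exp_increasing. nra.
Qed.

Lemma exp_lt1 y0 : 0 < y0 -> 0 <= exp (- (2 * PI * y0)) < 1.
Proof.
  intros H. split; [apply Rlt_le, exp_pos|]. rewrite <- exp_0. apply exp_increasing.
  generalize PI_RGT_0; intros. assert (0 < 2 * PI * y0) by (apply Rmult_lt_0_compat; lra). lra.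
Qed.

Lemma qs_bounded a y0 : goodc a -> 0 < y0 -> exists B, forall z, y0 <= Im z -> Cmod (qs a z) <= B.
Proof.
  intros Ha H. destruct (pser_bounded a _ Ha (exp_lt1 y0 H)) as [B HB].
  exists B; intros z Hz. apply HB. now apply Cmod_qexp_le.
Qed.

Lemma qs_periodic a z n : qs a (z + IZR n)%C = qs a z.
Proof. unfold qs. rewrite qexp_plus, qexp_IZR. f_equal; ring. Qed.

(** * The Eisenstein series of weight 2 *)

Lemma cser_geom x : Cmod x < 1 -> cser (fun n => x ^ n)%C (/ (1 - x))%C.
Proof.
  intros Hx.
  assert (N : (1 - x)%C <> RtoC 0).
  { intros E. replace x with (1 - (1 - x))%C in Hx by ring. rewrite E in Hx.
    replace (1 - 0)%C with (RtoC 1) in Hx by ring. rewrite Cmod_1 in Hx. lra. }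
  assert (A := pser_cser _ x goodc_1 Hx).
  apply (cser_ext _ (fun n => x ^ n)%C) in A; [|intros; ring].
  replace (/ (1 - x))%C with (pser (fun _ => RtoC 1) x); [exact A|]. set (G := pser _ _) in *.
  assert (B := cser_decr _ _ A). cbv beta in B.
  assert (B2 := cser_scal x _ _ A). apply (cser_ext _ (fun n => x ^ (S n))%C) in B2; [|intros; rewrite Cpow_S; ring].
  assert (E := cser_unique _ _ _ B B2).
  replace G with ((G - x ^ 0 - x * G + 1) * / (1 - x))%C by (simpl; field; auto).
  rewrite E. field. auto.
Qed.

Lemma cser_kpow x : Cmod x < 1 -> cser (fun n => INR n * x ^ n)%C (x / ((x - 1) * (x - 1)))%C.
Proof.
  intros Hx.
  assert (N : (1 - x)%C <> RtoC 0).
  { intros E. replace x with (1 - (1 - x))%C in Hx by ring. rewrite E in Hx.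
    replace (1 - 0)%C with (RtoC 1) in Hx by ring. rewrite Cmod_1 in Hx. lra. }
  assert (N' : (x - 1)%C <> RtoC 0).
  { intros E. apply N. replace (1 - x)%C with (- (x - 1))%C by ring. rewrite E. ring. }
  assert (A := pser_cser _ x (goodc_INR _ goodc_1) Hx).
  apply (cser_ext _ (fun n => INR n * x ^ n)%C) in A; [|intros; ring].
  replace (x / ((x - 1) * (x - 1)))%C with (pser (fun n => (INR n * 1)%C) x); [exact A|]. set (G := pser _ _) in *.
  assert (B := cser_decr _ _ A). cbv beta in B.
  assert (B2 := cser_plus _ _ _ _ (cser_scal x _ _ A) (cser_scal x _ _ (cser_geom x Hx))).
  apply (cser_ext _ (fun n => INR (S n) * x ^ (S n))%C) in B2; [|intros; rewrite Cpow_S, S_INR, RtoC_plus; ring].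
  assert (E := cser_unique _ _ _ B B2).
  assert (E2 : (G * (1 - x) = x * / (1 - x))%C).
  { replace (G * (1 - x))%C with ((G - RtoC (INR 0) * x ^ 0) - x * G)%C by (simpl; ring). rewrite E. ring. }
  replace G with ((G * (1 - x)) * / (1 - x))%C by (field; auto). rewrite E2. field. auto.
Qed.

(** * Divisor sums and Lambert series *)

Definition ediv (m N : nat) : nat := if (N mod m =? 0)%nat then (N / m)%nat else O.

Fixpoint nsum (u : nat -> nat) (n : nat) : nat :=
  match n with O => O | S p => (nsum u p + u p)%nat end.

(** The sum runs over the codivisor m and adds N/m, which is how the coefficient arises from the
    m-th Lambert term. *)
Definition sigma1 (N : nat) : nat := nsum (fun m => ediv (S m) N) N.

Lemma ediv_le m N : (ediv m N <= N)%nat.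
Proof.
  unfold ediv. destruct (N mod m =? 0)%nat; [|lia]. destruct m; [simpl; lia|].
  apply Nat.Div0.div_le_upper_bound. nia.
Qed.

Lemma ediv_0 m N : (N < m)%nat -> ediv m N = O.
Proof.
  intros H. unfold ediv. destruct (N mod m =? 0)%nat; auto. apply Nat.div_small; auto.
Qed.

Lemma nsum_le u v n : (forall k, (k < n)%nat -> (u k <= v k)%nat) -> (nsum u n <= nsum v n)%nat.
Proof. induction n; intros H; simpl; auto. specialize (IHn (fun k Hk => H k (Nat.lt_lt_succ_r _ _ Hk))). specialize (H n ltac:(lia)). lia. Qed.

Lemma nsum_const c n : nsum (fun _ => c) n = (n * c)%nat.
Proof. induction n; simpl; lia. Qed.

Lemma nsum_app u n m : nsum u (n + m) = (nsum u n + nsum (fun k => u (n + k)) m)%nat.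
Proof. induction m; simpl. rewrite Nat.add_0_r; lia. rewrite Nat.add_succ_r. simpl. lia. Qed.

Lemma nsum_ediv_le M N : (nsum (fun m => ediv (S m) N) M <= sigma1 N)%nat.
Proof.
  unfold sigma1. destruct (le_lt_dec M N) as [L|L].
  - assert (E := nsum_app (fun m => ediv (S m) N) M (N - M)).
    replace (M + (N - M))%nat with N in E by lia. lia.
  - replace M with (N + (M - N))%nat by lia. rewrite nsum_app.
    assert (nsum (fun k => ediv (S (N + k)) N) (M - N) <= nsum (fun _ => 0) (M - N))%nat.
    { apply nsum_le. intros k _. rewrite ediv_0; lia. }
    rewrite nsum_const in H. lia.
Qed.

Lemma nsum_ediv_eq M N : (N <= M)%nat -> nsum (fun m => ediv (S m) N) M = sigma1 N.
Proof.
  intros L. unfold sigma1. replace M with (N + (M - N))%nat by lia. rewrite nsum_app.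
  assert (nsum (fun k => ediv (S (N + k)) N) (M - N) <= nsum (fun _ => 0) (M - N))%nat.
  { apply nsum_le. intros k _. rewrite ediv_0; lia. }
  rewrite nsum_const in H. lia.
Qed.

Lemma sigma_le N : (sigma1 N <= N * N)%nat.
Proof.
  unfold sigma1. eapply Nat.le_trans; [apply (nsum_le _ (fun _ => N)); intros; apply ediv_le|].
  rewrite nsum_const. lia.
Qed.

Lemma goodc_poly2 (a : nat -> C) : (forall n, Cmod (a n) <= INR (n * n)) -> goodc a.
Proof.
  intros H. apply goodc_le with (fun n => INR n * (INR n * 1))%C.
  - intros n. eapply Rle_trans; [apply H|]. rewrite !Cmod_mult, Cmod_1, Cmod_R, Rabs_pos_eq by apply pos_INR.
    rewrite mult_INR. lra.
  - apply goodc_INR, goodc_INR, goodc_1.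
Qed.

Definition sigc (n : nat) : C := RtoC (INR (sigma1 n)).

Lemma goodc_sigc : goodc sigc.
Proof.
  apply goodc_poly2. intros n. unfold sigc. rewrite Cmod_R, Rabs_pos_eq by apply pos_INR.
  apply le_INR, sigma_le.
Qed.

Lemma csum_spread x m K : csum (fun N => INR (ediv (S m) N) * x ^ N)%C (S m * K)
   = csum (fun k => INR k * (x ^ S m) ^ k)%C K.
Proof.
  induction K as [|K IH].
  - rewrite Nat.mul_0_r. reflexivity.
  - replace (S m * S K)%nat with (S m * K + S m)%nat by lia. rewrite csum_app, IH, (csum_S _ K). f_equal.
    rewrite (csum_Sl _ m), csum_0.
    + cbv beta. rewrite Nat.add_0_r, Cplus_0_r. unfold ediv. rewrite Nat.mul_comm, Nat.Div0.mod_mul, Nat.div_mul by lia.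
      simpl (0 =? 0)%nat. cbv iota. rewrite <- Cpow_mult_r. f_equal. f_equal. lia.
    + intros i Hi. unfold ediv.
      replace (S m * K + S i)%nat with (S i + K * S m)%nat by lia.
      rewrite Nat.Div0.mod_add, Nat.mod_small by lia. simpl. ring.
Qed.

Lemma cser_spread x m : Cmod x < 1 ->
  cser (fun N => INR (ediv (S m) N) * x ^ N)%C (x ^ S m / ((x ^ S m - 1) * (x ^ S m - 1)))%C.
Proof.
  intros Hx.
  assert (G : goodc (fun N => RtoC (INR (ediv (S m) N)))).
  { apply goodc_poly2. intros n. rewrite Cmod_R, Rabs_pos_eq by apply pos_INR. apply le_INR.
    generalize (ediv_le (S m) n). nia. }
  assert (A := pser_cser _ x G Hx).
  replace (x ^ S m / ((x ^ S m - 1) * (x ^ S m - 1)))%C with (pser (fun N => RtoC (INR (ediv (S m) N))) x); [exact A|].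
  assert (H1 : Cmod (x ^ S m)%C < 1).
  { rewrite Cmod_pow. assert (0 <= Cmod x) by apply Cmod_ge_0.
    replace 1 with (1 ^ S m) by apply pow1.
    assert (forall n, Cmod x ^ S n < 1).
    { induction n. simpl; lra. change (Cmod x ^ S (S n)) with (Cmod x * Cmod x ^ S n).
      assert (0 <= Cmod x ^ S n) by (apply pow_le; lra). nra. }
    rewrite pow1. apply H0. }
  assert (B := cser_kpow _ H1). eapply clim_unique; [|exact B].
  assert (A' : clim (fun K => csum (fun N => INR (ediv (S m) N) * x ^ N)%C (S m * K)) (pser (fun N => RtoC (INR (ediv (S m) N))) x)).
  { apply (clim_subseq _ _ (fun K => S m * K)%nat); [intros; lia|exact A]. }
  apply clim_ext with (2 := A').
  intros K. apply csum_spread.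
Qed.

(** The m-th term is the sum of k x^(mk). The sum of the first M terms has coefficients at most
    sigma(N), with equality once M >= N, so [tannery] applies. *)
Theorem lambert x : Cmod x < 1 ->
  cser (fun m => x ^ S m / ((x ^ S m - 1) * (x ^ S m - 1)))%C (pser sigc x).
Proof.
  intros Hx. unfold cser.
  apply clim_ext with (fun M => CS (fun N => RtoC (INR (nsum (fun m => ediv (S m) N) M)) * x ^ N)%C).
  - intros M. apply cser_CS. induction M as [|M IH].
    + simpl. unfold cser. apply clim_ext with (fun _ => RtoC 0); [|apply clim_const].
      intros n. symmetry; apply csum_0. intros; ring.
    + rewrite csum_S. eapply cser_ext; [|apply cser_plus; [exact IH|apply (cser_spread x M Hx)]].
      intros N. cbv beta. simpl nsum. rewrite plus_INR, RtoC_plus. ring.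
  - unfold pser. apply tannery with (fun N => Cmod (sigc N) * Cmod x ^ N).
    + apply goodc_sigc. split; auto using Cmod_ge_0.
    + intros M N. rewrite Cmod_mult, Cmod_pow. apply Rmult_le_compat_r; [apply pow_le, Cmod_ge_0|].
      unfold sigc. rewrite !Cmod_R, !Rabs_pos_eq by apply pos_INR. apply le_INR, nsum_ediv_le.
    + intros N. apply clim_ext_ev with (fun _ => sigc N * x ^ N)%C; [|apply clim_const].
      exists N; intros M HM. unfold sigc. now rewrite nsum_ediv_eq.
Qed.

Lemma in_H_qexp_neq1 z : in_H z -> qexp z <> RtoC 1.
Proof. intros H E. assert (L := Cmod_qexp_lt1 z H). rewrite E, Cmod_1 in L. lra. Qed.

Lemma in_H_nz z : in_H z -> z <> RtoC 0.
Proof. intros H E. subst. unfold in_H, Im, RtoC in H; simpl in H. lra. Qed.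

Lemma in_H_scal m z : in_H z -> in_H (INR (S m) * z)%C.
Proof. intros H. unfold in_H in *. rewrite im_scal_l. generalize (INR_S_ge1 m). nra. Qed.

(* [Kq w] is the sum of 1/(w+n)^2 over all integers n. *)
Definition Kq (w : C) : C := (- (4 * PI * PI) * qexp w / ((qexp w - 1) * (qexp w - 1)))%C.

Definition P2 (z : C) : C := (1 - 24 * qs sigc z)%C.

(** The link between P and the lattice: [Kq (m z)] sums 1/(mz+n)^2 over n, and by [lambert] these
    rows add up to -4 pi^2 = -24 pi^2/6 times the series of sigma. *)
Lemma Kq_sum z : in_H z -> cser (fun m => Kq (INR (S m) * z)%C) ((P2 z - 1) * (PI * PI / 6))%C.
Proof.
  intros H. assert (L := lambert (qexp z) (Cmod_qexp_lt1 z H)).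
  apply (cser_scal (- (4 * PI * PI))%C) in L.
  replace ((P2 z - 1) * (PI * PI / 6))%C with (- (4 * PI * PI) * pser sigc (qexp z))%C.
  - eapply cser_ext; [|exact L]. intros m. unfold Kq. rewrite <- qexp_pow. unfold Cdiv. ring.
  - unfold P2, qs. field.
Qed.

(** Finitely many columns may be exchanged by additivity; the product majorant lets their number
    tend to infinity under the outer sum. *)
Lemma fubini (u : nat -> nat -> C) K :
  (forall m n, Cmod (u m n) <= K * (/ (INR (S m) * INR (S m)) * / (INR (S n) * INR (S n)))) ->
  CS (fun m => CS (u m)) = CS (fun n => CS (fun m => u m n)).
Proof.
  intros H. set (al := fun m => / (INR (S m) * INR (S m))).
  assert (Pal : forall m, 0 <= al m) by (intros; apply inv_sq_nonneg).
  assert (PK : 0 <= K).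
  { specialize (H O O). simpl in H. rewrite !Rmult_1_l, Rinv_1, !Rmult_1_r in H.
    eapply Rle_trans; [apply Cmod_ge_0|exact H]. }
  assert (S1 : ex_series al) by apply ex_series_inv_sq.
  assert (B1 : forall m n, Cmod (u m n) <= (K * al m) * al n) by (intros; unfold al; rewrite Rmult_assoc; apply H).
  assert (B2 : forall n m, Cmod (u m n) <= (K * al n) * al m).
  { intros. eapply Rle_trans; [apply B1|]. right; ring. }
  symmetry. apply cser_CS.
  unfold cser. apply clim_ext with (fun N => CS (fun m => csum (u m) N)).
  - intros N. apply cser_CS. induction N as [|N IH].
    + simpl. unfold cser. apply clim_ext with (fun _ => RtoC 0); [|apply clim_const].
      intros n. symmetry; apply csum_0; auto.
    + rewrite csum_S. eapply cser_ext; [|apply cser_plus; [exact IH|]].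
      2:{ apply asum_cser. apply (asum_inv_sq_bound (fun m => u m N) (K * al N)). intros; apply B2. }
      intros m. reflexivity.
  - apply tannery with (fun m => (K * Series al) * al m).
    + apply @ex_series_scal_l with (c := K * Series al). exact S1.
    + intros N m. eapply Rle_trans; [apply (csum_le_Series _ _ _ (B1 m))|].
      * apply @ex_series_scal_l with (c := K * al m). exact S1.
      * rewrite Series_scal_l. right; ring.
    + intros m. apply asum_cser. apply (asum_inv_sq_bound (u m) (K * al m)). intros; apply B1.
Qed.

(* [bq] telescopes along the integers, and the difference [dq] from 1/x^2 decays like |x|^(-4). *)
Definition bq (x : C) : C := (/ (x - / 2) - / (x + / 2))%C.
Definition dq (x : C) : C := (/ (x * x) - bq x)%C.

Lemma dq_closed x : x <> RtoC 0 -> (x - / 2)%C <> RtoC 0 -> (x + / 2)%C <> RtoC 0 ->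
  dq x = (- / 4 * (/ (x * x) * / ((x - / 2) * (x + / 2))))%C.
Proof.
  intros H1 H2 H3. unfold dq, bq.
  assert (H2' : (x * 2 - 1)%C <> RtoC 0).
  { intros E. apply H2. replace (x - / 2)%C with ((x * 2 - 1) * / 2)%C by field. rewrite E; ring. }
  assert (H3' : (x * 2 + 1)%C <> RtoC 0).
  { intros E. apply H3. replace (x + / 2)%C with ((x * 2 + 1) * / 2)%C by field. rewrite E; ring. }
  field. auto.
Qed.

(** Two imaginary parts: that of xz + s is x Im z, and that of (xz + s) times the conjugate of z is
    -s Im z. *)
Lemma lattice_lower z x s : in_H z -> 0 <= x ->
  x * Im z <= Cmod (RtoC x * z + RtoC s)%C /\ Rabs s * (Im z / Cmod z) <= Cmod (RtoC x * z + RtoC s)%C.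
Proof.
  intros H Hx. unfold in_H in H. assert (Pz := proj1 (Cmod_gt_0 _) (in_H_nz z H)). split.
  - eapply Rle_trans; [|apply im_le_Cmod]. eapply Rle_trans; [|apply Rle_abs].
    right. destruct z; unfold Im; simpl. ring.
  - apply Rmult_le_reg_r with (Cmod z); auto.
    replace (Rabs s * (Im z / Cmod z) * Cmod z) with (Rabs s * Im z) by (field; lra).
    rewrite <- (Cmod_conj z). rewrite <- Cmod_mult.
    eapply Rle_trans; [|apply im_le_Cmod].
    replace (Im ((RtoC x * z + RtoC s) * Cconj z)%C) with (- (s * Im z)).
    + rewrite Rabs_Ropp, Rabs_mult, (Rabs_pos_eq (Im z)) by lra. lra.
    + destruct z; unfold Im; simpl. ring.
Qed.

(** The lattice points mz + n and mz - n together, so that both indices run over positive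
    integers. *)
Definition epair (z : C) (m n : nat) : C :=
  (dq (INR (S m) * z + INR (S n)) + dq (INR (S m) * z - INR (S n)))%C.

(** Of the four factors in the denominator of [dq_closed], two are bounded below by multiples of m
    and two by multiples of n, which gives the product majorant of [fubini]. *)
Lemma epair_bound z : in_H z -> exists K, forall m n,
  Cmod (epair z m n) <= K * (/ (INR (S m) * INR (S m)) * / (INR (S n) * INR (S n))).
Proof.
  intros H. assert (Hy := H). unfold in_H in Hy. assert (Pz := proj1 (Cmod_gt_0 _) (in_H_nz z H)).
  assert (Pr : 0 < Im z / Cmod z) by (now apply Rdiv_lt_0_compat).
  (* The extra division by 2 pays for the shifts by 1/2, since |n +- 1/2| >= n/2 for n >= 1. *)
  set (d := Rmin (Im z) (Im z / Cmod z / 2)).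
  assert (Pd : 0 < d) by (unfold d; apply Rmin_glb_lt; lra).
  assert (d1 : d <= Im z) by apply Rmin_l. assert (d2 : d <= Im z / Cmod z / 2) by apply Rmin_r.
  assert (L : forall m n s, Rabs s >= INR (S n) / 2 ->
     d * INR (S m) <= Cmod (INR (S m) * z + RtoC s)%C /\ d * INR (S n) <= Cmod (INR (S m) * z + RtoC s)%C).
  { intros m n s Hs. assert (Q := INR_S_ge1 m). assert (Q2 := INR_S_ge1 n).
    destruct (lattice_lower z (INR (S m)) s H ltac:(lra)) as [l1 l2]. split; nra. }
  assert (B : forall m n s, s = INR (S n) \/ s = - INR (S n) ->
     Cmod (dq (INR (S m) * z + RtoC s)) <= (/ 4 * (/ (d * d) * / (d * d))) * (/ (INR (S m) * INR (S m)) * / (INR (S n) * INR (S n)))).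
  { intros m n s Hs. assert (Q := INR_S_ge1 m). assert (Q2 := INR_S_ge1 n).
    set (x := (INR (S m) * z + RtoC s)%C).
    assert (Ex1 : (x - / 2)%C = (INR (S m) * z + RtoC (s - 1/2))%C).
    { unfold x. rewrite RtoC_minus, RtoC_div by lra. field. }
    assert (Ex2 : (x + / 2)%C = (INR (S m) * z + RtoC (s + 1/2))%C).
    { unfold x. rewrite RtoC_plus, RtoC_div by lra. field. }
    destruct (L m n s) as [a1 a2].
    { destruct Hs as [->| ->]; rewrite ?Rabs_Ropp, Rabs_pos_eq; lra. }
    destruct (L m n (s - 1/2)) as [b1 b2].
    { destruct Hs as [->| ->]; [rewrite Rabs_pos_eq|rewrite Rabs_left]; lra. }
    destruct (L m n (s + 1/2)) as [c1 c2].
    { destruct Hs as [->| ->]; [rewrite Rabs_pos_eq|rewrite Rabs_left1]; lra. }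
    fold x in a1, a2. rewrite <- Ex1 in b1, b2. rewrite <- Ex2 in c1, c2.
    assert (P : 0 < d * INR (S m)) by nra.
    rewrite dq_closed by (apply Cmod_gt_0; lra).
    assert (C4 : Cmod (- / 4)%C = / 4).
    { rewrite Cmod_opp, Cmod_inv by (apply RtoC_neq0; lra). rewrite Cmod_R, Rabs_pos_eq; lra. }
    rewrite Cmod_mult, C4, Cmod_mult, (Rmult_assoc (/ 4)).
    apply Rmult_le_compat_l; [lra|].
    assert (I1 := Cmod_inv_mult_le x x (INR (S m)) d Pd ltac:(lra) a1 a1).
    assert (I2 := Cmod_inv_mult_le (x - / 2)%C (x + / 2)%C (INR (S n)) d Pd ltac:(lra) b2 c2).
    eapply Rle_trans; [apply Rmult_le_compat; [apply Cmod_ge_0|apply Cmod_ge_0|exact I1|exact I2]|].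
    right; ring. }
  exists (2 * (/ 4 * (/ (d * d) * / (d * d)))). intros m n. unfold epair.
  eapply Rle_trans; [apply Cmod_triangle|].
  assert (B1 := B m n (INR (S n)) (or_introl eq_refl)). assert (B2 := B m n (- INR (S n)) (or_intror eq_refl)).
  replace (INR (S m) * z - INR (S n))%C with (INR (S m) * z + RtoC (- INR (S n)))%C by (rewrite RtoC_opp; ring).
  lra.
Qed.

Lemma cser_minus u v a b : cser u a -> cser v b -> cser (fun n => u n - v n)%C (a - b)%C.
Proof.
  intros H1 H2. replace (a - b)%C with (a + (-(1)) * b)%C by ring.
  apply cser_ext with (fun n => u n + (-(1)) * v n)%C; [intros; ring|].
  apply cser_plus; auto. now apply cser_scal.
Qed.

Lemma cser_term u l : cser u l -> clim u (RtoC 0).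
Proof.
  intros H. apply clim_ext with (fun n => csum u (S n) - csum u n)%C; [intros; rewrite csum_S; ring|].
  replace (RtoC 0) with (l - l)%C by ring. apply clim_minus; auto.
  apply (clim_subseq _ _ S); [intros; lia|exact H].
Qed.

Lemma clim_pow x : Cmod x < 1 -> clim (fun n => x ^ n)%C (RtoC 0).
Proof. intros H. eapply cser_term. now apply cser_geom. Qed.

Lemma clim_inv_shift w (s : nat -> R) : in_H w -> (forall n, INR n < Rabs (s n)) ->
  clim (fun n => / (w + s n))%C (RtoC 0).
Proof.
  intros H Hs e He. assert (Hy := H). unfold in_H in Hy. assert (Pz := proj1 (Cmod_gt_0 _) (in_H_nz w H)).
  set (d := Im w / Cmod w). assert (Pd : 0 < d) by (now apply Rdiv_lt_0_compat).
  destruct (nfloor_ex (/ (d * e))) as [N [_ HN]].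
  { apply Rlt_le, Rinv_0_lt_compat. nra. }
  exists (S N); intros n Hn. specialize (Hs n).
  destruct (lattice_lower w 1 (s n) H ltac:(lra)) as [_ L]. fold d in L. rewrite Cmult_1_l in L.
  assert (B : INR N + 1 <= INR n) by (rewrite <- S_INR; apply le_INR; auto).
  assert (B2 : / (d * e) < Rabs (s n)) by lra.
  assert (B3 : / e < Rabs (s n) * d).
  { apply Rmult_lt_compat_r with (r := d) in B2; auto. replace (/ (d * e) * d) with (/ e) in B2 by (field; lra). exact B2. }
  assert (Pe := Rinv_0_lt_compat _ He).
  replace (/ (w + s n) - 0)%C with (/ (w + s n))%C by ring.
  rewrite Cmod_inv by (apply Cmod_gt_0; lra). rewrite <- (Rinv_inv e). apply Rinv_lt_contravar; [|lra].
  apply Rmult_lt_0_compat; lra.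
Qed.

(** Over all integers the telescoping sum is 0; leaving out the term of 0 leaves [- bq w]. *)
Lemma bq_telescope w : in_H w -> cser (fun j => bq (w + INR (S j)) + bq (w - INR (S j)))%C (- bq w)%C.
Proof.
  intros H. unfold cser.
  assert (E : forall N, csum (fun j => bq (w + INR (S j)) + bq (w - INR (S j)))%C N
    = ((/ (w + RtoC (- (INR N + 1/2))) - / (w + RtoC (INR N + 1/2))) - bq w)%C).
  { assert (h2 : RtoC (1/2) = (/ 2)%C) by (rewrite RtoC_div by lra; field).
    induction N.
    - simpl. rewrite Rplus_0_l, RtoC_opp, h2. unfold bq. change (w + - / 2)%C with (w - / 2)%C. ring.
    - rewrite csum_S, IHN. unfold bq. 
      replace (w + INR (S N) - / 2)%C with (w + RtoC (INR N + 1/2))%C.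
      replace (w + INR (S N) + / 2)%C with (w + RtoC (INR (S N) + 1/2))%C.
      replace (w - INR (S N) - / 2)%C with (w + RtoC (- (INR (S N) + 1/2)))%C.
      replace (w - INR (S N) + / 2)%C with (w + RtoC (- (INR N + 1/2)))%C.
      + ring.
      + rewrite RtoC_opp, S_INR, !RtoC_plus, h2. field.
      + rewrite RtoC_opp, S_INR, !RtoC_plus, h2. field.
      + rewrite RtoC_plus, h2. ring.
      + rewrite S_INR, !RtoC_plus, h2. field. }
  replace (- bq w)%C with ((0 - 0) - bq w)%C by ring.
  apply clim_ext with (fun N => (/ (w + RtoC (- (INR N + 1/2))) - / (w + RtoC (INR N + 1/2))) - bq w)%C.
  - intros n; now rewrite E.
  - apply clim_minus; [|apply clim_const]. apply clim_minus.
    + apply (clim_inv_shift w (fun N => - (INR N + 1/2))); auto.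
      intros n. rewrite Rabs_Ropp, Rabs_pos_eq; generalize (pos_INR n); lra.
    + apply (clim_inv_shift w (fun N => INR N + 1/2)); auto.
      intros n. rewrite Rabs_pos_eq; generalize (pos_INR n); lra.
Qed.

Lemma dq_bq x : (/ (x * x) = dq x + bq x)%C.
Proof. unfold dq. ring. Qed.

(** Along a row the telescoping parts add up to 0, so replacing 1/x^2 by [dq x] does not change the
    row sum. *)
Lemma Kq_eq w : in_H w -> cser (fun j => dq (w + INR (S j)) + dq (w - INR (S j)))%C (Kq w - dq w)%C.
Proof.
  intros H. assert (K := K_expansion w (in_H_qexp_neq1 w H)). fold (Kq w) in K.
  assert (B := bq_telescope w H).
  replace (Kq w - dq w)%C with ((Kq w - / (w * w)) - - bq w)%C by (unfold dq; ring).
  eapply cser_ext; [|apply cser_minus; [exact K|exact B]].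
  intros n. cbv beta. rewrite (dq_bq (w + _)), (dq_bq (w - _)). ring.
Qed.

(** Closed form of the sum over n >= 1 of 1/(nz+t) - 1/(nz-t): what the boundary terms of the
    telescoping parts yield when summed over the multiples of z. *)
Definition Gq (z : C) (t : R) : C := (PI / z * cotq (t / z) - / t)%C.

Lemma in_H_Sneg z : in_H z -> in_H (- / z)%C.
Proof.
  intros H. unfold in_H in *. destruct z as [x y]. unfold Im in *. simpl in *.
  replace (- (- y / (x * (x * 1) + y * (y * 1)))) with (y / (x * x + y * y)) by (field; nra).
  apply Rdiv_lt_0_compat; nra.
Qed.

Lemma in_H_mult_pos t z : 0 < t -> in_H z -> in_H (t * z)%C.
Proof. intros Ht H. unfold in_H in *. rewrite im_scal_l. nra. Qed.

Lemma qexp_tz_neq1 z t : in_H z -> 0 < t -> qexp (t / z)%C <> RtoC 1.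
Proof.
  intros H Ht E. apply (in_H_qexp_neq1 (t * - / z)%C).
  - apply in_H_mult_pos; auto. now apply in_H_Sneg.
  - replace (t * - / z)%C with (- (t / z))%C by (unfold Cdiv; ring). rewrite qexp_opp, E.
    field.
Qed.

Lemma Gq_sum z t : in_H z -> 0 < t ->
  cser (fun n => / (INR (S n) * z + t) - / (INR (S n) * z - t))%C (Gq z t).
Proof.
  intros H Ht. assert (Nz := in_H_nz z H). assert (Nt : RtoC t <> RtoC 0) by (apply RtoC_neq0; lra).
  assert (Q := qexp_tz_neq1 z t H Ht).
  assert (A := cser_scal (/ z)%C _ _ (cot_expansion _ Q)).
  replace (Gq z t) with (/ z * (PI * cotq (t / z) - / (t / z)))%C by (unfold Gq; field; auto).
  eapply cser_ext; [|exact A]. intros n. cbv beta.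
  assert (N1 := nonint_plus_nz _ (S n) Q). assert (N2 := nonint_minus_nz _ (S n) Q).
  assert (M1 : (INR (S n) * z + t)%C <> RtoC 0).
  { replace (INR (S n) * z + t)%C with ((t / z + INR (S n)) * z)%C by (field; auto). now apply Cmult_neq_0. }
  assert (M2 : (t - INR (S n) * z)%C <> RtoC 0).
  { replace (t - INR (S n) * z)%C with ((t / z - INR (S n)) * z)%C by (field; auto). now apply Cmult_neq_0. }
  assert (M3 : (INR (S n) * z - t)%C <> RtoC 0).
  { intros E; apply M2. replace (t - INR (S n) * z)%C with (- (INR (S n) * z - t))%C by ring. rewrite E; ring. }
  replace (t / z + INR (S n))%C with ((INR (S n) * z + t) / z)%C by (field; auto).
  replace (t / z - INR (S n))%C with (- (INR (S n) * z - t) / z)%C by (field; auto).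
  field. repeat split; auto.
Qed.

(** t/z goes to infinity in the lower half plane, where cot(pi t/z) tends to i. This limit is the
    source of the non-modular term in [P2_S]. *)
Lemma Gq_lim z : in_H z -> clim (fun N => Gq z (INR N + 1/2)) (PI * Ci / z)%C.
Proof.
  intros H. assert (Nz := in_H_nz z H). assert (HS := in_H_Sneg z H).
  set (p := fun N => (qexp (RtoC (1/2) * - / z) * qexp (- / z) ^ N)%C).
  assert (Lp : clim p (RtoC 0)).
  { unfold p. replace (RtoC 0) with (qexp (RtoC (1/2) * - / z) * 0)%C by ring.
    apply clim_scal, clim_pow. now apply Cmod_qexp_lt1. }
  assert (Pp : forall N, 0 < INR N + 1/2) by (intros; generalize (pos_INR N); lra).
  assert (Ep : forall N, qexp ((INR N + 1/2)%R / z)%C = (/ p N)%C).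
  { intros N. unfold p. rewrite qexp_pow, <- qexp_plus, <- qexp_opp. f_equal.
    rewrite RtoC_plus. field. auto. }
  assert (Np : forall N, p N <> RtoC 0).
  { intros N. unfold p. apply Cmult_neq_0; [apply qexp_nz|]. apply Cpow_nz, qexp_nz. }
  assert (Np1 : forall N, (1 - p N)%C <> RtoC 0).
  { intros N E. apply (qexp_tz_neq1 z _ H (Pp N)). rewrite Ep.
    replace (p N) with (RtoC 1). field. symmetry. apply Ceq_minus.
    replace (p N - 1)%C with (- (1 - p N))%C by ring. rewrite E. ring. }
  apply clim_ext with (fun N => (PI / z) * ((Ci * (1 + p N)) * / (1 - p N)) - / (INR N + 1/2)%R)%C.
  - intros N. unfold Gq, cotq. rewrite Ep. f_equal. f_equal.
    assert (X : (/ p N - 1)%C <> RtoC 0).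
    { replace (/ p N - 1)%C with ((1 - p N) * / p N)%C by (field; auto). apply Cmult_neq_0; auto.
      intros E. apply (Np N). replace (p N) with ((p N * p N) * / p N)%C by (field; auto). rewrite E; ring. }
    field. repeat split; auto.
  - replace (PI * Ci / z)%C with ((PI / z) * ((Ci * (1 + 0)) * / (1 - 0)) - 0)%C by (field; auto).
    apply clim_minus.
    + apply clim_scal, clim_mult.
      * apply clim_scal, clim_plus; [apply clim_const|auto].
      * apply clim_inv. replace (1 - 0)%C with (RtoC 1) by ring. apply RtoC_neq0; lra.
        apply clim_minus; [apply clim_const|auto].
    + intros e He. destruct (nfloor_ex (/ e)) as [N [_ HN]]. { apply Rlt_le, Rinv_0_lt_compat; auto. }
      exists (S N). intros n Hn. assert (B : INR N + 1 <= INR n) by (rewrite <- S_INR; apply le_INR; auto).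
      replace (/ (INR n + 1/2)%R - 0)%C with (/ (INR n + 1/2)%R)%C by ring.
      rewrite <- RtoC_inv by (specialize (Pp n); lra). rewrite Cmod_R, Rabs_pos_eq.
      2:{ apply Rlt_le, Rinv_0_lt_compat, Pp. }
      rewrite <- (Rinv_inv e). assert (Pe := Rinv_0_lt_compat _ He).
      apply Rinv_lt_contravar; [|lra]. apply Rmult_lt_0_compat; [auto|apply Pp].
Qed.

(* With 1/(mz+n)^2 = d(mz+n) + b(mz+n), the sum of the d's may be rearranged freely;
   only the telescoping b's feel the order of summation, and they produce the term pi i/z. *)
Theorem P2_S z : in_H z -> P2 (- / z)%C = (z * z * P2 z + 6 / (PI * Ci) * z)%C.
Proof.
  intros H. assert (Nz := in_H_nz z H). assert (HS := in_H_Sneg z H).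
  assert (NP : RtoC PI <> RtoC 0) by (apply RtoC_neq0; generalize PI_RGT_0; lra).
  assert (NI := Ci_nz).
  set (Z := (PI * PI / 6)%C).
  assert (Npos : forall n, RtoC (INR (S n)) <> RtoC 0) by (intros n; apply RtoC_neq0; generalize (INR_S_ge1 n); lra).
  destruct (epair_bound z H) as [K HK].
  assert (F := fubini (epair z) K HK). set (X := CS (fun m => CS (epair z m))) in F.
  set (al := fun m => / (INR (S m) * INR (S m))) in *.
  assert (S1 : ex_series al) by apply ex_series_inv_sq.
  assert (HKl : forall m n, Cmod (epair z m n) <= (K * al m) * al n) by (intros; unfold al; rewrite Rmult_assoc; apply HK).
  assert (HKr : forall n m, Cmod (epair z m n) <= (K * al n) * al m).
  { intros. eapply Rle_trans; [apply HKl|]. right; ring. }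
  assert (A1 : cser (fun m => CS (epair z m)) X).
  { apply asum_cser. apply asum_inv_sq_bound with (K * Series al). intros m.
    eapply Rle_trans; [apply (CS_le_Series _ _ (HKl m))|].
    - apply @ex_series_scal_l with (c := K * al m). exact S1.
    - rewrite Series_scal_l. fold (al m). right; ring. }
  assert (A2 : cser (fun m => CS (fun n => epair z n m)) X).
  { rewrite F. apply asum_cser. apply asum_inv_sq_bound with (K * Series al). intros m.
    eapply Rle_trans; [apply (CS_le_Series _ _ (HKr m))|].
    - apply @ex_series_scal_l with (c := K * al m). exact S1.
    - rewrite Series_scal_l. fold (al m). right; ring. }
  (* Inner sum over n: by [Kq_eq] only the terms [dq (m z)] remain, and they split into 1/(mz)^2 and
     the summands of [Gq z (1/2)]. *)
  assert (E1 : ((P2 z - 1) * Z - X = Z / (z * z) + Gq z (1/2))%C).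
  { assert (U := Kq_sum z H). fold Z in U.
    assert (D : cser (fun m => dq (INR (S m) * z)%C) ((P2 z - 1) * Z - X)%C).
    { eapply cser_ext; [|apply cser_minus; [exact U|exact A1]].
      intros m. cbv beta. assert (E := Kq_eq _ (in_H_scal m z H)). apply cser_CS in E.
      change (CS (epair z m)) with (CS (fun j => dq (INR (S m) * z + INR (S j)) + dq (INR (S m) * z - INR (S j)))%C).
      rewrite E. ring. }
    eapply cser_unique; [exact D|].
    assert (D2 := cser_plus _ _ _ _ (cser_scal (/ (z * z))%C _ _ zeta2) (Gq_sum z (1/2) H ltac:(lra))).
    replace (Z / (z * z) + Gq z (1/2))%C with (/ (z * z) * Z + Gq z (1/2))%C by (unfold Cdiv; ring).
    eapply cser_ext; [|exact D2]. intros m. cbv beta. unfold dq, bq.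
    replace (RtoC (1/2)) with (/ 2)%C by (rewrite RtoC_div by lra; field).
    replace (/ (INR (S m) * z * (INR (S m) * z)))%C with (/ (z * z) * / (INR (S m) * INR (S m)))%C by (field; auto).
    ring. }
  (* Inner sum over the multiples of z: these rows belong to -1/z, and the telescoping parts give
     differences of [Gq] at half integers, whose outer sum telescopes to [Gq z (1/2)] minus the
     limit of [Gq_lim]. *)
  assert (E2 : (/ (z * z) * ((P2 (- / z) - 1) * Z) = Z + (Gq z (1/2) - PI * Ci / z) + X)%C).
  { assert (U := cser_scal (/ (z * z))%C _ _ (Kq_sum _ HS)). fold Z in U.
    eapply cser_unique; [exact U|].
    assert (T : cser (fun m => Gq z (INR m + 1/2) - Gq z (INR (S m) + 1/2))%C (Gq z (1/2) - PI * Ci / z)%C).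
    { unfold cser. apply clim_ext with (fun N => Gq z (1/2) - Gq z (INR N + 1/2))%C.
      - induction n.
        + simpl. rewrite Rplus_0_l. ring.
        + rewrite csum_S, <- IHn. ring.
      - apply clim_minus; [apply clim_const|now apply Gq_lim]. }
    eapply cser_ext; [|apply cser_plus; [apply cser_plus; [apply zeta2|exact T]|exact A2]].
    intros m. cbv beta.
    assert (Hw := in_H_scal m _ HS). set (w := (INR (S m) * - / z)%C) in *.
    assert (K1 := cser_scal (/ (z * z))%C _ _ (K_expansion w (in_H_qexp_neq1 w Hw))). fold (Kq w) in K1.
    assert (P1 : 0 < INR m + 1/2) by (generalize (pos_INR m); lra).
    assert (P3 : 0 < INR (S m) + 1/2) by (generalize (pos_INR (S m)); lra).
    assert (G := cser_minus _ _ _ _ (Gq_sum z _ H P1) (Gq_sum z _ H P3)).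
    assert (R := cser_minus _ _ _ _ K1 G).
    assert (E : CS (fun n => epair z n m) =
       (/ (z * z) * (Kq w - / (w * w)) - (Gq z (INR m + 1/2) - Gq z (INR (S m) + 1/2)))%C).
    { apply cser_CS. eapply cser_ext; [|exact R]. intros n. cbv beta. unfold epair.
      set (x := (INR (S n) * z)%C).
      assert (e1 : (w + INR (S n) = (x - INR (S m)) * / z)%C) by (unfold w, x; field; auto).
      assert (e2 : (w - INR (S n) = - (x + INR (S m)) * / z)%C) by (unfold w, x; field; auto).
      assert (Q1 := nonint_plus_nz _ (S n) (in_H_qexp_neq1 w Hw)). rewrite e1 in Q1.
      assert (Q2 := nonint_minus_nz _ (S n) (in_H_qexp_neq1 w Hw)). rewrite e2 in Q2.
      assert (R1 : (x - INR (S m))%C <> RtoC 0) by (intros Q; apply Q1; rewrite Q; ring).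
      assert (R2 : (x + INR (S m))%C <> RtoC 0) by (intros Q; apply Q2; rewrite Q; ring).
      rewrite e1, e2.
      replace (/ (z * z) * (/ ((x - INR (S m)) * / z * ((x - INR (S m)) * / z)) + / (- (x + INR (S m)) * / z * (- (x + INR (S m)) * / z))))%C
        with (/ ((x + INR (S m)) * (x + INR (S m))) + / ((x - INR (S m)) * (x - INR (S m))))%C.
      - rewrite (dq_bq (x + _)), (dq_bq (x - _)). unfold bq.
        assert (h2 : RtoC (1/2) = (/ 2)%C) by (rewrite RtoC_div by lra; field).
        rewrite !RtoC_plus, h2.
        replace (x + INR (S m) - / 2)%C with (x + (INR m + / 2))%C by (rewrite S_INR, RtoC_plus; field).
        replace (x + INR (S m) + / 2)%C with (x + (INR (S m) + / 2))%C by ring.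
        replace (x - INR (S m) + / 2)%C with (x - (INR m + / 2))%C by (rewrite S_INR, RtoC_plus; field).
        replace (x - INR (S m) - / 2)%C with (x - (INR (S m) + / 2))%C by ring.
        ring.
      - field. repeat split; auto. }
    rewrite E. unfold w. field. auto. }
  assert (NZ : Z <> RtoC 0).
  { unfold Z. unfold Cdiv. repeat apply Cmult_neq_0; auto. rewrite <- RtoC_inv by lra. apply RtoC_neq0; lra. }
  assert (EX : X = ((P2 z - 1) * Z - (Z / (z * z) + Gq z (1/2)))%C) by (rewrite <- E1; ring).
  rewrite EX in E2.
  replace (P2 (- / z)%C) with (z * z * (/ (z * z) * ((P2 (- / z) - 1) * Z)) * / Z + 1)%C by (field; auto).
  rewrite E2. 
  assert (I2 : (Ci * Ci = - (1))%C) by (unfold Ci, Cmult, Copp, RtoC; simpl; f_equal; ring).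
  replace (6 / (PI * Ci))%C with (- 6 * Ci / PI)%C.
  - unfold Z in *. field. auto.
  - replace (- 6 * Ci / PI)%C with (- 6 * (Ci * Ci) / (PI * Ci))%C by (field; auto). rewrite I2. field. auto.
Qed.

(** * Transformation laws under SL2(Z) *)

Definition TP (z : C) : C := (- 24 * qs (fun n => INR n * sigc n)%C z)%C.
Definition E4 (z : C) : C := (P2 z * P2 z - 12 * TP z)%C.

Definition kap : C := (6 / (PI * Ci))%C.

Lemma PIC_nz : RtoC PI <> RtoC 0.
Proof. apply RtoC_neq0; generalize PI_RGT_0; lra. Qed.

Lemma Ci2 : (Ci * Ci = - (1))%C.
Proof. unfold Ci, Cmult, Copp, RtoC; simpl; f_equal; ring. Qed.

Lemma in_H_open z : in_H z -> exists d, 0 < d /\ forall h, Cmod h < d -> in_H (z + h)%C.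
Proof.
  intros H. exists (Im z); split; [exact H|]. intros h Hh. unfold in_H in *.
  assert (B := im_le_Cmod h). apply Rabs_le_between in B.
  replace (Im (z + h)%C) with (Im z + Im h) by (destruct z, h; reflexivity). lra.
Qed.

Lemma cder_P2 z : in_H z -> cder P2 z (twopii * TP z)%C.
Proof.
  intros H. unfold P2, TP.
  replace (twopii * (-24 * qs (fun n : nat => INR n * sigc n) z))%C
    with (0 - 24 * (twopii * qs (fun n : nat => INR n * sigc n) z))%C by ring.
  apply cder_minus; [apply cder_const|]. apply cder_scal, cder_qs; auto using goodc_sigc.
Qed.

Lemma cder_neginv z : z <> RtoC 0 -> cder (fun w => - / w)%C z (/ (z * z))%C.
Proof.
  intros N. apply cder_ext with (fun w => (-(1)) * / w)%C; [intros; ring|].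
  replace (/ (z * z))%C with ((-(1)) * - / (z * z))%C by ring. now apply cder_scal, cder_inv.
Qed.

Lemma TP_S z : in_H z -> (TP (- / z) = z * z * (z * z) * TP z + z * z * (2 * z * P2 z + kap) / twopii)%C.
Proof.
  intros H. assert (Nz := in_H_nz z H). assert (HS := in_H_Sneg z H). assert (NT := twopii_nz).
  assert (D1 := cder_comp P2 (fun w => - / w)%C z _ _ (cder_neginv z Nz) (cder_P2 _ HS)).
  assert (D2 : cder (fun w => w * w * P2 w + kap * w)%C z (2 * z * P2 z + z * z * (twopii * TP z) + kap)%C).
  { apply cder_plus.
    - apply (cder_mult (fun w => w * w)%C P2); [apply cder_sqr|now apply cder_P2].
    - replace kap with (kap * 1)%C at 2 by ring. apply cder_scal, cder_id. }
  assert (D3 : cder (fun w => P2 (- / w)%C) z (2 * z * P2 z + z * z * (twopii * TP z) + kap)%C).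
  { apply cder_ext_loc with (2 := D2). destruct (in_H_open z H) as [d [Pd K]].
    exists d; split; auto. intros h Hh. symmetry. apply P2_S. auto. }
  assert (E := cder_unique _ _ _ _ D1 D3).
  replace (TP (- / z)%C) with ((twopii * TP (- / z) * / (z * z)) * (z * z) / twopii)%C by (field; auto).
  rewrite E. field. auto.
Qed.

(** The unwanted terms of P^2 are 2 kap z^3 P + kap^2 z^2, those of 12 theta P are (12/(2 pi i)) (2
    z^3 P + kap z^2); they cancel because kap = 12/(2 pi i). *)
Lemma E4_S z : in_H z -> E4 (- / z)%C = (z ^ 4 * E4 z)%C.
Proof.
  intros H. assert (Nz := in_H_nz z H). unfold E4. rewrite P2_S, TP_S by auto. fold kap.
  assert (Ek : kap = (12 / twopii)%C).
  { unfold kap, twopii. rewrite RtoC_mult. field. auto using PIC_nz, Ci_nz. }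
  rewrite Ek. simpl. field. apply twopii_nz.
Qed.

Lemma P2_T z n : P2 (z + IZR n)%C = P2 z.
Proof. unfold P2. now rewrite qs_periodic. Qed.

Lemma E4_T z n : E4 (z + IZR n)%C = E4 z.
Proof. unfold E4, TP. now rewrite P2_T, qs_periodic. Qed.

(* [phi] is a primitive of [P2], so that exp(2 pi i phi) is the discriminant form. *)
Definition phic (n : nat) : C := (sigc n * / INR n)%C.
Definition phi (z : C) : C := (z + 12 * Ci / PI * qs phic z)%C.

Lemma goodc_phic : goodc phic.
Proof.
  apply goodc_le with sigc; [|apply goodc_sigc]. intros [|n]; unfold phic.
  - unfold sigc, sigma1; simpl. rewrite Cmult_0_l. lra.
  - assert (Q := INR_S_ge1 n). rewrite Cmod_mult, Cmod_inv by (apply RtoC_neq0; lra).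
    rewrite (Cmod_R (INR (S n))), Rabs_pos_eq by lra.
    assert (P := Cmod_ge_0 (sigc (S n))). assert (/ INR (S n) <= 1).
    { rewrite <- Rinv_1. apply Rinv_le_contravar; lra. }
    nra.
Qed.

Lemma cder_phi z : in_H z -> cder phi z (P2 z).
Proof.
  intros H. unfold phi.
  replace (P2 z) with (1 + 12 * Ci / PI * (twopii * qs (fun n => INR n * phic n)%C z))%C.
  - apply cder_plus; [apply cder_id|]. apply cder_scal, cder_qs; auto using goodc_phic.
  - unfold P2. replace (qs (fun n => INR n * phic n)%C z) with (qs sigc z).
    + unfold twopii. rewrite RtoC_mult.
      replace (12 * Ci / PI * (2 * PI * Ci * qs sigc z))%C with ((Ci * Ci) * 24 * qs sigc z)%C by (field; apply PIC_nz).
      rewrite Ci2. ring.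
    + unfold qs, pser. apply CS_ext. intros [|n]; unfold phic.
      * unfold sigc, sigma1; simpl. ring.
      * assert (Q := INR_S_ge1 n). assert (N : RtoC (INR (S n)) <> RtoC 0) by (apply RtoC_neq0; lra).
        f_equal. field. auto.
Qed.

(* |eta(z)|^2 *)
Definition D2 (z : C) : R := Cmod (qexp (phi z / 12)).

Lemma D2_pos z : 0 < D2 z.
Proof. apply Cmod_gt_0, qexp_nz. Qed.

Lemma D2_T z n : D2 (z + IZR n)%C = D2 z.
Proof.
  unfold D2, phi. rewrite qs_periodic, !Cmod_qexp. f_equal. f_equal. f_equal.
  set (w := (12 * Ci / PI * qs phic z)%C).
  replace ((z + IZR n + w) / 12)%C with ((z + w) / 12 + RtoC (IZR n / 12))%C.
  - unfold Im, Cplus, RtoC; simpl. ring.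
  - rewrite RtoC_div by lra. field.
Qed.

(** By [P2_S] the function [R] has derivative 0, hence is constant; at i, the fixed point of -1/z,
    its modulus is 1. *)
Lemma D2_S z : in_H z -> D2 (- / z)%C = Cmod z * D2 z.
Proof.
  intros H. assert (Nz := in_H_nz z H).
  set (R := fun w => (qexp ((phi (- / w) - phi w) * / 12) * / w)%C).
  assert (DR : forall w, in_H w -> cder R w (RtoC 0)).
  { intros w Hw. assert (Nw := in_H_nz w Hw). assert (HS := in_H_Sneg w Hw).
    assert (D1 := cder_comp phi (fun w => - / w)%C w _ _ (cder_neginv w Nw) (cder_phi _ HS)).
    assert (Dm := cder_minus _ _ _ _ _ D1 (cder_phi w Hw)).
    apply (cder_scal (/ 12)%C) in Dm.
    assert (Dq := cder_comp qexp _ w _ _ Dm (cder_qexp _)).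
    assert (Dr := cder_mult _ _ _ _ _ Dq (cder_inv w Nw)). cbv beta in Dr.
    eapply cder_ext; [|match type of Dr with cder _ _ ?v => replace (RtoC 0) with v; [exact Dr|] end].
    - intros x. cbv beta. unfold R. f_equal. f_equal. ring.
    - rewrite (P2_S w Hw). fold kap.
      set (e := qexp _).
      assert (Ek : kap = (12 / twopii)%C).
      { unfold kap, twopii. rewrite RtoC_mult. field. auto using PIC_nz, Ci_nz. }
      rewrite Ek. field. split; auto using twopii_nz. }
  assert (HC : in_H Ci) by (unfold in_H, Ci, Im; simpl; lra).
  assert (E := cder_zero_const R DR z Ci H HC).
  assert (EC : (- / Ci = Ci)%C).
  { replace (/ Ci)%C with (- Ci)%C. ring. replace (/ Ci)%C with ((- (1)) * (- (1)) * / Ci)%C by ring.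
    rewrite <- Ci2 at 1. field. apply Ci_nz. }
  unfold R in E. rewrite EC in E. replace ((phi Ci - phi Ci) * / 12)%C with (RtoC 0) in E by ring.
  rewrite qexp_0, Cmult_1_l in E. apply (f_equal Cmod) in E.
  rewrite Cmod_mult, !Cmod_inv in E by auto using Ci_nz. rewrite Cmod_Ci, Rinv_1 in E.
  unfold D2. replace (phi (- / z) / 12)%C with ((phi (- / z) - phi z) * / 12 + phi z / 12)%C by (unfold Cdiv; ring).
  rewrite qexp_plus, Cmod_mult. f_equal.
  assert (P := proj1 (Cmod_gt_0 _) Nz).
  rewrite <- (Rmult_1_r (Cmod z)), <- E. field. lra.
Qed.

(** Euclid's algorithm on the lower row: a translation replaces d by d mod c, and S moves this
    remainder into the place of c. The sign -1 comes from S^2. *)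
Lemma SL2_ind (Q : Z -> Z -> Z -> Z -> Prop) :
  Q 1%Z 0%Z 0%Z 1%Z ->
  (forall a b c d n, in_SL2Z a b c d -> Q a b c d -> Q a (b + a * n)%Z c (d + c * n)%Z) ->
  (forall a b c d, in_SL2Z a b c d -> Q a b c d -> Q b (- a)%Z d (- c)%Z) ->
  forall a b c d, in_SL2Z a b c d -> Q a b c d.
Proof.
  intros Q1 QT QS.
  assert (QT' : forall n, Q 1%Z n 0%Z 1%Z).
  { intros n. assert (H := QT 1%Z 0%Z 0%Z 1%Z n eq_refl Q1).
    replace (0 + 1 * n)%Z with n in H by ring. now replace (1 + 0 * n)%Z with 1%Z in H by ring. }
  assert (Qm : forall n, Q (-1)%Z n 0%Z (-1)%Z).
  { intros n. assert (H := QS 1%Z 0%Z 0%Z 1%Z eq_refl Q1). apply QS in H; [|reflexivity].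
    apply (QT _ _ _ _ (- n)%Z) in H; [|reflexivity].
    replace (- (0) + - (1) * - n)%Z with n in H by ring.
    now replace (- (1) + - (0) * - n)%Z with (-1)%Z in H by ring. }
  assert (F : forall k a b c d, (Z.abs_nat c <= k)%nat -> in_SL2Z a b c d -> Q a b c d).
  { induction k as [|k IH]; intros a b c d Hc H; unfold in_SL2Z in *.
    - assert (c = 0%Z) by lia. subst c. rewrite Z.mul_0_r, Z.sub_0_r in H.
      assert (Ha : (a = 1 /\ d = 1 \/ a = -1 /\ d = -1)%Z).
      { destruct (Z.eq_mul_1 a d H) as [-> | ->]; lia. }
      destruct Ha as [[-> ->]|[-> ->]]; auto.
    - destruct (Z.eq_dec c 0) as [->|Nc]; [apply (IH a b 0%Z d); [lia|exact H]|].
      assert (E := Z.div_mod d c Nc). set (n := (d / c)%Z) in *. set (d' := (d mod c)%Z) in *.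
      assert (Hd : (Z.abs d' < Z.abs c)%Z).
      { unfold d'. destruct (Z_lt_le_dec 0 c).
        - generalize (Z.mod_pos_bound d c ltac:(lia)); lia.
        - generalize (Z.mod_neg_bound d c ltac:(lia)); lia. }
      assert (H1 : Q (- (b - a * n))%Z a (- d')%Z c).
      { apply IH; [lia|]. unfold in_SL2Z. nia. }
      apply QS in H1; [|unfold in_SL2Z; nia].
      apply (QT _ _ _ _ n) in H1; [|unfold in_SL2Z; nia].
      replace (- - (b - a * n) + a * n)%Z with b in H1 by ring.
      replace (- - d' + c * n)%Z with d in H1 by lia. exact H1. }
  intros a b c d. apply (F (Z.abs_nat c)). lia.
Qed.

Definition jf (c d : Z) (z : C) : C := (IZR c * z + IZR d)%C.

Lemma jf_nz a b c d z : in_SL2Z a b c d -> in_H z -> jf c d z <> RtoC 0.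
Proof.
  intros S H E. unfold in_SL2Z in S. unfold in_H in H.
  assert (E1 := f_equal Im E). assert (E2 := f_equal Re E).
  unfold jf in *. destruct z as [x y]. unfold Im, Re, RtoC, Cplus, Cmult in *; simpl in *.
  assert (IZR c = 0) by nra. apply eq_IZR in H0. subst c.
  assert (IZR d = 0) by lra. apply eq_IZR in H0. subst d. lia.
Qed.

Lemma moeb_eq a b c d z : moeb a b c d z = ((IZR a * z + IZR b) / jf c d z)%C.
Proof. reflexivity. Qed.

Lemma moeb_T a b c d n z : moeb a (b + a * n) c (d + c * n) z = moeb a b c d (z + IZR n)%C.
Proof.
  unfold moeb. rewrite !plus_IZR, !mult_IZR, !RtoC_plus, !RtoC_mult. f_equal; ring.
Qed.

Lemma jf_T c d n z : jf c (d + c * n) z = jf c d (z + IZR n)%C.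
Proof. unfold jf. rewrite plus_IZR, mult_IZR, RtoC_plus, RtoC_mult. ring. Qed.

Lemma jf_S c d z : z <> RtoC 0 -> jf d (- c) z = (z * jf c d (- / z))%C.
Proof. intros N. unfold jf. rewrite opp_IZR, RtoC_opp. field; auto. Qed.

Lemma moeb_S a b c d z : in_SL2Z a b c d -> in_H z -> moeb b (- a) d (- c) z = moeb a b c d (- / z)%C.
Proof.
  intros S H. assert (N := in_H_nz z H). rewrite !moeb_eq, jf_S by auto.
  assert (N2 := jf_nz _ _ _ _ _ S (in_H_Sneg z H)).
  set (j := jf c d _) in *. rewrite opp_IZR, RtoC_opp. field; auto.
Qed.

Lemma moeb_1 z : moeb 1 0 0 1 z = z.
Proof. unfold moeb. field. Qed.

Lemma in_H_T z n : in_H z -> in_H (z + IZR n)%C.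
Proof. unfold in_H. destruct z; unfold Im; simpl. lra. Qed.

Lemma weight_SL2 (f : C -> C) k :
  (forall z n, in_H z -> f (z + IZR n)%C = f z) ->
  (forall z, in_H z -> f (- / z)%C = (z ^ k * f z)%C) ->
  forall a b c d, in_SL2Z a b c d -> forall z, in_H z -> f (moeb a b c d z) = (jf c d z ^ k * f z)%C.
Proof.
  intros HT HS. apply (SL2_ind (fun a b c d => forall z, in_H z -> f (moeb a b c d z) = (jf c d z ^ k * f z)%C)).
  - intros z Hz. rewrite moeb_1. unfold jf. replace (0 * z + 1)%C with (RtoC 1) by ring. rewrite Cpow_1_l. ring.
  - intros a b c d n S IH z Hz. rewrite moeb_T, jf_T, IH by now apply in_H_T. now rewrite HT.
  - intros a b c d S IH z Hz. rewrite moeb_S, jf_S, IH by auto using in_H_Sneg, in_H_nz.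
    rewrite HS, Cpow_mult_l by auto. ring.
Qed.

Lemma E4_SL2 a b c d z : in_SL2Z a b c d -> in_H z -> E4 (moeb a b c d z) = (jf c d z ^ 4 * E4 z)%C.
Proof. intros S H. apply weight_SL2; auto using E4_T, E4_S. Qed.

Lemma D2_SL2 a b c d z : in_SL2Z a b c d -> in_H z -> D2 (moeb a b c d z) = Cmod (jf c d z) * D2 z.
Proof.
  intros S. revert z. revert a b c d S.
  apply (SL2_ind (fun a b c d => forall z, in_H z -> D2 (moeb a b c d z) = Cmod (jf c d z) * D2 z)).
  - intros z Hz. rewrite moeb_1. unfold jf. replace (0 * z + 1)%C with (RtoC 1) by ring. rewrite Cmod_1. ring.
  - intros a b c d n S IH z Hz. rewrite moeb_T, jf_T, IH by now apply in_H_T. now rewrite D2_T.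
  - intros a b c d S IH z Hz. rewrite moeb_S, jf_S, IH by auto using in_H_Sneg, in_H_nz.
    rewrite D2_S, Cmod_mult by auto. ring.
Qed.

Lemma P2_SL2 a b c d z : in_SL2Z a b c d -> in_H z ->
  P2 (moeb a b c d z) = (jf c d z * jf c d z * P2 z + kap * IZR c * jf c d z)%C.
Proof.
  intros S. revert z. revert a b c d S.
  apply (SL2_ind (fun a b c d => forall z, in_H z ->
    P2 (moeb a b c d z) = (jf c d z * jf c d z * P2 z + kap * IZR c * jf c d z)%C)).
  - intros z Hz. rewrite moeb_1. unfold jf. ring.
  - intros a b c d n S IH z Hz. rewrite moeb_T, jf_T, IH by now apply in_H_T. now rewrite P2_T.
  - intros a b c d S IH z Hz. assert (N := in_H_nz z Hz).
    rewrite moeb_S, jf_S, IH by auto using in_H_Sneg.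
    rewrite P2_S by auto. fold kap.
    assert (E : (jf c d (- / z) = IZR d - IZR c * / z)%C) by (unfold jf; ring).
    rewrite E. field. auto.
Qed.

(** * Forms of weight 4 for Gamma_0(5) *)

Lemma jfac_jf c d k z : jfac c d k z = (jf c d z ^ k)%C.
Proof. reflexivity. Qed.

Lemma ex_derive_cder (f : C -> C) z : @ex_derive C_AbsRing C_NormedModule f z <-> exists l, cder f z l.
Proof.
  split; intros [l H]; exists l; now apply cder_is_derive.
Qed.

Lemma mf_const c : modular_form_G05 0 (fun _ => c).
Proof.
  split; [|split].
  - intros z _. apply ex_derive_cder. exists (RtoC 0). apply cder_const.
  - intros. rewrite jfac_jf. simpl. ring.
  - intros. exists (Cmod c), 0. intros. rewrite jfac_jf. simpl. rewrite Cmod_1. lra.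
Qed.

Lemma mf_plus k f g : modular_form_G05 k f -> modular_form_G05 k g -> modular_form_G05 k (fun z => f z + g z)%C.
Proof.
  intros [D1 [T1 B1]] [D2 [T2 B2]]. split; [|split].
  - intros z Hz. specialize (D1 z Hz). specialize (D2 z Hz). apply ex_derive_cder in D1, D2. apply ex_derive_cder.
    destruct D1 as [l1 H1], D2 as [l2 H2]. exists (l1 + l2)%C. now apply cder_plus.
  - intros. rewrite T1, T2 by auto. ring.
  - intros a b c d S. destruct (B1 a b c d S) as [M1 [C1 K1]]. destruct (B2 a b c d S) as [M2 [C2 K2]].
    exists (M1 + M2), (Rmax C1 C2). intros z Hz.
    specialize (K1 z (Rle_lt_trans _ _ _ (Rmax_l _ _) Hz)). specialize (K2 z (Rle_lt_trans _ _ _ (Rmax_r _ _) Hz)).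
    eapply Rle_trans; [apply Cmod_triangle|]. lra.
Qed.

Lemma mf_mult k l f g : modular_form_G05 k f -> modular_form_G05 l g -> modular_form_G05 (k + l) (fun z => f z * g z)%C.
Proof.
  intros [D1 [T1 B1]] [D2 [T2 B2]]. split; [|split].
  - intros z Hz. specialize (D1 z Hz). specialize (D2 z Hz). apply ex_derive_cder in D1, D2. apply ex_derive_cder.
    destruct D1 as [l1 H1], D2 as [l2 H2]. exists (l1 * g z + f z * l2)%C. now apply cder_mult.
  - intros. rewrite T1, T2 by auto. rewrite !jfac_jf, Cpow_add_r. ring.
  - intros a b c d S. destruct (B1 a b c d S) as [M1 [C1 K1]]. destruct (B2 a b c d S) as [M2 [C2 K2]].
    exists (M1 * M2), (Rmax C1 C2). intros z Hz.
    specialize (K1 z (Rle_lt_trans _ _ _ (Rmax_l _ _) Hz)). specialize (K2 z (Rle_lt_trans _ _ _ (Rmax_r _ _) Hz)).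
    rewrite Cmod_mult, !jfac_jf, Cpow_add_r, Cmod_mult. rewrite !jfac_jf in K1, K2.
    replace (M1 * M2 * (Cmod (jf c d z ^ k) * Cmod (jf c d z ^ l)))
      with ((M1 * Cmod (jf c d z ^ k)) * (M2 * Cmod (jf c d z ^ l))) by ring.
    apply Rmult_le_compat; auto using Cmod_ge_0.
Qed.

Lemma mf_scal k s f : modular_form_G05 k f -> modular_form_G05 k (fun z => s * f z)%C.
Proof. intros H. apply (mf_mult 0 k (fun _ => s) f); auto. apply mf_const. Qed.

Lemma mf_ext k f g : (forall z, f z = g z) -> modular_form_G05 k f -> modular_form_G05 k g.
Proof.
  intros E [D [T B]]. split; [|split].
  - intros z Hz. specialize (D z Hz). apply ex_derive_cder in D. apply ex_derive_cder.
    destruct D as [l H]. exists l. now apply cder_ext with f.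
  - intros. rewrite <- !E. auto.
  - intros a b c d S. destruct (B a b c d S) as [M [C K]]. exists M, C. intros. rewrite <- E. auto.
Qed.

Lemma mf_minus k f g : modular_form_G05 k f -> modular_form_G05 k g -> modular_form_G05 k (fun z => f z - g z)%C.
Proof.
  intros H1 H2. apply mf_ext with (fun z => f z + (-(1)) * g z)%C; [intros; ring|].
  apply mf_plus; auto. now apply mf_scal.
Qed.

(** Conjugation by diag(5,1) carries Gamma_0(5) into SL2(Z), with the same factor of automorphy. *)
Lemma five_moeb_div a b c d z : in_SL2Z a b (5 * c) d -> in_H z ->
  in_SL2Z a (5 * b) c d /\ (5 * moeb a b (5 * c) d z)%C = moeb a (5 * b) c d (5 * z)%C /\ jf c d (5 * z) = jf (5 * c) d z.
Proof.
  intros S H. assert (N := jf_nz _ _ _ _ z S H). unfold in_SL2Z in *. split; [lia|].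
  assert (E : jf c d (5 * z) = jf (5 * c) d z). { unfold jf. rewrite mult_IZR, RtoC_mult. ring. }
  split; auto. rewrite !moeb_eq, E, mult_IZR, RtoC_mult. field. auto.
Qed.

(** At the cusp 0, diag(5,1) times the matrix equals an element of SL2(Z) times the upper triangular
    matrix with rows (1, B) and (0, 5). *)
Lemma five_moeb_ndiv a b c d B e z : (d - c * B = 5 * e)%Z -> in_SL2Z a b c d -> in_H z ->
  in_SL2Z (5 * a) (b - a * B) c e /\
  (5 * moeb a b c d z)%C = moeb (5 * a) (b - a * B) c e ((z + IZR B) / 5)%C /\
  jf c e ((z + IZR B) / 5)%C = (jf c d z / 5)%C.
Proof.
  intros Hd S H. assert (N := jf_nz _ _ _ _ z S H). unfold in_SL2Z in *. split; [nia|].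
  assert (E : jf c e ((z + IZR B) / 5)%C = (jf c d z / 5)%C).
  { unfold jf. replace d with (5 * e + c * B)%Z by lia. rewrite plus_IZR, !mult_IZR, RtoC_plus, !RtoC_mult. field. }
  split; auto. rewrite !moeb_eq, E, minus_IZR, !mult_IZR, RtoC_minus, !RtoC_mult. field. auto.
Qed.

(** By Fermat c^4 = 1 mod 5 when 5 does not divide c, so B = c^3 d works. The two cases are the two
    cusps. *)
Lemma mod5_cases c d : (exists c', c = 5 * c')%Z \/ (exists B e, d - c * B = 5 * e)%Z.
Proof.
  destruct (Z.eq_dec (c mod 5) 0) as [E|N].
  - left. exists (c / 5)%Z. generalize (Z.div_mod c 5 ltac:(lia)). lia.
  - right. assert (F : exists u, (1 - c * (c * c * c) = 5 * u)%Z).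
    { assert (R := Z.mod_pos_bound c 5 ltac:(lia)). assert (D := Z.div_mod c 5 ltac:(lia)).
      set (q := (c / 5)%Z) in *. set (s := (c mod 5)%Z) in *.
      assert (K : (s = 1 \/ s = 2 \/ s = 3 \/ s = 4)%Z) by lia. rewrite D.
      destruct K as [-> | [-> | [-> | ->]]].
      - exists (- (125 * q*q*q*q + 100 * q*q*q + 30 * q*q + 4 * q))%Z. ring.
      - exists (- (125 * q*q*q*q + 200 * q*q*q + 120 * q*q + 32 * q + 3))%Z. ring.
      - exists (- (125 * q*q*q*q + 300 * q*q*q + 270 * q*q + 108 * q + 16))%Z. ring.
      - exists (- (125 * q*q*q*q + 400 * q*q*q + 480 * q*q + 256 * q + 51))%Z. ring. }
    destruct F as [u Hu]. exists (c * c * c * d)%Z, (u * d)%Z. nia.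
Qed.

Lemma in_H_five z : in_H z -> in_H (5 * z)%C.
Proof. apply (in_H_mult_pos 5). lra. Qed.

Lemma Im_five z : Im (5 * z)%C = 5 * Im z.
Proof. apply im_scal_l. Qed.

Lemma Im_fifth z B : Im ((z + IZR B) / 5)%C = Im z / 5.
Proof.
  unfold Cdiv. rewrite <- RtoC_inv by lra. rewrite im_scal_r. unfold Rdiv. f_equal. 
  destruct z; unfold Im; simpl. ring.
Qed.

Lemma cder_E4 z : in_H z -> exists l, cder E4 z l.
Proof.
  intros H. unfold E4, TP. eexists. apply cder_minus.
  - apply cder_mult; now apply cder_P2.
  - apply cder_scal, cder_scal, cder_qs; auto. apply goodc_INR, goodc_sigc.
Qed.

Lemma cder_five f z l : cder f (5 * z)%C l -> cder (fun z => f (5 * z)%C) z (l * 5)%C.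
Proof.
  intros H. apply (cder_comp f (fun z => 5 * z)%C); auto.
  assert (X := cder_scal 5 _ _ _ (cder_id z)). now rewrite Cmult_1_r in X.
Qed.

Lemma P2_bounded y0 : 0 < y0 -> exists B, forall z, y0 <= Im z -> Cmod (P2 z) <= B.
Proof.
  intros H. destruct (qs_bounded sigc y0 goodc_sigc H) as [B HB]. exists (1 + 24 * B). intros z Hz.
  unfold P2, Cminus. eapply Rle_trans; [apply Cmod_triangle|]. rewrite Cmod_opp, Cmod_mult, Cmod_1, Cmod_R, Rabs_pos_eq by lra.
  specialize (HB z Hz). lra.
Qed.

Lemma E4_bounded y0 : 0 < y0 -> exists B, forall z, y0 <= Im z -> Cmod (E4 z) <= B.
Proof.
  intros H. destruct (P2_bounded y0 H) as [B HB].
  destruct (qs_bounded _ y0 (goodc_INR _ goodc_sigc) H) as [B' HB'].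
  exists (B * B + 12 * (24 * B')). intros z Hz. specialize (HB z Hz). specialize (HB' z Hz).
  unfold E4, TP, Cminus. eapply Rle_trans; [apply Cmod_triangle|].
  rewrite Cmod_opp, !Cmod_mult, (Cmod_R 12), (Rabs_pos_eq 12) by lra.
  replace (Cmod (-24)) with 24 by (rewrite Cmod_R, Rabs_left; lra).
  assert (Cmod (P2 z) * Cmod (P2 z) <= B * B) by (apply Rmult_le_compat; auto using Cmod_ge_0). lra.
Qed.

Lemma mf_E4 : modular_form_G05 4 E4.
Proof.
  split; [|split].
  - intros z Hz. apply ex_derive_cder. now apply cder_E4.
  - intros a b c d z [S _] Hz. rewrite jfac_jf. now apply E4_SL2.
  - intros a b c d S. destruct (E4_bounded 1 Rlt_0_1) as [B HB]. exists B, 1. intros z Hz.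
    assert (HH : in_H z) by (unfold in_H; lra).
    rewrite E4_SL2, jfac_jf, Cmod_mult by auto. rewrite Rmult_comm. apply Rmult_le_compat_r; [apply Cmod_ge_0|].
    apply HB; lra.
Qed.

Lemma mf_E4_five : modular_form_G05 4 (fun z => E4 (5 * z)%C).
Proof.
  split; [|split].
  - intros z Hz. apply ex_derive_cder. destruct (cder_E4 _ (in_H_five z Hz)) as [l H].
    exists (l * 5)%C. now apply cder_five.
  - intros a b c d z [S [c' Hc]] Hz. rewrite jfac_jf. replace c with (5 * c')%Z in * by lia.
    destruct (five_moeb_div a b c' d z S Hz) as [S' [E1 E2]].
    rewrite E1, E4_SL2, E2 by auto using in_H_five. reflexivity.
  - intros a b c d S. destruct (E4_bounded (1/5) ltac:(lra)) as [B HB]. exists B, 1. intros z Hz.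
    assert (HH : in_H z) by (unfold in_H; lra). rewrite jfac_jf.
    destruct (mod5_cases c d) as [[c' ->]|[Bz [e He]]].
    + destruct (five_moeb_div a b c' d z S HH) as [S' [E1 E2]].
      rewrite E1, E4_SL2, E2, Cmod_mult by auto using in_H_five.
      rewrite Rmult_comm. apply Rmult_le_compat_r; [apply Cmod_ge_0|]. apply HB. rewrite Im_five; lra.
    + destruct (five_moeb_ndiv a b c d Bz e z He S HH) as [S' [E1 E2]].
      assert (HF : in_H ((z + IZR Bz) / 5)%C) by (unfold in_H; rewrite Im_fifth; lra).
      rewrite E1, E4_SL2, E2, Cmod_mult by auto.
      assert (Q : Cmod (E4 ((z + IZR Bz) / 5)%C) <= B) by (apply HB; rewrite Im_fifth; lra).
      rewrite !Cmod_pow, Cmod_div by (apply RtoC_neq0; lra). rewrite Cmod_R, Rabs_pos_eq by lra.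
      assert (P := Cmod_ge_0 (jf c d z)). set (j := Cmod (jf c d z)) in *.
      assert (PB : 0 <= B) by (eapply Rle_trans; [apply Cmod_ge_0|exact Q]).
      rewrite Rmult_comm. apply Rmult_le_compat; auto using Cmod_ge_0.
      * apply pow_le. lra.
      * apply pow_incr. lra.
Qed.

Definition E2 (z : C) : C := (/ 4 * (5 * P2 (5 * z) - P2 z))%C.

(** The terms kap c (cz+d) from [P2_SL2] cancel between 5 P(5z) and P(z), at both cusps. *)
Lemma mf_E2 : modular_form_G05 2 E2.
Proof.
  split; [|split].
  - intros z Hz. apply ex_derive_cder. eexists. unfold E2. apply cder_scal, cder_minus; [|now apply cder_P2].
    apply cder_scal, cder_five, cder_P2. now apply in_H_five.
  - intros a b c d z [S [c' Hc]] Hz. rewrite jfac_jf. replace c with (5 * c')%Z in * by lia.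
    destruct (five_moeb_div a b c' d z S Hz) as [S' [E1 Ej]]. unfold E2.
    rewrite E1, !P2_SL2, Ej, mult_IZR, RtoC_mult by auto using in_H_five. simpl. ring.
  - intros a b c d S. destruct (P2_bounded (1/5) ltac:(lra)) as [B HB]. exists (2 * B), 1. intros z Hz.
    assert (HH : in_H z) by (unfold in_H; lra). rewrite jfac_jf. unfold E2.
    assert (Q1 : Cmod (P2 z) <= B) by (apply HB; lra).
    assert (P := Cmod_ge_0 (jf c d z ^ 2)%C).
    (* s is 5 at the cusp infinity and 5/25 = 1/5 at the cusp 0, where the factor of automorphy is
       divided by 5. *)
    assert (F : forall X Y : C, Cmod X <= B -> Cmod Y <= B -> forall s, 0 <= s <= 5 ->
       Cmod (/ 4 * (jf c d z ^ 2 * (s * X - Y)))%C <= 2 * B * Cmod (jf c d z ^ 2)).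
    { intros X Y HX HY s Hs. rewrite Cmod_mult, Cmod_inv by (apply RtoC_neq0; lra).
      rewrite Cmod_R, (Rabs_pos_eq 4), Cmod_mult by lra.
      assert (T : Cmod (s * X - Y)%C <= 8 * B).
      { unfold Cminus. eapply Rle_trans; [apply Cmod_triangle|]. rewrite Cmod_opp, Cmod_mult, Cmod_R, Rabs_pos_eq by lra.
        assert (0 <= Cmod X) by apply Cmod_ge_0. nra. }
      set (J := Cmod (jf c d z ^ 2)) in *. nra. }
    destruct (mod5_cases c d) as [[c' ->]|[Bz [e He]]].
    + destruct (five_moeb_div a b c' d z S HH) as [S' [E1 Ej]].
      rewrite E1, !P2_SL2, Ej, mult_IZR, RtoC_mult by auto using in_H_five.
      replace (/ 4 * _)%C with (/ 4 * (jf (5 * c') d z ^ 2 * (5 * P2 (5 * z) - P2 z)))%C by (simpl; ring).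
      apply F; auto; [|lra]. apply HB. rewrite Im_five; lra.
    + destruct (five_moeb_ndiv a b c d Bz e z He S HH) as [S' [E1 Ej]].
      assert (HF : in_H ((z + IZR Bz) / 5)%C) by (unfold in_H; rewrite Im_fifth; lra).
      rewrite E1, !P2_SL2, Ej by auto.
      replace (/ 4 * _)%C with (/ 4 * (jf c d z ^ 2 * (RtoC (/ 5) * P2 ((z + IZR Bz) / 5) - P2 z)))%C
        by (rewrite RtoC_inv by lra; simpl; field).
      apply F; auto; [|lra]. apply HB. rewrite Im_fifth; lra.
Qed.

(* In terms of sigma_3, F1 = 5 sum sigma_3(n) (q^n - q^(5n)); dividing by 48 rather than 240 keeps
   the expansion visibly integral, and the leading coefficient 5 is still odd.
   Likewise F2 = 5 eta(5z)^10 / eta(z)^2. *)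
Definition F1 (z : C) : C := (/ 48 * (E4 z - E4 (5 * z)))%C.
Definition F2 (z : C) : C := (/ 36 * (12 * F1 z - 5 * (E2 z * E2 z) + 5 * E4 (5 * z)))%C.

Lemma mf_F1 : modular_form_G05 4 F1.
Proof. apply mf_scal, mf_minus; [apply mf_E4|apply mf_E4_five]. Qed.

Lemma mf_F2 : modular_form_G05 4 F2.
Proof.
  apply mf_scal, mf_plus; [apply mf_minus|].
  - apply mf_scal, mf_F1.
  - apply mf_scal. apply (mf_mult 2 2); apply mf_E2.
  - apply mf_scal, mf_E4_five.
Qed.

(** * Integral q-expansions and their products *)

Fixpoint zsum (u : nat -> Z) (n : nat) : Z :=
  match n with O => 0%Z | S p => (zsum u p + u p)%Z end.

Definition zconv (a b : nat -> Z) (n : nat) : Z := zsum (fun j => (a j * b (n - j)%nat)%Z) (S n).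

Definition zc (a : nat -> Z) (n : nat) : C := RtoC (IZR (a n)).

Lemma qexp_surj rho : 0 < rho < 1 -> exists z, in_H z /\ qexp z = RtoC rho.
Proof.
  intros H. exists (0, - ln rho / (2 * PI)). assert (P := PI_RGT_0).
  assert (L : ln rho < 0) by (rewrite <- ln_1; apply ln_increasing; lra).
  split.
  - unfold in_H, Im; simpl. apply Rdiv_lt_0_compat; lra.
  - unfold qexp, Re, Im; simpl. rewrite Rmult_0_r, cos_0, sin_0.
    replace (- (2 * PI * (- ln rho / (2 * PI)))) with (ln rho) by (field; lra).
    rewrite exp_ln by lra. unfold RtoC. f_equal; ring.
Qed.

(** Abel's argument: convergence at q = m > rho bounds the terms there, so (rho/m)^n is a geometric
    majorant at rho. *)
Lemma qexpansion_goodc F a : has_qexpansion F a -> goodc (zc a).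
Proof.
  intros H rho Hr. set (m := (1 + rho) / 2). assert (Hm : 0 < m < 1) by (unfold m; lra).
  destruct (qexp_surj m Hm) as [z [Hz Ez]]. specialize (H z Hz). apply is_series_cser in H.
  apply cser_term, clim_bounded in H. destruct H as [B HB]. rewrite Ez in HB.
  assert (E : ex_series (fun n => B * (rho / m) ^ n)).
  { apply @ex_series_scal_l with (c := B). apply ex_series_geom. rewrite Rabs_pos_eq.
    - apply Rmult_lt_reg_r with m; [lra|]. unfold Rdiv. rewrite Rmult_assoc, Rinv_l; unfold m; lra.
    - apply Rmult_le_pos; [lra|]. apply Rlt_le, Rinv_0_lt_compat; lra. }
  apply @ex_series_le with (2 := E). intros n.
  change (Rabs (Cmod (zc a n) * rho ^ n) <= B * (rho / m) ^ n).
  assert (P1 : 0 <= rho ^ n) by (apply pow_le; lra). assert (P2 : 0 < m ^ n) by (apply pow_lt; lra).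
  rewrite Rabs_pos_eq by (apply Rmult_le_pos; auto using Cmod_ge_0).
  specialize (HB n). rewrite Cmod_mult, Cmod_pow, (Cmod_R m), Rabs_pos_eq in HB by lra. fold (zc a n) in HB.
  unfold Rdiv. rewrite Rpow_mult_distr, pow_inv.
  apply Rmult_le_reg_r with (m ^ n); auto.
  replace (B * (rho ^ n * / m ^ n) * m ^ n) with (B * rho ^ n) by (field; lra).
  replace (Cmod (zc a n) * rho ^ n * m ^ n) with (Cmod (zc a n) * m ^ n * rho ^ n) by ring.
  apply Rmult_le_compat_r; auto.
Qed.

Lemma qexpansion_qs F a z : has_qexpansion F a -> in_H z -> F z = qs (zc a) z.
Proof.
  intros H Hz. symmetry. apply cser_CS. apply is_series_cser. exact (H z Hz).
Qed.

Lemma qexpansion_intro F a : goodc (zc a) -> (forall z, in_H z -> F z = qs (zc a) z) -> has_qexpansion F a.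
Proof.
  intros G E z Hz. rewrite E by auto. apply is_series_cser. now apply qs_cser.
Qed.

Lemma qx_plus F G a b : has_qexpansion F a -> has_qexpansion G b ->
  has_qexpansion (fun z => F z + G z)%C (fun n => a n + b n)%Z.
Proof.
  intros H1 H2 z Hz. specialize (H1 z Hz). specialize (H2 z Hz). apply is_series_cser in H1, H2. apply is_series_cser.
  eapply cser_ext; [|apply cser_plus; [exact H1|exact H2]]. intros n. cbv beta. rewrite plus_IZR, RtoC_plus. ring.
Qed.

Lemma qx_scal F a k : has_qexpansion F a -> has_qexpansion (fun z => IZR k * F z)%C (fun n => k * a n)%Z.
Proof.
  intros H z Hz. specialize (H z Hz). apply is_series_cser in H. apply is_series_cser.
  eapply cser_ext; [|apply cser_scal; exact H]. intros n. cbv beta. rewrite mult_IZR, RtoC_mult. ring.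
Qed.

Lemma qx_ext F G a b : (forall z, in_H z -> F z = G z) -> (forall n, a n = b n) -> has_qexpansion F a -> has_qexpansion G b.
Proof.
  intros E1 E2 H z Hz. specialize (H z Hz). rewrite <- E1 by auto. apply is_series_cser in H. apply is_series_cser.
  eapply cser_ext; [|exact H]. intros n. cbv beta. now rewrite E2.
Qed.

Lemma csum_conv (u v : nat -> C) N :
  csum (fun n => csum (fun j => u j * v (n - j)%nat) (S n))%C N = csum (fun j => u j * csum v (N - j))%C N.
Proof.
  induction N as [|N IH]; [reflexivity|].
  rewrite csum_S, IH, (csum_S _ N), (csum_S _ N).
  rewrite (csum_ext (fun j => u j * csum v (S N - j))%C (fun j => u j * csum v (N - j) + u j * v (N - j)%nat)%C).
  - rewrite csum_plus. replace (S N - N)%nat with 1%nat by lia. rewrite Nat.sub_diag. simpl csum. ring.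
  - intros k Hk. replace (S N - k)%nat with (S (N - k)) by lia. rewrite csum_S. ring.
Qed.

(** The N-th partial sum is the sum of u_j times a partial sum of v. Partial sums of v are bounded,
    so a multiple of |u_j| dominates. *)
Lemma cauchy_product (u v : nat -> C) : asum u -> asum v ->
  cser (fun n => csum (fun j => u j * v (n - j)%nat) (S n))%C (CS u * CS v)%C.
Proof.
  intros Hu Hv. assert (Sv := asum_cser v Hv). destruct (clim_bounded _ _ Sv) as [B HB].
  unfold cser. apply clim_ext with (fun N => CS (fun j => if (j <? N)%nat then u j * csum v (N - j) else RtoC 0)%C).
  - intros N. rewrite csum_conv. rewrite (CS_finite _ N).
    + apply csum_ext. intros k Hk. apply Nat.ltb_lt in Hk. now rewrite Hk.
    + intros j Hj. apply Nat.ltb_ge in Hj. now rewrite Hj.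
  - replace (CS u * CS v)%C with (CS (fun j => u j * CS v)%C).
    + apply tannery with (fun j => B * Cmod (u j)).
      * apply @ex_series_scal_l with (c := B). exact Hu.
      * intros N j. assert (P := Cmod_ge_0 (u j)). assert (PB : 0 <= B) by (eapply Rle_trans; [apply Cmod_ge_0|apply (HB O)]).
        destruct (j <? N)%nat.
        -- rewrite Cmod_mult, Rmult_comm. apply Rmult_le_compat_r; auto.
        -- rewrite Cmod_0. nra.
      * intros j. apply clim_ext_ev with (fun N => u j * csum v (N - j))%C.
        -- exists (S j). intros N HN. replace (j <? N)%nat with true; auto. symmetry; apply Nat.ltb_lt; lia.
        -- apply clim_scal. intros e He. destruct (Sv e He) as [M HM]. exists (M + j)%nat. intros n Hn. apply HM. lia.
    + apply cser_CS. replace (CS u * CS v)%C with (CS v * CS u)%C by ring.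
      eapply cser_ext; [|apply cser_scal, asum_cser, Hu]. intros; cbv beta; ring.
Qed.

Lemma zsum_csum (u : nat -> Z) n : RtoC (IZR (zsum u n)) = csum (fun k => RtoC (IZR (u k))) n.
Proof. induction n; simpl; [reflexivity|]. now rewrite plus_IZR, RtoC_plus, IHn. Qed.

Lemma qx_mult F G a b : has_qexpansion F a -> has_qexpansion G b ->
  has_qexpansion (fun z => F z * G z)%C (zconv a b).
Proof.
  intros H1 H2 z Hz. assert (G1 := qexpansion_goodc _ _ H1). assert (G2 := qexpansion_goodc _ _ H2).
  rewrite (qexpansion_qs F a z), (qexpansion_qs G b z) by auto. apply is_series_cser.
  assert (L := Cmod_qexp_lt1 z Hz).
  eapply cser_ext; [|apply cauchy_product; apply goodc_asum; eauto].
  intros n. cbv beta. unfold zconv. rewrite zsum_csum, Cmult_comm, <- csum_scal. apply csum_ext.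
  intros k Hk. unfold zc. rewrite mult_IZR, RtoC_mult.
  assert (En : (qexp z ^ n = qexp z ^ k * qexp z ^ (n - k))%C).
  { rewrite <- Cpow_add_r. f_equal. lia. }
  rewrite En. ring.
Qed.

(** * The maximum modulus principle *)

Definition ispoly (p : C -> C) : Prop :=
  exists d a, forall w, p w = csum (fun n => a n * w ^ n)%C d.

Lemma ispoly_plus p q : ispoly p -> ispoly q -> ispoly (fun w => p w + q w)%C.
Proof.
  intros [d [a Ha]] [e [b Hb]].
  exists (d + e)%nat, (fun n => (if (n <? d)%nat then a n else RtoC 0) + (if (n <? e)%nat then b n else RtoC 0))%C.
  intros w. rewrite Ha, Hb.
  assert (T : forall (a : nat -> C) d k, csum (fun n => a n * w ^ n)%C d = csum (fun n => (if (n <? d)%nat then a n else RtoC 0) * w ^ n)%C (d + k)).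
  { clear. intros a d k. rewrite csum_app.
    match goal with |- _ = (_ + ?X)%C => replace X with (RtoC 0) end.
    - rewrite Cplus_0_r. apply csum_ext. intros j Hj. apply Nat.ltb_lt in Hj. now rewrite Hj.
    - symmetry. apply csum_0. intros j _. replace (d + j <? d)%nat with false. ring. symmetry; apply Nat.ltb_ge; lia. }
  rewrite (T a d e), (T b e d). replace (e + d)%nat with (d + e)%nat by lia. rewrite <- csum_plus.
  apply csum_ext. intros; ring.
Qed.

Lemma ispoly_scal c p : ispoly p -> ispoly (fun w => c * p w)%C.
Proof.
  intros [d [a Ha]]. exists d, (fun n => c * a n)%C. intros w. rewrite Ha, <- csum_scal. apply csum_ext. intros; ring.
Qed.

Lemma ispoly_shift p : ispoly p -> ispoly (fun w => w * p w)%C.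
Proof.
  intros [d [a Ha]]. exists (S d), (fun n => match n with O => RtoC 0 | S k => a k end). intros w.
  rewrite Ha, csum_Sl, <- csum_scal. rewrite Cmult_0_l, Cplus_0_l. apply csum_ext. intros; rewrite Cpow_S; ring.
Qed.

Lemma ispoly_ext p q : (forall w, p w = q w) -> ispoly p -> ispoly q.
Proof. intros E [d [a Ha]]. exists d, a. intros; now rewrite <- E. Qed.

Lemma ispoly_mult p q : ispoly p -> ispoly q -> ispoly (fun w => p w * q w)%C.
Proof.
  intros [d [a Ha]] Hq. apply ispoly_ext with (fun w => csum (fun n => a n * w ^ n)%C d * q w)%C.
  { intros; now rewrite Ha. }
  clear Ha p. assert (M : forall n, ispoly (fun w => w ^ n * q w)%C).
  { induction n.
    - apply ispoly_ext with q; auto. intros; simpl; ring.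
    - apply ispoly_shift in IHn. eapply ispoly_ext; [|exact IHn]. intros; rewrite Cpow_S; ring. }
  induction d.
  - exists O, (fun _ => RtoC 0). intros; simpl; ring.
  - apply ispoly_ext with (fun w => csum (fun n => a n * w ^ n) d * q w + a d * (w ^ d * q w))%C.
    + intros; rewrite csum_S; ring.
    + apply ispoly_plus; auto. now apply ispoly_scal.
Qed.

Lemma ispoly_const c : ispoly (fun _ => c).
Proof. exists 1%nat, (fun _ => c). intros; simpl; ring. Qed.

Lemma ispoly_pow p n : ispoly p -> ispoly (fun w => p w ^ n)%C.
Proof.
  intros H. induction n; [apply (ispoly_const (RtoC 1))|].
  apply ispoly_ext with (fun w => p w * p w ^ n)%C; [intros; now rewrite Cpow_S|]. now apply ispoly_mult.
Qed.

Lemma qexp_frac_neq1 t : 0 < Rabs t < 1 -> qexp (RtoC t) <> RtoC 1.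
Proof.
  intros Ht E. apply (f_equal Re) in E. unfold qexp, Re, Im, RtoC in E; simpl in E.
  rewrite Rmult_0_r, Ropp_0, exp_0, Rmult_1_l in E.
  replace (2 * PI * t) with (2 * (PI * t)) in E by ring. rewrite cos_2a_sin in E.
  assert (P := PI_RGT_0).
  assert (S : sin (PI * Rabs t) > 0) by (apply sin_gt_0; nra).
  assert (S2 : sin (PI * t) * sin (PI * t) = sin (PI * Rabs t) * sin (PI * Rabs t)).
  { destruct (Rle_dec 0 t); [rewrite Rabs_pos_eq by auto; reflexivity|].
    rewrite Rabs_left by lra. replace (PI * - t) with (- (PI * t)) by ring. rewrite sin_neg. ring. }
  nra.
Qed.

Lemma root_sum (t : R) K : (exists l, INR (S K) * t = IZR l) -> 0 < Rabs t < 1 ->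
  csum (fun j => qexp (RtoC (INR j * t))) (S K) = RtoC 0.
Proof.
  intros [l Hl] Ht. assert (N := qexp_frac_neq1 t Ht). set (x := qexp (RtoC t)) in *.
  rewrite (csum_ext _ (fun j => x ^ j)%C).
  2:{ intros k _. unfold x. now rewrite qexp_pow, <- RtoC_mult. }
  assert (G : forall n, (csum (fun j => x ^ j)%C n * (x - 1) = x ^ n - 1)%C).
  { induction n; [simpl; ring|]. rewrite csum_S, Cpow_S. replace ((csum (fun j => x ^ j) n + x ^ n) * (x - 1))%C
      with (csum (fun j => x ^ j) n * (x - 1) + x ^ n * (x - 1))%C by ring. rewrite IHn. ring. }
  specialize (G (S K)).
  assert (E : (x ^ S K)%C = RtoC 1). { unfold x. rewrite qexp_pow, <- RtoC_mult, Hl. apply qexp_IZR. }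
  rewrite E in G. replace (1 - 1)%C with (RtoC 0) in G by ring.
  assert (Nx : (x - 1)%C <> RtoC 0) by (intros Q; apply N; now apply Ceq_minus).
  set (X := csum _ _) in *. replace X with (X * (x - 1) * / (x - 1))%C by (field; auto). rewrite G. ring.
Qed.

(* Average p(rho zeta^j) zeta^(-jn) over the d-th roots of unity. *)
Lemma poly_coef_bound (a : nat -> C) d rho M n : (n < d)%nat -> 0 <= rho ->
  (forall t : R, Cmod (csum (fun n => a n * (rho * qexp (RtoC t)) ^ n)%C d) <= M) -> Cmod (a n) * rho ^ n <= M.
Proof.
  intros Hn Hr HM. destruct d as [|K]; [lia|].
  set (c := fun j => (qexp (RtoC (- (INR j * (INR n / INR (S K)))))
     * csum (fun m => a m * (rho * qexp (RtoC (INR j / INR (S K)))) ^ m) (S K))%C).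
  assert (Q := INR_S_ge1 K).
  assert (E : csum c (S K) = (INR (S K) * (a n * rho ^ n))%C).
  { unfold c.
    rewrite (csum_ext _ (fun j => csum (fun m => a m * rho ^ m * qexp (RtoC (INR j * ((INR m - INR n) / INR (S K)))))%C (S K))).
    - rewrite csum_double.
      rewrite (csum_ext _ (fun m => if (m =? n)%nat then (INR (S K) * (a n * rho ^ n))%C else RtoC 0)).
      + clear -Hn. assert (G : forall D X, csum (fun m => if (m =? n)%nat then X else RtoC 0) D = if (n <? D)%nat then X else RtoC 0).
        { intros D X. induction D; [reflexivity|]. rewrite csum_S, IHD.
          destruct (Nat.eqb_spec D n), (Nat.ltb_spec n D), (Nat.ltb_spec n (S D)); try lia; ring. }
        rewrite G. apply Nat.ltb_lt in Hn. now rewrite Hn.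
      + intros m Hm. rewrite csum_scal. destruct (Nat.eqb_spec m n) as [->|Ne].
        * rewrite (csum_ext _ (fun _ => RtoC 1)).
          -- assert (G : forall D, csum (fun _ => RtoC 1) D = RtoC (INR D)).
             { induction D; [reflexivity|]. rewrite csum_S, IHD, S_INR, RtoC_plus. reflexivity. }
             rewrite G. ring.
          -- intros j _. unfold Rminus. rewrite Rplus_opp_r. unfold Rdiv. rewrite Rmult_0_l, Rmult_0_r. apply qexp_0.
        * rewrite root_sum; [ring| |].
          -- exists (Z.of_nat m - Z.of_nat n)%Z. rewrite minus_IZR, <- !INR_IZR_INZ. field. lra.
          -- assert (A : 1 <= Rabs (INR m - INR n)).
             { rewrite !INR_IZR_INZ, <- minus_IZR. rewrite <- abs_IZR. apply IZR_le. lia. }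
             assert (B : Rabs (INR m - INR n) < INR (S K)).
             { rewrite !INR_IZR_INZ, <- minus_IZR. rewrite <- abs_IZR. apply IZR_lt. lia. }
             unfold Rdiv. rewrite Rabs_mult, Rabs_inv, (Rabs_pos_eq (INR (S K))) by lra.
             split; [apply Rmult_lt_0_compat; [lra|apply Rinv_0_lt_compat; lra]|].
             apply Rmult_lt_reg_r with (INR (S K)); [lra|]. rewrite Rmult_assoc, Rinv_l; lra.
    - intros j _. rewrite <- csum_scal. apply csum_ext. intros m _.
      rewrite Cpow_mult_l, qexp_pow.
      replace (RtoC (INR j * ((INR m - INR n) / INR (S K))))
        with (RtoC (- (INR j * (INR n / INR (S K)))) + RtoC (INR m) * RtoC (INR j / INR (S K)))%C.
      + rewrite qexp_plus. ring.
      + rewrite <- RtoC_mult, <- RtoC_plus. f_equal. field. lra. }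
  assert (B : Cmod (csum c (S K)) <= INR (S K) * M).
  { assert (G : forall D, Cmod (csum c D) <= INR D * M).
    { induction D; [simpl; rewrite Cmod_0; lra|]. rewrite csum_S, S_INR. eapply Rle_trans; [apply Cmod_triangle|].
      assert (Cmod (c D) <= M); [|lra]. unfold c. rewrite Cmod_mult, Cmod_qexp.
      unfold Im, RtoC at 1; simpl. rewrite Rmult_0_r, Ropp_0, exp_0, Rmult_1_l. apply HM. }
    apply G. }
  rewrite E, !Cmod_mult, Cmod_pow, !Cmod_R, (Rabs_pos_eq (INR (S K))), (Rabs_pos_eq rho) in B by lra.
  apply Rmult_le_reg_l with (INR (S K)); lra.
Qed.

(** If x > M > 0, then (x/M)^n grows at least linearly. This removes the constant c that Cauchy's
    estimate loses inside the circle. *)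
Lemma bernoulli_inf x M c : 0 <= M -> (forall n : nat, x ^ n <= M ^ n * c) -> x <= M.
Proof.
  intros HM H. apply Rnot_lt_le. intros L. destruct HM as [PM|<-].
  2:{ specialize (H 1%nat). simpl in H. lra. }
  set (s := x / M - 1). assert (Ps : 0 < s).
  { unfold s. assert (1 < x / M); [|lra]. apply Rmult_lt_reg_r with M; auto. unfold Rdiv. rewrite Rmult_assoc, Rinv_l; lra. }
  assert (Ex : x = M * (1 + s)) by (unfold s; field; lra).
  assert (K : forall n : nat, 1 + INR n * s <= c).
  { intros n. eapply Rle_trans; [apply poly; auto|]. specialize (H n). rewrite Ex, Rpow_mult_distr in H.
    apply Rmult_le_reg_l with (M ^ n); auto. apply pow_lt; auto. }
  assert (c0 := K O). simpl in c0.
  destruct (nfloor_ex (c / s)) as [N [_ HN]]. { apply Rmult_le_pos; [lra|]. apply Rlt_le, Rinv_0_lt_compat; auto. }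
  specialize (K (S N)). rewrite S_INR in K.
  apply Rmult_lt_compat_r with (r := s) in HN; auto. replace (c / s * s) with c in HN by (field; lra). lra.
Qed.

(* Apply Cauchy's estimate to all powers of p and let the exponent tend to infinity. *)
Lemma max_modulus_poly p rho M w : ispoly p -> 0 < rho -> Cmod w < rho ->
  (forall t : R, Cmod (p (rho * qexp (RtoC t))%C) <= M) -> Cmod (p w) <= M.
Proof.
  intros Hp Pr Hw HM.
  assert (PM : 0 <= M) by (eapply Rle_trans; [apply Cmod_ge_0|apply (HM 0)]).
  set (t := Cmod w / rho). assert (Pw := Cmod_ge_0 w).
  assert (Ht : 0 <= t < 1).
  { unfold t. split. apply Rmult_le_pos; [lra|apply Rlt_le, Rinv_0_lt_compat; auto].
    apply Rmult_lt_reg_r with rho; auto. unfold Rdiv. rewrite Rmult_assoc, Rinv_l; lra. }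
  apply bernoulli_inf with (/ (1 - t)); auto. intros N.
  destruct (ispoly_pow p N Hp) as [d [a Ha]].
  assert (B : forall n, (n < d)%nat -> Cmod (a n) * rho ^ n <= M ^ N).
  { intros n Hn. apply poly_coef_bound with d; auto; [lra|]. intros s. rewrite <- Ha, Cmod_pow. apply pow_incr.
    split; auto using Cmod_ge_0. }
  rewrite <- Cmod_pow, Ha.
  assert (G : forall D, (D <= d)%nat -> Cmod (csum (fun n => a n * w ^ n)%C D) <= M ^ N * ((1 - t ^ D) / (1 - t))).
  { induction D; intros HD.
    - simpl. rewrite Cmod_0. right. field. lra.
    - rewrite csum_S. eapply Rle_trans; [apply Cmod_triangle|]. specialize (IHD ltac:(lia)).
      assert (Cmod (a D * w ^ D)%C <= M ^ N * t ^ D).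
      { rewrite Cmod_mult, Cmod_pow. specialize (B D ltac:(lia)).
        replace (Cmod w) with (rho * t) by (unfold t; field; lra). rewrite Rpow_mult_distr, <- Rmult_assoc.
        apply Rmult_le_compat_r; auto. apply pow_le; lra. }
      apply Rle_trans with (M ^ N * ((1 - t ^ D) / (1 - t)) + M ^ N * t ^ D); [lra|].
      right. simpl. field. lra. }
  eapply Rle_trans; [apply G; auto|]. apply Rmult_le_compat_l; [apply pow_le; auto|].
  unfold Rdiv. rewrite <- (Rmult_1_l (/ (1 - t))) at 2. apply Rmult_le_compat_r.
  - apply Rlt_le, Rinv_0_lt_compat; lra.
  - assert (0 <= t ^ d) by (apply pow_le; lra). lra.
Qed.

Lemma pow_exp x n : exp x ^ n = exp (INR n * x).
Proof.
  induction n. simpl. now rewrite Rmult_0_l, exp_0.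
  rewrite S_INR. simpl. rewrite IHn, <- exp_plus. f_equal; ring.
Qed.

(** |1 + x|^2 = 1 + 2 Re x + |x|^2 <= exp(2 Re x + |x|^2), raised to the power N + 1. *)
Lemma euler_upper (e : C) R N : Cmod e <= R -> Cmod (1 + e / INR (S N))%C ^ S N <= exp (Re e + R * R / INR (S N)).
Proof.
  intros HR. assert (Q := INR_S_ge1 N). set (n := INR (S N)) in *.
  assert (Pe := Cmod_ge_0 e).
  set (x := (e / n)%C).
  assert (ER : Re x = Re e / n). { unfold x, Cdiv. rewrite <- RtoC_inv, re_scal_r by lra. reflexivity. }
  assert (EM : Cmod x = Cmod e / n).
  { unfold x. rewrite Cmod_div by (apply RtoC_neq0; lra). rewrite Cmod_R, Rabs_pos_eq; lra. }
  assert (B : Cmod (1 + x)%C ^ 2 <= exp (2 * Re x + Cmod x ^ 2)).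
  { eapply Rle_trans; [|apply exp_ineq1_le]. rewrite !Cmod2_alt. destruct x; unfold Re, Im; simpl. right; ring. }
  assert (B2 : (Cmod (1 + x)%C ^ S N) ^ 2 <= exp (Re e + R * R / n) ^ 2).
  { rewrite <- pow_mult, Nat.mul_comm, pow_mult.
    eapply Rle_trans; [apply pow_incr; split; [apply pow_le, Cmod_ge_0|exact B]|].
    rewrite !pow_exp. fold n.
    assert (L : n * (2 * Re x + Cmod x ^ 2) <= INR 2 * (Re e + R * R / n)).
    { rewrite ER, EM. simpl. replace (n * (2 * (Re e / n) + Cmod e / n * (Cmod e / n * 1))) with (2 * Re e + Cmod e * Cmod e / n) by (field; lra).
      assert (Cmod e * Cmod e / n <= R * R / n).
      { apply Rmult_le_compat_r; [apply Rlt_le, Rinv_0_lt_compat; lra|]. apply Rmult_le_compat; lra. }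
      assert (0 <= R * R / n). { apply Rmult_le_pos; [nra|apply Rlt_le, Rinv_0_lt_compat; lra]. }
      lra. }
    destruct L as [L|L]; [apply Rlt_le, exp_increasing, L|rewrite L; lra]. }
  apply Rsqr_incr_0; [unfold Rsqr; simpl in *; lra|apply pow_le, Cmod_ge_0|apply Rlt_le, exp_pos].
Qed.

(** The upper bound for -e is turned around by (1 - x)(1 + x) = 1 - x^2, whose powers stay close to
    1 by Bernoulli. *)
Lemma euler_lower (e : C) R N : Cmod e <= R -> R * R < INR (S N) ->
  (1 - R * R / INR (S N)) * exp (Re e - R * R / INR (S N)) <= Cmod (1 + e / INR (S N))%C ^ S N.
Proof.
  intros HR HN. assert (U := euler_upper (- e)%C R N ltac:(rewrite Cmod_opp; auto)).
  assert (Q := INR_S_ge1 N). set (n := INR (S N)) in *. assert (Pe := Cmod_ge_0 e).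
  replace (Re (- e)%C) with (- Re e) in U by (destruct e; reflexivity).
  set (x := (e / n)%C) in *. replace (1 + - e / n)%C with (1 - x)%C in U by (unfold x; field; apply RtoC_neq0; lra).
  assert (EM : Cmod x = Cmod e / n).
  { unfold x. rewrite Cmod_div by (apply RtoC_neq0; lra). rewrite Cmod_R, Rabs_pos_eq; lra. }
  assert (Pn : 0 < / n) by (apply Rinv_0_lt_compat; lra).
  assert (L1 : 1 - R * R / (n * n) <= Cmod (1 - x)%C * Cmod (1 + x)%C).
  { rewrite <- Cmod_mult. replace ((1 - x) * (1 + x))%C with (1 - x * x)%C by ring.
    assert (T := Cmod_triang_inv 1 (x * x)%C). rewrite Cmod_1, Cmod_mult, EM in T.
    assert (Cmod e / n * (Cmod e / n) <= R * R / (n * n)).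
    { replace (Cmod e / n * (Cmod e / n)) with (Cmod e * Cmod e * (/ n * / n)) by (unfold Rdiv; ring).
      unfold Rdiv. rewrite Rinv_mult. apply Rmult_le_compat_r; [nra|]. apply Rmult_le_compat; lra. }
    lra. }
  assert (Ps : 0 <= R * R / (n * n) < 1).
  { split. apply Rmult_le_pos; [nra|apply Rlt_le, Rinv_0_lt_compat; nra].
    apply Rmult_lt_reg_r with (n * n); [nra|]. unfold Rdiv. rewrite Rmult_assoc, Rinv_l; nra. }
  assert (L2 : 1 - R * R / n <= (1 - R * R / (n * n)) ^ S N).
  { set (s := R * R / (n * n)) in *. assert (Es : R * R / n = n * s) by (unfold s; field; lra). rewrite Es. unfold n.
    clear -Ps. assert (G : forall k, 1 - INR k * s <= (1 - s) ^ k).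
    { induction k. simpl; lra. rewrite S_INR. simpl. assert (0 <= INR k) by apply pos_INR. nra. }
    apply G. }
  assert (L3 : (1 - R * R / (n * n)) ^ S N <= Cmod (1 - x)%C ^ S N * Cmod (1 + x)%C ^ S N).
  { rewrite <- Rpow_mult_distr. apply pow_incr. lra. }
  set (A := Cmod (1 - x)%C ^ S N) in *. set (B := Cmod (1 + x)%C ^ S N) in *.
  assert (PB : 0 <= B) by (apply pow_le, Cmod_ge_0).
  set (E := exp (Re e - R * R / n)).
  assert (EE : exp (- Re e + R * R / n) = / E).
  { unfold E. rewrite <- exp_Ropp. f_equal; ring. }
  rewrite EE in U. assert (PE : 0 < E) by apply exp_pos.
  apply Rle_trans with (A * B * E); [apply Rmult_le_compat_r; lra|].
  apply Rle_trans with (/ E * B * E); [apply Rmult_le_compat_r; [lra|apply Rmult_le_compat_r; auto]|].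
  right. field. lra.
Qed.

Lemma ispoly_bounded p rho : ispoly p -> exists B, forall w, Cmod w <= rho -> Cmod (p w) <= B.
Proof.
  intros [d [a Ha]]. 
  assert (G : forall D, exists B, forall w, Cmod w <= rho -> Cmod (csum (fun n => a n * w ^ n)%C D) <= B).
  { induction D as [|D [B HB]].
    - exists 0. intros; simpl; rewrite Cmod_0; lra.
    - exists (B + Cmod (a D) * rho ^ D). intros w Hw. rewrite csum_S. eapply Rle_trans; [apply Cmod_triangle|].
      rewrite Cmod_mult, Cmod_pow. specialize (HB w Hw).
      assert (Cmod (a D) * Cmod w ^ D <= Cmod (a D) * rho ^ D).
      { apply Rmult_le_compat_l; [apply Cmod_ge_0|]. apply pow_incr; split; auto using Cmod_ge_0. }
      lra. }
  destruct (G d) as [B HB]. exists B. intros; rewrite Ha; auto.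
Qed.

Lemma le_of_le_plus_inv x M c : (exists N0, forall N : nat, (N0 <= N)%nat -> x <= M + c / INR (S N)) -> x <= M.
Proof.
  intros [N0 H]. apply Rnot_lt_le. intros L.
  destruct (nfloor_ex (Rabs c / (x - M))) as [N [_ HN]].
  { apply Rmult_le_pos; [apply Rabs_pos|apply Rlt_le, Rinv_0_lt_compat; lra]. }
  specialize (H (N0 + N)%nat ltac:(lia)).
  assert (Q := INR_S_ge1 (N0 + N)). assert (LL : INR N + 1 <= INR (S (N0 + N))).
  { rewrite <- S_INR. apply le_INR. lia. }
  set (n := INR (S (N0 + N))) in *.
  apply Rmult_lt_compat_r with (r := x - M) in HN; [|lra].
  replace (Rabs c / (x - M) * (x - M)) with (Rabs c) in HN by (field; lra).
  assert (c / n < x - M); [|lra].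
  apply Rmult_lt_reg_r with n; [lra|]. unfold Rdiv. rewrite Rmult_assoc, Rinv_l, Rmult_1_r by lra.
  assert (A := Rle_abs c). nra.
Qed.

(* exp e is the limit of the polynomials (1 + e/N)^N. *)
Lemma max_modulus_poly_exp p e rho M w : ispoly p -> ispoly e -> 0 < rho -> Cmod w < rho ->
  (forall t : R, Cmod (p (rho * qexp (RtoC t))%C) * exp (Re (e (rho * qexp (RtoC t))%C)) <= M) ->
  Cmod (p w) * exp (Re (e w)) <= M.
Proof.
  intros Hp He Pr Hw HM. destruct (ispoly_bounded e rho He) as [R HR].
  assert (PM : 0 <= M).
  { eapply Rle_trans; [|apply (HM 0)]. apply Rmult_le_pos; [apply Cmod_ge_0|apply Rlt_le, exp_pos]. }
  assert (PR : 0 <= R) by (eapply Rle_trans; [apply Cmod_ge_0|apply (HR w); lra]).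
  assert (Cz : forall t, Cmod (rho * qexp (RtoC t))%C = rho).
  { intros t. rewrite Cmod_mult, Cmod_R, Rabs_pos_eq, Cmod_qexp by lra. unfold Im, RtoC; simpl.
    rewrite Rmult_0_r, Ropp_0, exp_0; ring. }
  set (x := Cmod (p w) * exp (Re (e w))).
  assert (Px : 0 <= x) by (apply Rmult_le_pos; [apply Cmod_ge_0|apply Rlt_le, exp_pos]).
  destruct (nfloor_ex (R * R)) as [N0 [_ HN0]]; [nra|].
  (* With s = R^2/(N+1), replacing exp by the polynomial costs the factor (1 - s) exp(-2s) >= 1 -
     3s. *)
  apply le_of_le_plus_inv with (3 * x * (R * R)). exists N0. intros N HN.
  assert (Q := INR_S_ge1 N).
  assert (LN : R * R < INR (S N)). { rewrite S_INR. apply le_INR in HN. lra. }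
  assert (Pq : ispoly (fun w => p w * (1 + e w / INR (S N)) ^ S N)%C).
  { apply ispoly_mult; auto. apply ispoly_pow. apply ispoly_plus; [apply ispoly_const|].
    apply ispoly_ext with (fun w => / INR (S N) * e w)%C; [intros; unfold Cdiv; ring|]. now apply ispoly_scal. }
  assert (MM := max_modulus_poly _ rho (M * exp (R * R / INR (S N))) w Pq Pr Hw).
  assert (HH : Cmod (p w * (1 + e w / INR (S N)) ^ S N)%C <= M * exp (R * R / INR (S N))).
  { apply MM. intros t. rewrite Cmod_mult, Cmod_pow.
    eapply Rle_trans; [apply Rmult_le_compat_l; [apply Cmod_ge_0|apply (euler_upper _ R)]|].
    - apply HR. rewrite Cz; lra.
    - rewrite exp_plus, <- Rmult_assoc. apply Rmult_le_compat_r; [apply Rlt_le, exp_pos|apply HM]. }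
  rewrite Cmod_mult, Cmod_pow in HH.
  assert (LL := euler_lower (e w) R N (HR w ltac:(lra)) LN).
  set (s := R * R / INR (S N)) in *.
  assert (Hs : 0 <= s < 1).
  { unfold s. split. apply Rmult_le_pos; [nra|apply Rlt_le, Rinv_0_lt_compat; lra].
    apply Rmult_lt_reg_r with (INR (S N)); [lra|]. unfold Rdiv. rewrite Rmult_assoc, Rinv_l; lra. }
  assert (E1 : exp (Re (e w) - s) = exp (Re (e w)) * exp (- s)) by (rewrite <- exp_plus; reflexivity).
  rewrite E1 in LL.
  assert (Es : exp s * exp (- s) = 1) by (rewrite <- exp_plus, Rplus_opp_r; apply exp_0).
  assert (A := exp_ineq1_le (- s)). assert (Pes := exp_pos s). assert (Pem := exp_pos (- s)).
  assert (K : x * ((1 - s) * exp (- s)) <= M * exp s).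
  { eapply Rle_trans; [|exact HH]. unfold x. 
    replace (Cmod (p w) * exp (Re (e w)) * ((1 - s) * exp (- s))) with (Cmod (p w) * ((1 - s) * (exp (Re (e w)) * exp (- s)))) by ring.
    apply Rmult_le_compat_l; [apply Cmod_ge_0|exact LL]. }
  assert (K2 : x * ((1 - s) * exp (- s) * exp (- s)) <= M).
  { apply Rmult_le_compat_r with (r := exp (- s)) in K; [|lra].
    replace (M * exp s * exp (- s)) with (M * (exp s * exp (-s))) in K by ring. rewrite Es in K. lra. }
  assert (K3 : 1 - 3 * s <= (1 - s) * exp (- s) * exp (- s)).
  { assert ((1 - s) * (1 - s) <= exp (-s) * exp (-s)) by (apply Rmult_le_compat; lra). nra. }
  replace (3 * x * (R * R) / INR (S N)) with (3 * x * s) by (unfold s, Rdiv; ring).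
  nra.
Qed.

(** Both series are truncated with error eps on the closed disc of radius rho, and eps tends to 0.
    Keeping the exponential as a separate factor avoids composing power series. *)
Lemma max_modulus_pser a b rho M w : goodc a -> goodc b -> 0 < rho < 1 -> Cmod w < rho ->
  (forall t : R, Cmod (pser a (rho * qexp (RtoC t))%C) * exp (Re (pser b (rho * qexp (RtoC t))%C)) <= M) ->
  Cmod (pser a w) * exp (Re (pser b w)) <= M.
Proof.
  intros Ha Hb Hr Hw HM.
  assert (PM : 0 <= M).
  { eapply Rle_trans; [|apply (HM 0)]. apply Rmult_le_pos; [apply Cmod_ge_0|apply Rlt_le, exp_pos]. }
  destruct (pser_bounded b rho Hb ltac:(lra)) as [R HR].
  assert (PR : 0 <= R) by (eapply Rle_trans; [apply Cmod_ge_0|apply (HR w); lra]).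
  assert (Cz : forall t, Cmod (rho * qexp (RtoC t))%C = rho).
  { intros t. rewrite Cmod_mult, Cmod_R, Rabs_pos_eq, Cmod_qexp by lra. unfold Im, RtoC; simpl.
    rewrite Rmult_0_r, Ropp_0, exp_0; ring. }
  set (x := Cmod (pser a w) * exp (Re (pser b w))).
  set (E := exp (R + 1)). assert (PE : 0 < E) by apply exp_pos.
  (* N >= 3 makes eps = 1/(N+1) at most 1/4, so exp(2 eps) <= 1 + 4 eps; the three eps E bound the
     truncation errors of the first factor. *)
  apply le_of_le_plus_inv with (4 * M + 3 * E). exists 3%nat. intros N HN.
  assert (Q : 4 <= INR (S N)). { rewrite S_INR. apply le_INR in HN. simpl in HN. lra. }
  set (eps := / INR (S N)). assert (Pe : 0 < eps) by (apply Rinv_0_lt_compat; lra).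
  assert (eps4 : eps <= 1/4). { unfold eps. replace (1/4) with (/ 4) by lra. apply Rinv_le_contravar; lra. }
  destruct (series_tail_small _ (Ha rho ltac:(lra)) eps Pe) as [Na HNa].
  destruct (series_tail_small _ (Hb rho ltac:(lra)) eps Pe) as [Nb HNb].
  set (p := fun w => csum (fun n => a n * w ^ n)%C Na). set (e := fun w => csum (fun n => b n * w ^ n)%C Nb).
  assert (Hp : ispoly p) by (exists Na, a; reflexivity). assert (He : ispoly e) by (exists Nb, b; reflexivity).
  assert (T : forall (a : nat -> C) u n, goodc a -> Cmod u <= rho ->
     Rabs (Series (fun k => Cmod (a (n + k)%nat) * rho ^ (n + k))) < eps ->
     Cmod (pser a u - csum (fun n => a n * u ^ n)%C n)%C <= eps).
  { clear -Hr. intros a u n Ga Hu Ht.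
    eapply Rle_trans; [apply (CS_tail _ (fun n => Cmod (a n) * rho ^ n))|].
    - intros m. rewrite Cmod_mult, Cmod_pow. apply Rmult_le_compat_l; [apply Cmod_ge_0|].
      apply pow_incr; split; auto using Cmod_ge_0.
    - apply Ga; lra.
    - eapply Rle_trans; [apply Rle_abs|]. lra. }
  assert (Tp : forall u, Cmod u <= rho -> Cmod (pser a u - p u)%C <= eps) by (intros; apply T; auto).
  assert (Te : forall u, Cmod u <= rho -> Cmod (pser b u - e u)%C <= eps) by (intros; apply T; auto).
  assert (TR : forall u, Cmod u <= rho -> Re (e u) <= Re (pser b u) + eps /\ Re (pser b u) <= Re (e u) + eps /\ Re (pser b u) <= R).
  { intros u Hu. specialize (Te u Hu). assert (B := re_le_Cmod (pser b u - e u)%C).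
    replace (Re (pser b u - e u)%C) with (Re (pser b u) - Re (e u)) in B by reflexivity.
    assert (B' : Rabs (Re (pser b u) - Re (e u)) <= eps) by lra. apply Rabs_le_between in B'.
    assert (B2 := re_le_Cmod (pser b u)). specialize (HR u Hu). assert (A := Rle_abs (Re (pser b u))). lra. }
  assert (Xle : forall s t, s <= t -> exp s <= exp t).
  { intros s t [L| ->]; [apply Rlt_le, exp_increasing, L|lra]. }
  set (X := exp eps). assert (PX : 1 <= X <= 1 + 4/3 * eps).
  { unfold X. split. apply Rle_trans with (1 + eps); [lra|apply exp_ineq1_le].
    assert (A := exp_ineq1_le (- eps)). assert (B : exp eps * exp (- eps) = 1) by (rewrite <- exp_plus, Rplus_opp_r; apply exp_0).
    assert (P := exp_pos eps). nra. }
  assert (MM : Cmod (p w) * exp (Re (e w)) <= M * X + eps * E).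
  { apply max_modulus_poly_exp with rho; auto; [lra|]. intros t. set (u := (rho * qexp (RtoC t))%C) in *.
    assert (Hu : Cmod u <= rho) by (unfold u; rewrite Cz; lra).
    specialize (Tp u Hu). destruct (TR u Hu) as [t1 [t2 t3]]. specialize (HM t). fold u in HM.
    assert (C1 : Cmod (p u) <= Cmod (pser a u) + eps).
    { assert (I := Cmod_triang_inv (p u) (pser a u)). rewrite Cmod_minus_sym in I. lra. }
    apply Rle_trans with ((Cmod (pser a u) + eps) * exp (Re (pser b u) + eps)).
    { apply Rmult_le_compat; auto using Cmod_ge_0. apply Rlt_le, exp_pos. }
    rewrite Rmult_plus_distr_r. apply Rplus_le_compat.
    - rewrite exp_plus, <- Rmult_assoc. apply Rmult_le_compat_r; [apply Rlt_le, exp_pos|exact HM].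
    - apply Rmult_le_compat_l; [lra|]. apply Xle. lra. }
  destruct (TR w ltac:(lra)) as [t1 [t2 t3]]. specialize (Tp w ltac:(lra)).
  assert (C1 : Cmod (pser a w) <= Cmod (p w) + eps).
  { assert (I := Cmod_triang_inv (pser a w) (p w)). lra. }
  assert (F : x <= (M * X + eps * E) * X + eps * E).
  { unfold x. apply Rle_trans with ((Cmod (p w) + eps) * exp (Re (pser b w))).
    { apply Rmult_le_compat_r; [apply Rlt_le, exp_pos|exact C1]. }
    rewrite Rmult_plus_distr_r. apply Rplus_le_compat.
    - apply Rle_trans with (Cmod (p w) * (exp (Re (e w)) * X)).
      + apply Rmult_le_compat_l; [apply Cmod_ge_0|]. unfold X. rewrite <- exp_plus. apply Xle; lra.
      + rewrite <- Rmult_assoc. apply Rmult_le_compat_r; [lra|exact MM].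
    - apply Rmult_le_compat_l; [lra|]. apply Xle; lra. }
  replace ((4 * M + 3 * E) / INR (S N)) with ((4 * M + 3 * E) * eps) by (unfold eps, Rdiv; ring).
  assert (X2 : X * X <= 1 + 4 * eps) by nra.
  assert (X3 : X <= 2) by lra.
  assert (M * (X * X) <= M * (1 + 4 * eps)) by (apply Rmult_le_compat_l; auto).
  assert (eps * E * X <= eps * E * 2) by (apply Rmult_le_compat_l; [nra|lra]).
  lra.
Qed.

(** * Reduction theory *)

(* Coefficients of f(x^5). *)
Definition spr (a : nat -> C) (n : nat) : C := if (n mod 5 =? 0)%nat then a (n / 5)%nat else RtoC 0.

Lemma spr_values a K : spr a (5 * K) = a K /\ spr a (5 * K + 1) = RtoC 0 /\ spr a (5 * K + 2) = RtoC 0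
  /\ spr a (5 * K + 3) = RtoC 0 /\ spr a (5 * K + 4) = RtoC 0.
Proof.
  assert (Z : forall i, (0 < i < 5)%nat -> spr a (5 * K + i) = RtoC 0).
  { intros i Hi. unfold spr. replace (5 * K + i)%nat with (i + K * 5)%nat by lia.
    rewrite Nat.Div0.mod_add, Nat.mod_small by lia. destruct i; [lia|reflexivity]. }
  split; [|repeat split; apply Z; lia].
  unfold spr. rewrite Nat.mul_comm, Nat.Div0.mod_mul, Nat.div_mul by lia. reflexivity.
Qed.

Lemma sum_spr_R (a : nat -> C) rho K : 0 <= rho -> 
  sum_f_R0 (fun n => Cmod (spr a n) * rho ^ n) (5 * K + 4) = sum_f_R0 (fun n => Cmod (a n) * (rho ^ 5) ^ n) K.
Proof.
  intros Hr.
  assert (S5 := spr_values a).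
  induction K as [|K IH].
  - destruct (S5 O) as [e0 [e1 [e2 [e3 e4]]]]. simpl in *. rewrite e0, e1, e2, e3, e4, !Cmod_0. ring.
  - destruct (S5 (S K)) as [e0 [e1 [e2 [e3 e4]]]].
    replace (5 * S K + 4)%nat with (S (S (S (S (S (5 * K + 4)))))) by lia. rewrite !tech5, IH.
    replace (S (S (S (S (S (5 * K + 4)))))) with (5 * S K + 4)%nat by lia.
    replace (S (S (S (S (5 * K + 4))))) with (5 * S K + 3)%nat by lia.
    replace (S (S (S (5 * K + 4)))) with (5 * S K + 2)%nat by lia.
    replace (S (S (5 * K + 4))) with (5 * S K + 1)%nat by lia.
    replace (S (5 * K + 4)) with (5 * S K)%nat by lia.
    rewrite e0, e1, e2, e3, e4, !Cmod_0, pow_mult. ring.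
Qed.

Lemma csum_spr (a : nat -> C) x K :
  csum (fun n => spr a n * x ^ n)%C (5 * K) = csum (fun n => a n * (x ^ 5) ^ n)%C K.
Proof.
  assert (S5 := spr_values a).
  induction K as [|K IH]; [reflexivity|].
  destruct (S5 K) as [e0 [e1 [e2 [e3 e4]]]].
  replace (5 * S K)%nat with (5 * K + 5)%nat by lia. rewrite csum_app, IH, (csum_S _ K).
  change (csum (fun k => spr a (5 * K + k) * x ^ (5 * K + k))%C 5) with
    (0 + spr a (5 * K + 0) * x ^ (5 * K + 0) + spr a (5 * K + 1) * x ^ (5 * K + 1) + spr a (5 * K + 2) * x ^ (5 * K + 2)
      + spr a (5 * K + 3) * x ^ (5 * K + 3) + spr a (5 * K + 4) * x ^ (5 * K + 4))%C.
  rewrite Nat.add_0_r, e0, e1, e2, e3, e4, Cpow_mult_r. ring.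
Qed.

Lemma ex_series_bounded (u : nat -> R) B : (forall n, 0 <= u n) -> (forall n, sum_f_R0 u n <= B) -> ex_series u.
Proof.
  intros Hp HB.
  destruct (ex_finite_lim_seq_incr (sum_n u) B) as [l Hl].
  - intros n. rewrite sum_Sn. unfold plus; simpl. generalize (Hp (S n)); lra.
  - intros n. rewrite sum_n_Reals. apply HB.
  - exists l. exact Hl.
Qed.

Lemma pow5_lt1 rho : 0 <= rho < 1 -> 0 <= rho ^ 5 < 1.
Proof.
  intros H. split; [apply pow_le; lra|]. destruct (Req_dec rho 0) as [->|N]; [simpl; lra|].
  assert (rho ^ 5 <= rho ^ 1); [|simpl in *; lra].
  simpl. assert (rho * rho <= 1) by nra. assert (0 <= rho * rho) by nra.
  assert (rho * (rho * rho) <= rho) by nra. assert (0 <= rho * (rho * rho)) by nra.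
  replace (rho * (rho * (rho * (rho * (rho * 1))))) with (rho * (rho * rho) * (rho * rho)) by ring. nra.
Qed.

Lemma goodc_spr a : goodc a -> goodc (spr a).
Proof.
  intros H rho Hr. assert (H5 := H _ (pow5_lt1 rho Hr)).
  set (v := fun n => Cmod (a n) * (rho ^ 5) ^ n) in H5.
  assert (Pv : forall n, 0 <= v n).
  { intros n. apply Rmult_le_pos; [apply Cmod_ge_0|]. apply pow_le, pow_le; lra. }
  assert (Pu : forall n, 0 <= Cmod (spr a n) * rho ^ n).
  { intros n. apply Rmult_le_pos; [apply Cmod_ge_0|apply pow_le; lra]. }
  apply ex_series_bounded with (Series v); auto. intros n.
  apply Rle_trans with (sum_f_R0 (fun n => Cmod (spr a n) * rho ^ n) (5 * n + 4)).
  - rewrite <- !sum_n_Reals. assert (G : forall k, sum_n (fun n => Cmod (spr a n) * rho ^ n) n <= sum_n (fun n => Cmod (spr a n) * rho ^ n) (n + k)).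
    { induction k. rewrite Nat.add_0_r; lra. rewrite Nat.add_succ_r, sum_Sn. unfold plus; simpl.
      generalize (Pu (S (n + k))). simpl. lra. }
    replace (5 * n + 4)%nat with (n + (4 * n + 4))%nat by lia. apply G.
  - rewrite sum_spr_R by lra. rewrite <- sum_n_Reals. now apply sum_n_le_Series.
Qed.

Lemma Cmod_pow5_lt1 x : Cmod x < 1 -> Cmod (x ^ 5)%C < 1.
Proof. intros H. rewrite Cmod_pow. apply pow5_lt1. split; auto using Cmod_ge_0. Qed.

Lemma pser_spr a x : goodc a -> Cmod x < 1 -> pser (spr a) x = pser a (x ^ 5)%C.
Proof.
  intros H Hx. assert (A := pser_cser _ x (goodc_spr a H) Hx).
  assert (B := pser_cser a _ H (Cmod_pow5_lt1 x Hx)).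
  eapply clim_unique; [|exact B].
  apply clim_ext with (fun K => csum (fun n => spr a n * x ^ n)%C (5 * K)).
  - intros K. apply csum_spr.
  - apply (clim_subseq _ _ (fun K => 5 * K)%nat); [intros; lia|exact A].
Qed.

Lemma qexp_five z : (qexp (5 * z) = qexp z ^ 5)%C.
Proof. rewrite qexp_pow. f_equal. simpl. f_equal. f_equal. lra. Qed.

Lemma qs_spr a z : goodc a -> in_H z -> qs (spr a) z = qs a (5 * z)%C.
Proof. intros H Hz. unfold qs. rewrite pser_spr, qexp_five by auto using Cmod_qexp_lt1. reflexivity. Qed.

(* Reduction to the fundamental domain: each step of translating to |Re z| <= 1/2
   and inverting at least doubles Im z as long as Im z < 1/2. *)
Lemma reduction_SL2 n : forall z, in_H z -> 1/2 <= 2 ^ n * Im z ->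
  exists a b c d z', in_SL2Z a b c d /\ in_H z' /\ 1/2 <= Im z' /\ Rabs (Re z') <= 1 /\ z = moeb a b c d z'.
Proof.
  assert (TR : forall z, in_H z -> exists k, Rabs (Re (z + IZR k)%C) <= 1/2 /\ Im (z + IZR k)%C = Im z).
  { intros z _. destruct (archimed (Re z - 1/2)) as [A1 A2]. exists (- up (Re z - 1/2))%Z.
    rewrite opp_IZR. split.
    - replace (Re (z + RtoC (- IZR (up (Re z - 1/2))))%C) with (Re z - IZR (up (Re z - 1/2))) by (destruct z; reflexivity).
      apply Rabs_le. lra.
    - destruct z; unfold Im; simpl. ring. }
  induction n as [|n IH]; intros z Hz Hn.
  - destruct (TR z Hz) as [k [K1 K2]]. simpl in Hn.
    exists 1%Z, (- k)%Z, 0%Z, 1%Z, (z + IZR k)%C. split; [unfold in_SL2Z; lia|]. split; [now apply in_H_T|].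
    split; [rewrite K2; lra|]. split; [lra|]. unfold moeb. rewrite opp_IZR, RtoC_opp. field.
  - destruct (TR z Hz) as [k [K1 K2]]. set (w := (z + IZR k)%C) in *.
    assert (Hw : in_H w) by (now apply in_H_T).
    destruct (Rle_dec (1/2) (Im w)) as [L|L].
    + exists 1%Z, (- k)%Z, 0%Z, 1%Z, w. split; [unfold in_SL2Z; lia|]. split; auto. split; auto. split; [lra|].
      unfold moeb, w. rewrite opp_IZR, RtoC_opp. field.
    + assert (HS := in_H_Sneg w Hw). assert (Nw := in_H_nz w Hw).
      assert (E : Im (- / w)%C = Im w / (Re w * Re w + Im w * Im w)).
      { unfold in_H in Hw. destruct w as [x y]. unfold Re, Im in *; simpl in *. field. nra. }
      assert (B : Re w * Re w <= 1/4) by (apply Rabs_le_between in K1; nra).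
      assert (D : 2 * Im w <= Im (- / w)%C).
      { rewrite E. unfold in_H in Hw. apply Rmult_le_reg_r with (Re w * Re w + Im w * Im w); [nra|].
        set (X := Re w * Re w + Im w * Im w) in *. assert (PX : 0 < X) by (unfold X; nra).
        replace (Im w / X * X) with (Im w) by (field; lra). unfold X. nra. }
      destruct (IH (- / w)%C HS) as [a [b [c [d [z' [S [Hz' [L1 [L2 E']]]]]]]]].
      { rewrite <- K2 in Hn. change (2 ^ S n) with (2 * 2 ^ n) in Hn. assert (P2 : 0 < 2 ^ n) by (apply pow_lt; lra).
        apply Rle_trans with (2 ^ n * (2 * Im w)); [lra|]. apply Rmult_le_compat_l; lra. }
      (* z = T^{-k} S^{-1} (-1/w) and -1/w = g z' *)
      exists (- c - k * a)%Z, (- d - k * b)%Z, a, b, z'.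
      assert (S' : in_SL2Z (- c - k * a) (- d - k * b) a b) by (unfold in_SL2Z in *; nia).
      split; auto. split; auto. split; auto. split; auto.
      assert (N1 := jf_nz _ _ _ _ z' S Hz'). assert (N2 := jf_nz _ _ _ _ z' S' Hz').
      assert (Ew : w = (- (jf c d z') / jf a b z')%C).
      { replace w with (- / (- / w))%C by (field; auto). rewrite E', moeb_eq. unfold jf in *. field. auto. }
      replace z with (w - IZR k)%C by (unfold w; ring). rewrite Ew, moeb_eq.
      unfold jf in *. rewrite !minus_IZR, !opp_IZR, !mult_IZR, !RtoC_minus, !RtoC_opp, !RtoC_mult. field. auto.
Qed.

(** The coset representatives of Gamma_0(5) are the identity and S T^j, 0 <= j < 5. If 5 does not
    divide c, j is chosen with 5 | d - jc; the shift by j raises the bound on |Re| from 1 to 5. *)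
Lemma reduction_G05 z : in_H z -> exists a b c d z', in_Gamma0_5 a b c d /\ in_H z' /\ 1/2 <= Im z' /\
  Rabs (Re z') <= 5 /\ (z = moeb a b c d z' \/ z = moeb a b c d (- / z')%C).
Proof.
  intros Hz. destruct (nfloor_ex (/ Im z)) as [n [_ Hn]].
  { apply Rlt_le, Rinv_0_lt_compat; exact Hz. }
  assert (P2n : INR n + 1 <= 2 ^ n). { clear. induction n. simpl; lra. rewrite S_INR. simpl. generalize (pos_INR n); lra. }
  destruct (reduction_SL2 n z Hz) as [a [b [c [d [z' [S [Hz' [L1 [L2 E]]]]]]]]].
  { assert (/ Im z < 2 ^ n) by lra. unfold in_H in Hz. apply Rmult_lt_compat_r with (r := Im z) in H; auto.
    rewrite Rinv_l in H by lra. lra. }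
  destruct (mod5_cases c d) as [[c' Ec]|[B [e He]]].
  - exists a, b, c, d, z'. split; [split; auto; exists c'; lia|]. split; auto. split; auto. split; [lra|auto].
  - set (j := (B mod 5)%Z). assert (Hj : (0 <= j < 5)%Z) by (apply Z.mod_pos_bound; lia).
    assert (Hd : (d - j * c = 5 * (e + c * (B / 5)))%Z).
    { generalize (Z.div_mod B 5 ltac:(lia)). fold j. nia. }
    exists (- (b - j * a))%Z, a, (- (d - j * c))%Z, c, (z' + IZR j)%C.
    assert (S' : in_SL2Z (- (b - j * a)) a (- (d - j * c)) c) by (unfold in_SL2Z in *; nia).
    assert (Hw : in_H (z' + IZR j)%C) by (now apply in_H_T).
    split; [split; [exact S'|]|split; [auto|split; [|split]]].
    + exists (- (e + c * (B / 5)))%Z. lia.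
    + destruct z'; unfold Im in *; simpl in *. lra.
    + replace (Re (z' + IZR j)%C) with (Re z' + IZR j) by (destruct z'; reflexivity).
      assert (0 <= IZR j <= 4) by (split; apply IZR_le; lia). apply Rabs_le_between in L2. apply Rabs_le. lra.
    + right. rewrite E. rewrite <- (moeb_S _ _ _ _ _ S' Hw).
      replace (- - (b - j * a))%Z with (b + a * (- j))%Z by ring. replace (- - (d - j * c))%Z with (d + c * (- j))%Z by ring.
      rewrite moeb_T, opp_IZR, RtoC_opp. f_equal. ring.
Qed.

(** * Sturm's bound *)

Lemma goodc_shift a N : goodc a -> goodc (fun n => a (N + n)%nat).
Proof.
  intros H rho Hr. set (m := (1 + rho) / 2). assert (Hm : 0 < m < 1) by (unfold m; lra).
  assert (E := proj1 (ex_series_incr_n _ N) (H m ltac:(lra))).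
  apply (@ex_series_scal_l R_AbsRing R_NormedModule (/ m ^ N)) in E.
  apply @ex_series_le with (2 := E). intros n.
  change (Rabs (Cmod (a (N + n)%nat) * rho ^ n) <= / m ^ N * (Cmod (a (N + n)%nat) * m ^ (N + n))).
  assert (P1 : 0 <= rho ^ n) by (apply pow_le; lra). assert (P2 : 0 < m ^ N) by (apply pow_lt; lra).
  rewrite Rabs_pos_eq by (apply Rmult_le_pos; auto using Cmod_ge_0).
  rewrite pow_add. replace (/ m ^ N * (Cmod (a (N + n)%nat) * (m ^ N * m ^ n))) with (Cmod (a (N + n)%nat) * m ^ n) by (field; lra).
  apply Rmult_le_compat_l; [apply Cmod_ge_0|]. apply pow_incr. unfold m; lra.
Qed.

Lemma pser_shift a N w : goodc a -> Cmod w < 1 -> (forall n, (n < N)%nat -> a n = RtoC 0) ->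
  (pser a w = w ^ N * pser (fun n => a (N + n)%nat) w)%C.
Proof.
  intros Ha Hw H0. apply cser_CS. assert (A := pser_cser _ w (goodc_shift a N Ha) Hw).
  assert (B := asum_cser _ (goodc_asum a w Ha Hw)).
  replace (w ^ N * pser (fun n => a (N + n)%nat) w)%C with (pser a w); [exact B|].
  apply (cser_scal (w ^ N)%C) in A. eapply clim_unique; [|exact A].
  apply clim_ext with (fun k => csum (fun n => a n * w ^ n)%C (N + k)).
  - intros k. rewrite csum_app, (csum_0 (fun n => a n * w ^ n)%C).
    + rewrite Cplus_0_l. apply csum_ext. intros j _. rewrite Cpow_add_r. ring.
    + intros j Hj. rewrite H0 by auto. ring.
  - apply (clim_subseq _ _ (fun k => N + k)%nat); [intros; lia|exact B].
Qed.

(** After division by q^N the first possibly nonzero coefficient is the limit of the series as q =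
    1/(2(k+1)) tends to 0; these q are values of [qexp]. *)
Lemma qexpansion_zero a : goodc (zc a) -> (forall z, in_H z -> qs (zc a) z = RtoC 0) -> forall n, a n = 0%Z.
Proof.
  intros G H.
  assert (K : forall N, (forall n, (n < N)%nat -> a n = 0%Z) -> a N = 0%Z).
  { intros N HN.
    assert (H0 : forall n, (n < N)%nat -> zc a n = RtoC 0) by (intros n Hn; unfold zc; rewrite HN; auto).
    assert (G' := goodc_shift (zc a) N G). set (g := fun n => zc a (N + n)%nat) in *.
    set (x := fun k => (RtoC (1/2) / INR (S k))%C).
    assert (L := cder_cont_seq (pser g) (RtoC 0) _ x (cder_pser g (RtoC 0) G' ltac:(rewrite Cmod_0; lra)) (clim_inv_S _)).
    assert (Z : forall k, pser g (0 + x k)%C = RtoC 0).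
    { intros k. rewrite Cplus_0_l. assert (Q := INR_S_ge1 k).
      assert (Ex : x k = RtoC (1/2 / INR (S k))) by (unfold x; rewrite (RtoC_div (1/2) (INR (S k))) by lra; reflexivity).
      assert (B : 0 < 1/2 / INR (S k) < 1).
      { split; [apply Rdiv_lt_0_compat; lra|]. apply Rmult_lt_reg_r with (INR (S k)); [lra|].
        unfold Rdiv at 1. rewrite Rmult_assoc, Rinv_l; lra. }
      destruct (qexp_surj _ B) as [z [Hz Ez]]. specialize (H z Hz). unfold qs in H.
      rewrite (pser_shift _ N) in H; auto using Cmod_qexp_lt1. fold g in H. rewrite Ez, <- Ex in H.
      assert (Nx : x k <> RtoC 0) by (rewrite Ex; apply RtoC_neq0; lra).
      replace (pser g (x k)) with (x k ^ N * pser g (x k) * / (x k ^ N))%C by (field; apply Cpow_nz; auto).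
      rewrite H. ring. }
    assert (E : pser g (RtoC 0) = RtoC 0).
    { eapply clim_unique; [exact L|]. apply clim_ext with (fun _ => RtoC 0); [intros; now rewrite Z|apply clim_const]. }
    assert (E2 : pser g (RtoC 0) = g O).
    { unfold pser. rewrite (CS_finite _ 1).
      - simpl. ring.
      - intros j Hj. destruct j; [lia|]. rewrite Cpow_S. ring. }
    rewrite E2 in E. unfold g, zc in E. rewrite Nat.add_0_r in E. apply RtoC_inj in E. now apply eq_IZR in E. }
  intros n. induction n as [n IH] using (well_founded_induction lt_wf). now apply K.
Qed.

(** Real logarithm of the eta product: the series of sigma(n)/n q^n is -log of prod (1 - q^n), and
    |q|^(1/12) gives the linear term. *)
Lemma D2_formula z : D2 z = exp (- (PI / 6 * Im z) - 2 * Re (qs phic z)).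
Proof.
  unfold D2. rewrite Cmod_qexp. f_equal. assert (P := PI_RGT_0).
  replace (Im (phi z / 12)%C) with ((Im z + 12 / PI * Re (qs phic z)) / 12).
  - field. lra.
  - unfold phi, Cdiv. rewrite <- !RtoC_inv by lra. set (E := qs phic z).
    destruct z as [x y], E as [u v]. unfold Re, Im, RtoC, Ci, Cplus, Cmult; simpl. unfold Rdiv. ring.
Qed.

Section Sturm.
Variables (m : nat) (F : C -> C) (a : nat -> Z).
Hypothesis HF : modular_form_G05 (4 * m) F.
Hypothesis Ha : has_qexpansion F a.
Hypothesis H0 : forall n, (n <= 2 * m)%nat -> a n = 0%Z.

(* |F|^2 |eta(z)|^(4m+6) / |eta(5z)|^(20m+6): invariant under Gamma_0(5) and vanishing at both cusps. *)
Let hh (z : C) : R := Cmod (F z) ^ 2 * D2 z ^ (2 * m + 3) / D2 (5 * z) ^ (10 * m + 3).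

Let f1 (n : nat) : C := zc a (2 * m + 1 + n).
(** Logarithm of prod (1 - q^n)^(2m+3) / prod (1 - q^(5n))^(10m+3). *)
Let ec (n : nat) : C := (- (INR (2 * m + 3)) * phic n + INR (10 * m + 3) * spr phic n)%C.
(** Modulus of the holomorphic function [pser f1] times exp of [pser ec], in the shape of
    [max_modulus_pser]. *)
Let AA (w : C) : R := Cmod (pser f1 w) * exp (Re (pser ec w)).

Lemma sturm_good_f1 : goodc f1.
Proof. apply (goodc_shift (zc a) (2 * m + 1)). now apply qexpansion_goodc with F. Qed.

Lemma sturm_good_ec : goodc ec.
Proof. apply goodc_plus; apply goodc_scal; [apply goodc_phic|apply goodc_spr, goodc_phic]. Qed.

(** The exponents of |q| add up to 2(2m+1) + (4m+6)/24 - 5(20m+6)/24 = 1. *)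
Lemma sturm_formula z : in_H z -> hh z = Cmod (qexp z) * AA (qexp z) ^ 2.
Proof.
  intros Hz. assert (P := PI_RGT_0). unfold hh, AA.
  rewrite (qexpansion_qs F a z Ha Hz). unfold qs. rewrite (pser_shift (zc a) (2 * m + 1)).
  2: now apply qexpansion_goodc with F. 2: now apply Cmod_qexp_lt1.
  2:{ intros n Hn. unfold zc. rewrite H0 by lia. reflexivity. }
  fold f1. rewrite Cmod_mult, Cmod_pow, !D2_formula, Im_five, Cmod_qexp.
  assert (E : Re (pser ec (qexp z)) = - INR (2 * m + 3) * Re (qs phic z) + INR (10 * m + 3) * Re (qs phic (5 * z)%C)).
  { change (pser ec (qexp z)) with (qs ec z). unfold ec.
    rewrite (qs_plus (fun n => - INR (2 * m + 3) * phic n)%C (fun n => INR (10 * m + 3) * spr phic n)%C);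
      auto using goodc_scal, goodc_spr, goodc_phic.
    rewrite !qs_scal, qs_spr by auto using goodc_spr, goodc_phic.
    rewrite <- RtoC_opp. set (X := qs phic z). set (Y := qs phic (5 * z)%C).
    rewrite <- (re_scal_l (- INR (2 * m + 3)) X), <- (re_scal_l (INR (10 * m + 3)) Y). reflexivity. }
  rewrite E. change (pser f1 (qexp z)) with (qs f1 z). set (f := Cmod (qs f1 z)).
  set (X := Re (qs phic z)). set (Y := Re (qs phic (5 * z)%C)). set (y := Im z).
  rewrite !Rpow_mult_distr, !pow_exp. unfold Rdiv. rewrite <- exp_Ropp.
  replace (exp (INR 2 * (INR (2 * m + 1) * - (2 * PI * y))) * f ^ 2 * exp (INR (2 * m + 3) * (- (PI * / 6 * y) - 2 * X)) *
     exp (- (INR (10 * m + 3) * (- (PI * / 6 * (5 * y)) - 2 * Y))))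
    with (f ^ 2 * (exp (INR 2 * (INR (2 * m + 1) * - (2 * PI * y))) * (exp (INR (2 * m + 3) * (- (PI * / 6 * y) - 2 * X)) *
     exp (- (INR (10 * m + 3) * (- (PI * / 6 * (5 * y)) - 2 * Y)))))) by ring.
  replace (exp (- (2 * PI * y)) * (f ^ 2 * exp (INR 2 * (- INR (2 * m + 3) * X + INR (10 * m + 3) * Y))))
    with (f ^ 2 * (exp (- (2 * PI * y)) * exp (INR 2 * (- INR (2 * m + 3) * X + INR (10 * m + 3) * Y)))) by ring.
  rewrite <- !exp_plus. f_equal. f_equal. rewrite !plus_INR, !mult_INR. simpl INR. field.
Qed.

Lemma sturm_invariant b1 b2 c d z : in_Gamma0_5 b1 b2 c d -> in_H z -> hh (moeb b1 b2 c d z) = hh z.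
Proof.
  intros G Hz. destruct HF as [_ [T _]]. unfold hh. rewrite T by auto.
  assert (GG := G). destruct GG as [S [c' Hc]]. rewrite jfac_jf.
  assert (N := jf_nz _ _ _ _ z S Hz). assert (PN := proj1 (Cmod_gt_0 _) N).
  rewrite D2_SL2 by auto. replace c with (5 * c')%Z in * by lia.
  destruct (five_moeb_div b1 b2 c' d z S Hz) as [S' [E1 E2]].
  rewrite E1, D2_SL2, E2 by auto using in_H_five. rewrite Cmod_mult, Cmod_pow.
  set (j := Cmod (jf (5 * c') d z)) in *. rewrite !Rpow_mult_distr, <- pow_mult.
  assert (P1 := D2_pos (5 * z)%C).
  (* The weight count: |cz+d| occurs to the same power in numerator and denominator. *)
  replace (10 * m + 3)%nat with (4 * m * 2 + (2 * m + 3))%nat by lia. rewrite !(pow_add j), !(pow_add (D2 _)).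
  field. repeat split; try apply pow_nonzero; lra.
Qed.

Lemma sturm_AA_bounded rho : 0 <= rho < 1 -> exists B, forall w, Cmod w <= rho -> AA w <= B.
Proof.
  intros Hr. destruct (pser_bounded f1 rho sturm_good_f1 Hr) as [B1 K1].
  destruct (pser_bounded ec rho sturm_good_ec Hr) as [B2 K2]. exists (B1 * exp B2). intros w Hw.
  unfold AA. apply Rmult_le_compat; auto using Cmod_ge_0; [apply Rlt_le, exp_pos|].
  assert (Re (pser ec w) <= B2).
  { eapply Rle_trans; [apply Rle_abs|]. eapply Rle_trans; [apply re_le_Cmod|]. auto. }
  destruct H as [H| ->]; [apply Rlt_le, exp_increasing, H|lra].
Qed.

Lemma hh_nonneg z : 0 <= hh z.
Proof.
  unfold hh. assert (P := D2_pos z). assert (P1 := D2_pos (5 * z)%C).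
  apply Rmult_le_pos; [apply Rmult_le_pos|]; [apply pow_le, Cmod_ge_0|apply pow_le; lra|].
  apply Rlt_le, Rinv_0_lt_compat, pow_lt; auto.
Qed.

(** On the circle |q| = rho one has AA^2 = hh/rho <= S/rho; the maximum principle carries this
    inside, and rho tends to 1. *)
Lemma sturm_schwarz S : (forall z, in_H z -> hh z <= S) -> forall z, in_H z -> hh z <= Cmod (qexp z) * S.
Proof.
  intros HS z Hz. rewrite sturm_formula by auto. apply Rmult_le_compat_l; [apply Cmod_ge_0|].
  assert (PS : 0 <= S) by (eapply Rle_trans; [apply (hh_nonneg z)|auto]).
  set (w := qexp z). assert (Hw := Cmod_qexp_lt1 z Hz). fold w in Hw.
  assert (Pw : 0 <= Cmod w) by apply Cmod_ge_0.
  assert (PA : forall u, 0 <= AA u) by (intros; apply Rmult_le_pos; [apply Cmod_ge_0|apply Rlt_le, exp_pos]).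
  assert (K : forall rho, Cmod w < rho -> 0 < rho < 1 -> AA w ^ 2 * rho <= S).
  { intros rho H1 H2.
    assert (M : AA w <= sqrt (S / rho)).
    { apply (max_modulus_pser f1 ec rho (sqrt (S / rho)) w sturm_good_f1 sturm_good_ec H2 H1). intros t.
      set (u := (rho * qexp (RtoC t))%C). fold (AA u).
      destruct (qexp_surj rho H2) as [v [Hv Ev]].
      assert (Hvt : in_H (v + RtoC t)%C) by (unfold in_H in *; destruct v; unfold Im in *; simpl in *; lra).
      assert (E : qexp (v + RtoC t)%C = u) by (rewrite qexp_plus, Ev; reflexivity).
      assert (B := HS _ Hvt). rewrite sturm_formula, E in B by auto.
      assert (Cu : Cmod u = rho).
      { unfold u. rewrite Cmod_mult, Cmod_R, Rabs_pos_eq, Cmod_qexp by lra. unfold Im, RtoC; simpl.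
        rewrite Rmult_0_r, Ropp_0, exp_0; ring. }
      rewrite Cu in B. rewrite <- (sqrt_pow2 (AA u)) by auto. apply sqrt_le_1_alt.
      apply Rmult_le_reg_l with rho; [lra|]. replace (rho * (S / rho)) with S by (field; lra). exact B. }
    assert (B : AA w ^ 2 <= sqrt (S / rho) ^ 2) by (apply pow_incr; auto).
    rewrite pow2_sqrt in B.
    - apply Rmult_le_compat_r with (r := rho) in B; [|lra]. replace (S / rho * rho) with S in B by (field; lra). exact B.
    - apply Rmult_le_pos; auto. apply Rlt_le, Rinv_0_lt_compat; lra. }
  set (X := AA w ^ 2) in *. assert (PX : 0 <= X) by (apply pow_le; auto).
  apply le_of_le_plus_inv with X.
  destruct (nfloor_ex (/ (1 - Cmod w))) as [N0 [_ HN0]]. { apply Rlt_le, Rinv_0_lt_compat; lra. }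
  exists N0. intros N HN. assert (Q := INR_S_ge1 N).
  assert (L : INR N0 + 1 <= INR (Datatypes.S N)) by (rewrite S_INR; apply le_INR in HN; lra).
  set (n := INR (Datatypes.S N)) in *.
  assert (I : / n < 1 - Cmod w).
  { rewrite <- (Rinv_inv (1 - Cmod w)). apply Rinv_lt_contravar; [|lra]. apply Rmult_lt_0_compat; [|lra].
    apply Rinv_0_lt_compat; lra. }
  assert (Pn : 0 < / n) by (apply Rinv_0_lt_compat; lra).
  assert (KK := K (1 - / n) ltac:(lra) ltac:(lra)). unfold Rdiv. lra.
Qed.

Lemma exp_le s t : s <= t -> exp s <= exp t.
Proof. intros [L| ->]; [apply Rlt_le, exp_increasing, L|lra]. Qed.

(** F contributes only its boundedness under S. The powers of |z| cancel by the weight, and the eta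
    quotient at z and z/5 supplies the decay exp(-2 pi y/5). *)
Lemma sturm_cusp eps : 0 < eps -> exists Y, forall z, Y < Im z -> hh (- / z)%C <= eps.
Proof.
  intros He. assert (PP := PI_RGT_0). destruct HF as [_ [_ B]].
  destruct (B 0%Z (-1)%Z 1%Z 0%Z eq_refl) as [Mb [Y0 KB]].
  destruct (qs_bounded phic (1/5) goodc_phic ltac:(lra)) as [c Kc].
  assert (Pc : 0 <= c).
  { eapply Rle_trans; [apply Cmod_ge_0|apply (Kc Ci)]. unfold Ci, Im; simpl; lra. }
  set (n1 := (2 * m + 3)%nat). set (n2 := (10 * m + 3)%nat).
  set (L := INR n1 * (2 * c) + INR n2 * (2 * c)).
  set (C0 := Mb ^ 2 * 5 ^ n2 * exp L).
  assert (PC : 0 <= C0).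
  { unfold C0. apply Rmult_le_pos; [apply Rmult_le_pos|]; [simpl; nra|apply pow_le; lra|apply Rlt_le, exp_pos]. }
  exists (Rmax (Rmax 1 Y0) (C0 / eps)). intros z HY.
  assert (y1 := Rle_lt_trans _ _ _ (Rmax_l _ _) HY). assert (y2 := Rle_lt_trans _ _ _ (Rmax_r _ _) HY).
  assert (y3 := Rle_lt_trans _ _ _ (Rmax_l _ _) y1). assert (y4 := Rle_lt_trans _ _ _ (Rmax_r _ _) y1).
  assert (Hz : in_H z) by (unfold in_H; lra). assert (Nz := in_H_nz z Hz). assert (Pz := proj1 (Cmod_gt_0 _) Nz).
  assert (E5 : (5 * - / z = - / (z / 5))%C) by (field; auto).
  assert (I5 : Im (z / 5)%C = Im z / 5).
  { replace (z / 5)%C with ((z + IZR 0) / 5)%C by (rewrite Cplus_0_r; reflexivity). apply Im_fifth. }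
  assert (Hz5 : in_H (z / 5)%C) by (unfold in_H; rewrite I5; lra).
  unfold hh. rewrite E5, !D2_S by auto. fold n1 n2.
  specialize (KB z y4). rewrite jfac_jf in KB.
  replace (moeb 0 (-1) 1 0 z) with (- / z)%C in KB by (unfold moeb; field; auto).
  replace (jf 1 0 z) with z in KB by (unfold jf; ring). rewrite Cmod_pow in KB.
  rewrite Cmod_div by (apply RtoC_neq0; lra). rewrite Cmod_R, (Rabs_pos_eq 5) by lra.
  rewrite !D2_formula, I5. set (x := Cmod z) in *.
  assert (K1 := Kc z ltac:(lra)). assert (K2 := Kc (z / 5)%C ltac:(rewrite I5; lra)).
  assert (R1 := re_le_Cmod (qs phic z)). assert (R2 := re_le_Cmod (qs phic (z / 5)%C)).
  set (X := Re (qs phic z)) in *. set (X5 := Re (qs phic (z / 5)%C)) in *. set (y := Im z) in *.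
  assert (BX : - c <= X <= c) by (apply Rabs_le_between; lra).
  assert (BX5 : - c <= X5 <= c) by (apply Rabs_le_between; lra).
  rewrite !Rpow_mult_distr. unfold Rdiv. rewrite !Rpow_mult_distr, !pow_exp, pow_inv.
  assert (FB : Cmod (F (- / z)%C) ^ 2 <= Mb ^ 2 * x ^ (4 * m * 2)).
  { rewrite pow_mult, <- Rpow_mult_distr. apply pow_incr. split; auto using Cmod_ge_0. }
  set (e1 := INR n1 * (- (PI * / 6 * y) - 2 * X)). set (e2 := INR n2 * (- (PI * / 6 * (y * / 5)) - 2 * X5)).
  assert (Ex : x ^ n2 = x ^ (4 * m * 2) * x ^ n1) by (rewrite <- pow_add; f_equal; unfold n1, n2; lia).
  assert (Px1 : 0 < x ^ (4 * m * 2)) by (apply pow_lt; auto). assert (Px2 : 0 < x ^ n1) by (apply pow_lt; auto).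
  assert (P5 : 0 < 5 ^ n2) by (apply pow_lt; lra).
  replace (Cmod (F (- / z)%C) ^ 2 * (x ^ n1 * exp e1) * / (x ^ n2 * / 5 ^ n2 * exp e2))
    with ((Cmod (F (- / z)%C) ^ 2 * / x ^ (4 * m * 2)) * (5 ^ n2 * (exp e1 * / exp e2))).
  2:{ rewrite Ex. assert (Q := exp_pos e2). field. repeat split; lra. }
  apply Rle_trans with (Mb ^ 2 * (5 ^ n2 * (exp L * exp (- y)))).
  - apply Rmult_le_compat.
    + apply Rmult_le_pos; [apply pow_le, Cmod_ge_0|apply Rlt_le, Rinv_0_lt_compat; auto].
    + apply Rmult_le_pos; [lra|]. apply Rmult_le_pos; apply Rlt_le; [apply exp_pos|apply Rinv_0_lt_compat, exp_pos].
    + apply Rmult_le_reg_r with (x ^ (4 * m * 2)); auto. rewrite Rmult_assoc, Rinv_l by lra. lra.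
    + apply Rmult_le_compat_l; [lra|]. rewrite <- exp_Ropp, <- !exp_plus. apply exp_le.
      unfold e1, e2, L.
      assert (Pn1 : 0 <= INR n1) by apply pos_INR. assert (Pn2 : 0 <= INR n2) by apply pos_INR.
      (* The exponents nearly cancel: n1 pi y/6 - n2 pi y/30 = 12 pi y/30, which is at least y. *)
      assert (En : INR n2 = 5 * INR n1 - 12).
      { unfold n1, n2. rewrite !plus_INR, !mult_INR. simpl INR. ring. }
      assert (Q1 : INR n1 * (- X) <= INR n1 * c) by (apply Rmult_le_compat_l; lra).
      assert (Q2 : INR n2 * X5 <= INR n2 * c) by (apply Rmult_le_compat_l; lra).
      assert (P3 := PI2_3_2). unfold PI2 in P3.
      assert (Q3 : INR n1 * (PI * / 6 * y) - INR n2 * (PI * / 6 * (y * / 5)) = PI * y * (2 / 5)).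
      { rewrite En. field. }
      assert (Q4 : y <= PI * y * (2/5)) by nra.
      lra.
  - replace (Mb ^ 2 * (5 ^ n2 * (exp L * exp (- y)))) with (C0 * exp (- y)) by (unfold C0; ring).
    assert (A := exp_ineq1_le y). rewrite exp_Ropp.
    assert (Pe := exp_pos y). apply Rmult_le_reg_r with (exp y); auto. rewrite Rmult_assoc, Rinv_l, Rmult_1_r by lra.
    apply Rmult_lt_compat_r with (r := eps) in y2; auto. replace (C0 / eps * eps) with C0 in y2 by (field; lra). nra.
Qed.

Theorem sturm_vanish z : in_H z -> F z = RtoC 0.
Proof.
  (* A value of hh is attained at a point with Im z >= d unless it is close to its limit 0 at the cusp 0;
     the Schwarz lemma then makes the supremum S satisfy S <= r S with r < 1. *)
  assert (PP := PI_RGT_0).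
  assert (CASE : forall eps, 0 < eps -> exists d, 0 < d /\ forall z, in_H z ->
      hh z <= eps \/ exists w, d <= Im w /\ hh z = hh w).
  { intros eps He. destruct (sturm_cusp eps He) as [Y KY]. set (Y' := Rmax Y 1).
    assert (PY : 1 <= Y') by apply Rmax_r.
    assert (Pd : 0 < 1/2 / (25 + Y' * Y')) by (apply Rdiv_lt_0_compat; nra).
    (* The second value bounds Im(-1/z') = Im z'/|z'|^2 from below for |Re z'| <= 5 and 1/2 <= Im z'
       <= Y'. *)
    exists (Rmin (1/2) (1/2 / (25 + Y' * Y'))). split; [apply Rmin_glb_lt; lra|].
    intros w Hw. destruct (reduction_G05 w Hw) as [b1 [b2 [c [d [z' [G [Hz' [L1 [L2 [E|E]]]]]]]]]].
    - right. exists z'. split; [eapply Rle_trans; [apply Rmin_l|auto]|]. rewrite E. now apply sturm_invariant.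
    - assert (HS := in_H_Sneg z' Hz').
      assert (EH : hh w = hh (- / z')%C) by (rewrite E; now apply sturm_invariant).
      destruct (Rle_dec (Im z') Y') as [L|L].
      + right. exists (- / z')%C. split; auto. eapply Rle_trans; [apply Rmin_r|].
        unfold in_H in Hz'.
        assert (Ei : Im (- / z')%C = Im z' / (Re z' * Re z' + Im z' * Im z')).
        { destruct z' as [x y]. unfold Re, Im in *; simpl in *. field. nra. }
        rewrite Ei. apply Rabs_le_between in L2.
        apply Rmult_le_compat; [lra|apply Rlt_le, Rinv_0_lt_compat; nra|lra|].
        apply Rinv_le_contravar; nra.
      + left. rewrite EH. apply KY. apply Rle_lt_trans with Y'; [apply Rmax_l|lra]. }
  assert (BD : exists S, forall z, in_H z -> hh z <= S).
  { destruct (CASE 1 Rlt_0_1) as [d [Pd K]].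
    destruct (sturm_AA_bounded _ (exp_lt1 d Pd)) as [B HB]. exists (Rmax 1 (1 * B ^ 2)). intros w Hw.
    destruct (K w Hw) as [L|[v [Hv E]]]; [eapply Rle_trans; [exact L|apply Rmax_l]|].
    eapply Rle_trans; [|apply Rmax_r].
    assert (HHv : in_H v) by (unfold in_H; lra). rewrite E, sturm_formula by auto.
    apply Rmult_le_compat; [apply Cmod_ge_0|apply pow_le|apply Rlt_le, Cmod_qexp_lt1; auto|].
    - apply Rmult_le_pos; [apply Cmod_ge_0|apply Rlt_le, exp_pos].
    - apply pow_incr. split; [apply Rmult_le_pos; [apply Cmod_ge_0|apply Rlt_le, exp_pos]|].
      apply HB. now apply Cmod_qexp_le. }
  destruct BD as [S0 HS0].
  assert (HC : in_H Ci) by (unfold in_H, Ci, Im; simpl; lra).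
  destruct (completeness (fun r => exists z, in_H z /\ r = hh z)) as [S [Ub Lub]].
  { exists S0. intros r [w [Hw ->]]. auto. }
  { exists (hh Ci), Ci. auto. }
  assert (HS : forall z, in_H z -> hh z <= S) by (intros w Hw; apply Ub; exists w; auto).
  assert (PS : 0 <= S) by (eapply Rle_trans; [apply (hh_nonneg Ci)|auto]).
  assert (S = 0).
  { destruct PS as [PS|]; [|auto]. exfalso.
    destruct (CASE (S / 2) ltac:(lra)) as [d [Pd K]].
    set (r := Rmax (1/2) (exp (- (2 * PI * d)))).
    assert (Hr : 1/2 <= r < 1).
    { unfold r. split; [apply Rmax_l|]. apply Rmax_lub_lt; [lra|apply exp_lt1; auto]. }
    assert (U : S <= r * S); [|nra].
    apply Lub. intros x [w [Hw ->]]. destruct (K w Hw) as [L|[v [Hv E]]]; [nra|].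
    assert (HHv : in_H v) by (unfold in_H; lra). rewrite E.
    eapply Rle_trans; [apply sturm_schwarz; eauto|]. apply Rmult_le_compat_r; [lra|].
    eapply Rle_trans; [apply Cmod_qexp_le, Hv|apply Rmax_r]. }
  intros Hz. subst S. specialize (HS z Hz). assert (P := hh_nonneg z). assert (E : hh z = 0) by lra.
  unfold hh in E. assert (P1 := D2_pos z). assert (P2 := D2_pos (5 * z)%C).
  assert (Q1 : 0 < D2 z ^ (2 * m + 3)) by (now apply pow_lt).
  assert (Q2 : 0 < / D2 (5 * z)%C ^ (10 * m + 3)) by (now apply Rinv_0_lt_compat, pow_lt).
  apply Cmod_eq_0. unfold Rdiv in E.
  apply Rmult_integral in E. destruct E as [E|E]; [|lra].
  apply Rmult_integral in E. destruct E as [E|E]; [|lra].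
  simpl in E. apply Rmult_integral in E. destruct E as [E|E]; [exact E|lra].
Qed.

End Sturm.

Theorem sturm m F a : modular_form_G05 (4 * m) F -> has_qexpansion F a ->
  (forall n, (n <= 2 * m)%nat -> a n = 0%Z) -> forall n, a n = 0%Z.
Proof.
  intros HF Ha H0. apply qexpansion_zero; [now apply qexpansion_goodc with F|].
  intros z Hz. rewrite <- (qexpansion_qs F a z Ha Hz). now apply (sturm_vanish m F a).
Qed.

(** * Reduction modulo 2 *)

Fixpoint bsum (u : nat -> bool) (n : nat) : bool :=
  match n with O => false | S p => xorb (bsum u p) (u p) end.

Lemma xsum_bsum n g : xsum n g = bsum g (S n).
Proof. induction n; [simpl; destruct (g O); reflexivity|]. simpl in *. now rewrite IHn. Qed.

Lemma bsum_S u n : bsum u (S n) = xorb (bsum u n) (u n).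
Proof. reflexivity. Qed.

Lemma bsum_ext u v n : (forall k, (k < n)%nat -> u k = v k) -> bsum u n = bsum v n.
Proof. induction n; intros H; simpl; auto. rewrite IHn, H; auto. Qed.

Lemma bsum_false u n : (forall k, (k < n)%nat -> u k = false) -> bsum u n = false.
Proof. induction n; intros H; simpl; auto. rewrite IHn, H; auto. Qed.

Lemma xorb_swap a b c d : xorb (xorb a b) (xorb c d) = xorb (xorb a c) (xorb b d).
Proof. destruct a, b, c, d; reflexivity. Qed.

Lemma bsum_xor u v n : bsum (fun k => xorb (u k) (v k)) n = xorb (bsum u n) (bsum v n).
Proof. induction n; simpl; auto. rewrite IHn. apply xorb_swap. Qed.

Lemma bsum_and c u n : bsum (fun k => andb c (u k)) n = andb c (bsum u n).
Proof. induction n; simpl. now rewrite andb_false_r. rewrite IHn. destruct c, (bsum u n), (u n); reflexivity. Qed.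

Lemma bsum_Sl u n : bsum u (S n) = xorb (u O) (bsum (fun k => u (S k)) n).
Proof.
  induction n. simpl. destruct (u O); reflexivity.
  change (bsum u (S (S n))) with (xorb (bsum u (S n)) (u (S n))). rewrite IHn, xorb_assoc. reflexivity.
Qed.

Lemma bsum_single u n j : (forall k, (k < n)%nat -> k <> j -> u k = false) ->
  bsum u n = if (j <? n)%nat then u j else false.
Proof.
  induction n; intros H; [reflexivity|]. simpl bsum. rewrite IHn by auto.
  destruct (Nat.eq_dec n j) as [->|N].
  - replace (j <? j)%nat with false by (symmetry; apply Nat.ltb_ge; lia).
    replace (j <? S j)%nat with true by (symmetry; apply Nat.ltb_lt; lia). apply xorb_false_l.
  - rewrite (H n) by auto. rewrite xorb_false_r.
    destruct (Nat.ltb_spec j n), (Nat.ltb_spec j (S n)); auto; lia.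
Qed.

(** Modulo 2 the entries off the diagonal cancel in pairs. Both the parity of sigma and the
    Frobenius identity for squares follow from this. *)
Lemma bsum_symmetric (g : nat -> nat -> bool) n : (forall i j, g i j = g j i) ->
  bsum (fun i => bsum (fun j => g i j) n) n = bsum (fun i => g i i) n.
Proof.
  intros S. induction n; [reflexivity|].
  simpl bsum at 1. 
  rewrite (bsum_ext (fun i => xorb (bsum (fun j => g i j) n) (g i n)) (fun i => xorb (bsum (g i) n) (g n i))).
  - rewrite bsum_xor. simpl. rewrite <- IHn.
    replace (bsum (g n) n) with (bsum (fun j => g n j) n) by reflexivity.
    set (X := bsum (fun i => bsum (fun j => g i j) n) n). change (bsum (fun k => bsum (g k) n) n) with X.
    set (Y := bsum (fun j => g n j) n). destruct X, Y, (g n n); reflexivity.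
  - intros k _. now rewrite (S k n).
Qed.

(* At most one k contributes, so this decides whether N = c k^2 with k >= 1. *)
Definition csq (c N : nat) : bool := bsum (fun k => (c * (S k * S k) =? N)%nat) N.

Lemma csq_true c N : (0 < c)%nat -> (csq c N = true <-> exists k, (0 < k)%nat /\ (c * (k * k) = N)%nat).
Proof.
  intros Hc. unfold csq. split.
  - intros H.
    assert (D : (exists k, (k < N)%nat /\ (c * (S k * S k) =? N)%nat = true) \/ forall k, (k < N)%nat -> (c * (S k * S k) =? N)%nat = false).
    { clear. generalize N at 1 3. intros n. induction n as [|n [[k [H1 H2]]|IH]].
      - right; intros; lia.
      - left; exists k; split; auto.
      - destruct (c * (S n * S n) =? N)%nat eqn:E.
        + left; exists n; split; auto.
        + right. intros k Hk. destruct (Nat.eq_dec k n) as [->|]; auto. apply IH; lia. }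
    destruct D as [[k [_ E]]|E].
    + exists (S k). split; [lia|]. now apply Nat.eqb_eq.
    + rewrite bsum_false in H by auto. discriminate.
  - intros [k [Hk E]]. rewrite (bsum_single _ N (k - 1)).
    + replace (k - 1 <? N)%nat with true by (symmetry; apply Nat.ltb_lt; nia).
      replace (S (k - 1)) with k by lia. now apply Nat.eqb_eq.
    + intros j _ Hj. apply Nat.eqb_neq. intros E'. apply Hj. assert (S j * S j = k * k)%nat by nia. nia.
Qed.

Lemma bool_iff (a b : bool) : (a = true <-> b = true) -> a = b.
Proof. destruct a, b; intuition. Qed.

Lemma csq_even_odd c N : (0 < c)%nat -> Nat.odd c = true -> csq c (2 * N) = csq (2 * c) N.
Proof.
  intros Hc Ho. apply bool_iff. rewrite !csq_true by lia. split.
  - intros [k [Hk E]].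
    assert (Ev : Nat.odd k = false).
    { destruct (Nat.odd k) eqn:Q; auto. assert (O : Nat.odd (c * (k * k)) = true) by (rewrite !Nat.odd_mul, Ho, Q; auto).
      rewrite E, Nat.odd_mul in O. discriminate. }
    apply (f_equal negb) in Ev. rewrite Nat.negb_odd in Ev. apply Nat.even_spec in Ev. destruct Ev as [j Hj].
    exists j. subst k. split; [lia|nia].
  - intros [k [Hk E]]. exists (2 * k)%nat. split; [lia|nia].
Qed.

Lemma csq_even_even c N : (0 < c)%nat -> csq (2 * c) (2 * N) = csq c N.
Proof.
  intros Hc. apply bool_iff. rewrite !csq_true by lia. split; intros [k [Hk E]]; exists k; split; auto; nia.
Qed.

Lemma csq_five c N : (0 < c)%nat -> csq (5 * c) N = if (N mod 5 =? 0)%nat then csq c (N / 5) else false.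
Proof.
  intros Hc. apply bool_iff. rewrite csq_true by lia. split.
  - intros [k [Hk E]]. assert (M : N = (c * (k * k) * 5)%nat) by nia. rewrite M, Nat.Div0.mod_mul, Nat.div_mul by lia.
    simpl (0 =? 0)%nat. cbv iota. apply csq_true; auto. exists k; auto.
  - destruct (Nat.eqb_spec (N mod 5) 0) as [E|E]; [|discriminate]. intros H. apply csq_true in H; auto.
    destruct H as [k [Hk H]]. exists k. split; auto. assert (D := Nat.div_mod_eq N 5). nia.
Qed.

Lemma r_csq N : r N = xorb (xorb (csq 1 N) (csq 2 N)) (xorb (csq 5 N) (csq 10 N)).
Proof.
  unfold r. rewrite xsum_bsum, bsum_Sl. simpl (0 =? 0)%nat. cbv iota. rewrite xorb_false_l.
  unfold csq. rewrite <- !bsum_xor. apply bsum_ext. intros k _. simpl (S k =? 0)%nat. cbv iota.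
  rewrite (Nat.eqb_sym N (S k * S k)), (Nat.eqb_sym N (2 * _)), (Nat.eqb_sym N (5 * _)), (Nat.eqb_sym N (10 * _)), Nat.mul_1_l.
  reflexivity.
Qed.

(** Doubling exchanges squares with doubled squares, and likewise the families of 5 and 10. As
    squaring substitutes x^2 for x, this makes r^2 + r odd. *)
Lemma r_double N : r (2 * N)%nat = r N.
Proof.
  rewrite !r_csq. rewrite (csq_even_odd 1), (csq_even_odd 5) by (auto; lia).
  assert (E2 : csq 2 (2 * N) = csq 1 N) by (apply (csq_even_even 1); lia).
  assert (E10 : csq 10 (2 * N) = csq 5 N) by (apply (csq_even_even 5); lia).
  rewrite E2, E10. change (2 * 1)%nat with 2%nat. change (2 * 5)%nat with 10%nat.
  destruct (csq 1 N), (csq 2 N), (csq 5 N), (csq 10 N); reflexivity.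
Qed.

Lemma odd_nsum u n : Nat.odd (nsum u n) = bsum (fun k => Nat.odd (u k)) n.
Proof. induction n; simpl; auto. now rewrite Nat.odd_add, IHn. Qed.

Lemma bsum_pairs u n : bsum u (2 * n) = bsum (fun k => xorb (u (2 * k)%nat) (u (2 * k + 1)%nat)) n.
Proof.
  induction n; [reflexivity|]. replace (2 * S n)%nat with (S (S (2 * n))) by lia.
  rewrite !bsum_S, IHn, xorb_assoc. replace (2 * n + 1)%nat with (S (2 * n)) by lia. reflexivity.
Qed.

(** An odd codivisor m of 2N adds the even number 2N/m; an even one, 2m', adds N/m'. *)
Lemma odd_sigma_double N : Nat.odd (sigma1 (2 * N)%nat) = Nat.odd (sigma1 N).
Proof.
  unfold sigma1. rewrite !odd_nsum, bsum_pairs. apply bsum_ext. intros k Hk.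
  assert (E1 : Nat.odd (ediv (S (2 * k)) (2 * N)) = false).
  { unfold ediv. destruct (Nat.eqb_spec ((2 * N) mod S (2 * k)) 0) as [E|E]; [|reflexivity].
    assert (D := Nat.div_mod_eq (2 * N) (S (2 * k))). rewrite E in D. set (q := (2 * N / S (2 * k))%nat) in *.
    destruct (Nat.odd q) eqn:Q; auto.
    assert (O : Nat.odd (2 * N) = true).
    { rewrite D, Nat.add_0_r, Nat.odd_mul, Q, Nat.odd_succ, Nat.even_mul. reflexivity. }
    rewrite Nat.odd_mul in O. discriminate. }
  rewrite E1, xorb_false_l. f_equal. unfold ediv. replace (S (2 * k + 1)) with (2 * S k)%nat by lia.
  rewrite Nat.Div0.mul_mod_distr_l, Nat.Div0.div_mul_cancel_l by lia.
  destruct (Nat.eqb_spec (2 * (N mod S k)) 0), (Nat.eqb_spec (N mod S k) 0); auto; lia.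
Qed.

(* The divisor pairs (m, k) with m k = N cancel modulo 2 except when m = k. *)
Lemma odd_sigma_odd N : Nat.odd N = true -> Nat.odd (sigma1 N) = csq 1 N.
Proof.
  intros HN. unfold sigma1. rewrite odd_nsum.
  rewrite (bsum_ext _ (fun m => bsum (fun k => (S m * S k =? N)%nat) N)).
  - rewrite bsum_symmetric by (intros; now rewrite Nat.mul_comm).
    unfold csq. apply bsum_ext. intros; now rewrite Nat.mul_1_l.
  - intros m Hm. unfold ediv. assert (D := Nat.div_mod_eq N (S m)). set (q := (N / S m)%nat) in *.
    destruct (Nat.eqb_spec (N mod S m) 0) as [E|E].
    + rewrite E, Nat.add_0_r in D.
      assert (Q : Nat.odd q = true). { rewrite D, Nat.odd_mul in HN. now apply andb_prop in HN. }
      assert (q0 : (0 < q)%nat) by (destruct q; [discriminate|lia]).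
      rewrite Q. rewrite (bsum_single _ N (q - 1)).
      * replace (q - 1 <? N)%nat with true by (symmetry; apply Nat.ltb_lt; nia).
        replace (S (q - 1)) with q by lia. symmetry. apply Nat.eqb_eq. auto.
      * intros k _ Hk. apply Nat.eqb_neq. intros E'. apply Hk. assert (S k = q) by nia. lia.
    + symmetry. apply bsum_false. intros k _. apply Nat.eqb_neq. intros E'. apply E.
      rewrite <- E', Nat.mul_comm. apply Nat.Div0.mod_mul.
Qed.

Lemma odd_sigma N : Nat.odd (sigma1 N) = xorb (csq 1 N) (csq 2 N).
Proof.
  induction N as [N IH] using (well_founded_induction lt_wf).
  destruct (Nat.Even_or_Odd N) as [[n Hn]|Ho].
  - destruct n as [|n]; [subst; reflexivity|]. rewrite Hn, odd_sigma_double, IH by lia.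
    rewrite (csq_even_odd 1) by (auto; lia). assert (E2 : csq 2 (2 * S n) = csq 1 (S n)) by (apply (csq_even_even 1); lia).
    rewrite E2. apply xorb_comm.
  - apply Nat.odd_spec in Ho. rewrite odd_sigma_odd by auto.
    replace (csq 2 N) with false; [now rewrite xorb_false_r|].
    destruct (csq 2 N) eqn:E; auto. apply csq_true in E; [|lia]. destruct E as [k [_ E]].
    rewrite <- E, Nat.odd_mul in Ho. discriminate.
Qed.

(** * Integral coefficients of the forms and their parity *)

Definition sgz (n : nat) : Z := Z.of_nat (sigma1 n).
Definition nsgz (n : nat) : Z := (Z.of_nat n * sgz n)%Z.
Definition sprz (a : nat -> Z) (n : nat) : Z := if (n mod 5 =? 0)%nat then a (n / 5)%nat else 0%Z.

Lemma odd_of_nat n : Z.odd (Z.of_nat n) = Nat.odd n.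
Proof.
  induction n; [reflexivity|]. rewrite Nat2Z.inj_succ, Z.odd_succ, Nat.odd_succ.
  rewrite <- Z.negb_odd, <- Nat.negb_odd, IHn. reflexivity.
Qed.

Lemma r_sigma N : r N = xorb (Z.odd (sgz N)) (Z.odd (sprz sgz N)).
Proof.
  rewrite r_csq. unfold sprz, sgz. rewrite odd_of_nat, odd_sigma. f_equal.
  rewrite (csq_five 1), (csq_five 2) by lia.
  destruct (N mod 5 =? 0)%nat; [|reflexivity]. now rewrite odd_of_nat, odd_sigma.
Qed.

Lemma zc_sprz a n : zc (sprz a) n = spr (zc a) n.
Proof. unfold zc, sprz, spr. destruct (n mod 5 =? 0)%nat; reflexivity. Qed.

Lemma zc_sgz n : zc sgz n = sigc n.
Proof. unfold zc, sgz, sigc. now rewrite <- INR_IZR_INZ. Qed.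

Lemma zc_nsgz n : zc nsgz n = (INR n * sigc n)%C.
Proof. unfold zc, nsgz. rewrite mult_IZR, RtoC_mult, <- INR_IZR_INZ. f_equal. apply zc_sgz. Qed.

Definition tsig (n : nat) : C := (INR n * sigc n)%C.

Lemma goodc_tsig : goodc tsig.
Proof. apply goodc_INR, goodc_sigc. Qed.

Lemma qs_ext a b z : (forall n, a n = b n) -> qs a z = qs b z.
Proof. intros E. unfold qs, pser. apply CS_ext. intros; now rewrite E. Qed.

Lemma qx_qs c a : goodc c -> (forall n, zc a n = c n) -> has_qexpansion (qs c) a.
Proof.
  intros G E. apply qexpansion_intro.
  - now apply goodc_ext with c.
  - intros z _. apply qs_ext. auto.
Qed.

Lemma qx_qs_five c a : goodc c -> (forall n, zc a n = c n) -> has_qexpansion (fun z => qs c (5 * z)%C) (sprz a).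
Proof.
  intros G E. apply qexpansion_intro.
  - apply goodc_ext with (spr c); [|now apply goodc_spr]. intros n. rewrite zc_sprz. unfold spr. now rewrite E.
  - intros z Hz. rewrite <- qs_spr by auto. apply qs_ext. intros n. rewrite zc_sprz. unfold spr. now rewrite E.
Qed.

Definition onez (n : nat) : Z := if (n =? 0)%nat then 1%Z else 0%Z.

Lemma qx_one : has_qexpansion (fun _ => RtoC 1) onez.
Proof.
  intros z _. apply is_series_cser. unfold cser.
  apply clim_ext_ev with (fun _ => RtoC 1); [|apply clim_const]. exists 1%nat. intros n Hn.
  destruct n; [lia|]. rewrite csum_Sl, csum_0.
  - unfold onez; simpl; ring.
  - intros k _. unfold onez. simpl. ring.
Qed.

(* Coefficients of the forms, read off from E4 = P^2 - 12 theta P with P = 1 - 24 sum sigma(n) q^n. *)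
Definition aE4 (n : nat) : Z := (onez n + -48 * sgz n + (576 * zconv sgz sgz n + 288 * nsgz n))%Z.
Definition aF1 (n : nat) : Z :=
  (-1 * sgz n + sprz sgz n + (12 * (zconv sgz sgz n + -1 * zconv (sprz sgz) (sprz sgz) n) + 6 * (nsgz n + -1 * sprz nsgz n)))%Z.
(** Coefficients of (E2 - 1)/6. In E2^2 they enter with 36 times their square, which explains the
    division by 36 in [F2] and makes this square its only odd part. *)
Definition aS (n : nat) : Z := (sgz n + -5 * sprz sgz n)%Z.
Definition aF2 (n : nat) : Z :=
  (2 * (nsgz n + -1 * sgz n) + (2 * sprz sgz n + 38 * sprz nsgz n) +
   (4 * zconv sgz sgz n + 76 * zconv (sprz sgz) (sprz sgz) n + -5 * zconv aS aS n))%Z.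

Lemma qx_sg : has_qexpansion (qs sigc) sgz.
Proof. apply qx_qs; auto using goodc_sigc, zc_sgz. Qed.
Lemma qx_nsg : has_qexpansion (qs tsig) nsgz.
Proof. apply qx_qs; auto using goodc_tsig, zc_nsgz. Qed.
Lemma qx_sg5 : has_qexpansion (fun z => qs sigc (5 * z)%C) (sprz sgz).
Proof. apply qx_qs_five; auto using goodc_sigc, zc_sgz. Qed.
Lemma qx_nsg5 : has_qexpansion (fun z => qs tsig (5 * z)%C) (sprz nsgz).
Proof. apply qx_qs_five; auto using goodc_tsig, zc_nsgz. Qed.

Lemma E4_expand z : E4 z = (1 - 48 * qs sigc z + 576 * (qs sigc z * qs sigc z) + 288 * qs tsig z)%C.
Proof. unfold E4, P2, TP. fold tsig. ring. Qed.

Lemma qx_E4 : has_qexpansion E4 aE4.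
Proof.
  apply (fun H1 H2 => qx_ext _ _ _ _ H1 H2
    (qx_plus _ _ _ _ (qx_plus _ _ _ _ qx_one (qx_scal _ _ (-48)%Z qx_sg)) (qx_plus _ _ _ _ (qx_scal _ _ (576)%Z (qx_mult _ _ _ _ qx_sg qx_sg)) (qx_scal _ _ (288)%Z qx_nsg)))).
  - intros z _. rewrite E4_expand. cbv beta. ring.
  - intros n. reflexivity.
Qed.

Lemma qx_F1 : has_qexpansion F1 aF1.
Proof.
  apply (fun H1 H2 => qx_ext _ _ _ _ H1 H2
    (qx_plus _ _ _ _ (qx_plus _ _ _ _ (qx_scal _ _ (-1)%Z qx_sg) qx_sg5) (qx_plus _ _ _ _ (qx_scal _ _ (12)%Z (qx_plus _ _ _ _ (qx_mult _ _ _ _ qx_sg qx_sg) (qx_scal _ _ (-1)%Z (qx_mult _ _ _ _ qx_sg5 qx_sg5)))) (qx_scal _ _ (6)%Z (qx_plus _ _ _ _ qx_nsg (qx_scal _ _ (-1)%Z qx_nsg5)))))).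
  - intros z _. unfold F1. rewrite !E4_expand. cbv beta. field.
  - intros n. reflexivity.
Qed.

Lemma qx_F2 : has_qexpansion F2 aF2.
Proof.
  assert (QS : has_qexpansion (fun z => qs sigc z + IZR (-5) * qs sigc (5 * z))%C aS).
  { exact (qx_plus _ _ _ _ qx_sg (qx_scal _ _ (-5)%Z qx_sg5)). }
  apply (fun H1 H2 => qx_ext _ _ _ _ H1 H2
    (qx_plus _ _ _ _ (qx_plus _ _ _ _ (qx_scal _ _ (2)%Z (qx_plus _ _ _ _ qx_nsg (qx_scal _ _ (-1)%Z qx_sg))) (qx_plus _ _ _ _ (qx_scal _ _ (2)%Z qx_sg5) (qx_scal _ _ (38)%Z qx_nsg5))) (qx_plus _ _ _ _ (qx_plus _ _ _ _ (qx_scal _ _ (4)%Z (qx_mult _ _ _ _ qx_sg qx_sg)) (qx_scal _ _ (76)%Z (qx_mult _ _ _ _ qx_sg5 qx_sg5))) (qx_scal _ _ (-5)%Z (qx_mult _ _ _ _ QS QS))))).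
  - intros z _. unfold F2, F1, E2, P2. rewrite !E4_expand. cbv beta. field.
  - intros n. reflexivity.
Qed.

Lemma odd_zsum u n : Z.odd (zsum u n) = bsum (fun k => Z.odd (u k)) n.
Proof. induction n; simpl; auto. now rewrite Z.odd_add, IHn. Qed.

Definition red (a : nat -> Z) : ps := fun n => Z.odd (a n).

Lemma red_zconv a b : red (zconv a b) = ps_mul (red a) (red b).
Proof.
  apply functional_extensionality. intros n. unfold red, zconv, ps_mul.
  rewrite odd_zsum, xsum_bsum. apply bsum_ext. intros. apply Z.odd_mul.
Qed.

Lemma red_E4 : red aE4 = ps_one.
Proof.
  apply functional_extensionality. intros n. unfold red, aE4, ps_one, onez.
  rewrite !Z.odd_add, !Z.odd_mul. simpl. rewrite !xorb_false_r. destruct (n =? 0)%nat; reflexivity.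
Qed.

Lemma red_F1 : red aF1 = r.
Proof.
  apply functional_extensionality. intros n. unfold red, aF1. rewrite r_sigma.
  rewrite !Z.odd_add, (Z.odd_mul 12), (Z.odd_mul 6), (Z.odd_mul (-1) (sgz n)). simpl. now rewrite !xorb_false_r.
Qed.

Lemma red_aS : red aS = r.
Proof.
  apply functional_extensionality. intros n. unfold red, aS. rewrite r_sigma, Z.odd_add, Z.odd_mul. reflexivity.
Qed.

Lemma red_F2 : red aF2 = ps_mul r r.
Proof.
  rewrite <- red_aS, <- red_zconv. apply functional_extensionality. intros n. unfold red, aF2.
  rewrite !Z.odd_add, (Z.odd_mul 2 (_ + _)), (Z.odd_mul 2 (sprz _ _)), (Z.odd_mul 38), (Z.odd_mul 4), (Z.odd_mul 76), (Z.odd_mul (-5)).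
  reflexivity.
Qed.

Lemma aF1_0 : aF1 0 = 0%Z.
Proof. reflexivity. Qed.

Lemma aF2_01 n : (n < 2)%nat -> aF2 n = 0%Z.
Proof. intros H. destruct n as [|[|n]]; [reflexivity|reflexivity|lia]. Qed.

(** * The ring Z/2[[x]] *)

Lemma bsum_triangle (f : nat -> nat -> nat -> bool) n :
  bsum (fun j => bsum (fun i => f i (j - i)%nat (n - j)%nat) (S j)) (S n) =
  bsum (fun i => bsum (fun k => f i k (n - i - k)%nat) (S (n - i))) (S n).
Proof.
  revert f. induction n as [|n IH]; intros f; [reflexivity|].
  (* Both sides run over i + k + l = n + 1; the layer i = 0 is split off and the rest is the
     induction hypothesis for f shifted in i. *)
  rewrite (bsum_ext _ (fun j => xorb (f O j (S n - j)%nat) (bsum (fun i => f (S i) (j - S i)%nat (S n - j)%nat) j))).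
  2:{ intros j _. rewrite bsum_Sl. now rewrite Nat.sub_0_r. }
  rewrite bsum_xor.
  rewrite (bsum_Sl (fun j => bsum (fun i => f (S i) (j - S i)%nat (S n - j)%nat) j) (S n)).
  change (bsum _ 0) with false. rewrite xorb_false_l.
  rewrite (bsum_Sl (fun i => bsum (fun k => f i k (S n - i - k)%nat) (S (S n - i))) (S n)).
  f_equal. apply (IH (fun i => f (S i))).
Qed.

Lemma ps_mul_assoc f g h : ps_mul (ps_mul f g) h = ps_mul f (ps_mul g h).
Proof.
  apply functional_extensionality. intros n. unfold ps_mul. rewrite !xsum_bsum.
  rewrite (bsum_ext _ (fun j => bsum (fun i => f i && g (j - i)%nat && h (n - j)%nat) (S j))).
  - rewrite (bsum_triangle (fun i k l => f i && g k && h l)). apply bsum_ext. intros i _.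
    rewrite xsum_bsum, <- bsum_and. apply bsum_ext. intros k _. now rewrite andb_assoc.
  - intros j _. rewrite xsum_bsum. rewrite andb_comm, <- bsum_and. apply bsum_ext. intros i _. apply andb_comm.
Qed.

Lemma ps_mul_add_r f g h : ps_mul f (ps_add g h) = ps_add (ps_mul f g) (ps_mul f h).
Proof.
  apply functional_extensionality. intros n. unfold ps_add, ps_mul. rewrite !xsum_bsum, <- bsum_xor.
  apply bsum_ext. intros k _. destruct (f k); auto.
Qed.

Lemma ps_mul_1_l f : ps_mul ps_one f = f.
Proof.
  apply functional_extensionality. intros n. unfold ps_mul. rewrite xsum_bsum, (bsum_single _ _ 0).
  - simpl. now rewrite Nat.sub_0_r.
  - intros k _ Hk. unfold ps_one. apply Nat.eqb_neq in Hk. now rewrite Hk.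
Qed.

Lemma ps_mul_1_r f : ps_mul f ps_one = f.
Proof.
  apply functional_extensionality. intros n. unfold ps_mul. rewrite xsum_bsum, (bsum_single _ _ n).
  - replace (n <? S n)%nat with true by (symmetry; apply Nat.ltb_lt; lia). rewrite Nat.sub_diag. simpl. apply andb_true_r.
  - intros k Hk Nk. unfold ps_one. replace (n - k =? 0)%nat with false by (symmetry; apply Nat.eqb_neq; lia). apply andb_false_r.
Qed.

Lemma ps_pow_S f i : ps_pow f (S i) = ps_mul (ps_pow f i) f.
Proof. reflexivity. Qed.

Lemma ps_pow_add f i j : ps_pow f (i + j) = ps_mul (ps_pow f i) (ps_pow f j).
Proof.
  induction j; [rewrite Nat.add_0_r; simpl; now rewrite ps_mul_1_r|].
  rewrite Nat.add_succ_r, !ps_pow_S, IHj, ps_mul_assoc. reflexivity.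
Qed.

(* f(x)^2 = f(x^2) *)
Lemma ps_sqr f n : ps_mul f f n = if Nat.even n then f (n / 2)%nat else false.
Proof.
  unfold ps_mul. rewrite xsum_bsum.
  rewrite (bsum_ext _ (fun i => bsum (fun j => (i + j =? n)%nat && (f i && f j)) (S n))).
  - rewrite bsum_symmetric by (intros i j; rewrite Nat.add_comm, (andb_comm (f i)); reflexivity).
    rewrite (bsum_single _ _ (n / 2)).
    + assert (D := Nat.div_mod_eq n 2). assert (M := Nat.mod_upper_bound n 2 ltac:(lia)).
      replace (n / 2 <? S n)%nat with true by (symmetry; apply Nat.ltb_lt; lia). rewrite andb_diag.
      destruct (Nat.even n) eqn:E.
      * apply Nat.even_spec in E. destruct E as [k Hk].
        replace (n / 2 + n / 2 =? n)%nat with true by (symmetry; apply Nat.eqb_eq; lia). reflexivity.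
      * replace (n / 2 + n / 2 =? n)%nat with false; [reflexivity|]. symmetry. apply Nat.eqb_neq. intros Q.
        assert (T : Nat.even n = true) by (apply Nat.even_spec; exists (n / 2)%nat; lia). congruence.
    + intros k _ Hk. replace (k + k =? n)%nat with false; [reflexivity|]. symmetry. apply Nat.eqb_neq. intros Q.
      apply Hk. rewrite <- Q. replace (k + k)%nat with (k * 2)%nat by lia. now rewrite Nat.div_mul.
  - intros i Hi. rewrite (bsum_single _ _ (n - i)).
    + replace (n - i <? S n)%nat with true by (symmetry; apply Nat.ltb_lt; lia).
      replace (i + (n - i) =? n)%nat with true by (symmetry; apply Nat.eqb_eq; lia). reflexivity.
    + intros k _ Hk. replace (i + k =? n)%nat with false; [reflexivity|]. symmetry. apply Nat.eqb_neq. lia.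
Qed.

(** * Leading terms, and the bases of M_{4m} and M(odd) *)

Lemma ps_mul_low (f g : ps) i j : (forall n, (n < i)%nat -> f n = false) -> (forall n, (n < j)%nat -> g n = false) ->
  (forall n, (n < i + j)%nat -> ps_mul f g n = false) /\ ps_mul f g (i + j)%nat = f i && g j.
Proof.
  intros Hf Hg. unfold ps_mul. split.
  - intros n Hn. rewrite xsum_bsum. apply bsum_false. intros k Hk.
    destruct (le_lt_dec i k); [rewrite (Hg (n - k)%nat) by lia; apply andb_false_r|now rewrite Hf].
  - rewrite xsum_bsum, (bsum_single _ _ i).
    + replace (i <? S (i + j))%nat with true by (symmetry; apply Nat.ltb_lt; lia). do 2 f_equal. lia.
    + intros k Hk Ne. destruct (le_lt_dec i k); [rewrite (Hg (i + j - k)%nat) by lia; apply andb_false_r|now rewrite Hf].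
Qed.

Lemma r_pow_low i : (forall n, (n < i)%nat -> ps_pow r i n = false) /\ ps_pow r i i = true.
Proof.
  induction i as [|i [IH1 IH2]].
  - split; [intros; lia|reflexivity].
  - assert (R0 : forall n, (n < 1)%nat -> r n = false) by (intros n Hn; replace n with O by lia; reflexivity).
    destruct (ps_mul_low (ps_pow r i) r i 1 IH1 R0) as [K1 K2]. replace (i + 1)%nat with (S i) in * by lia.
    split; [exact K1|]. rewrite ps_pow_S, K2, IH2. reflexivity.
Qed.

Lemma zconv_low a b i j : (forall n, (n < i)%nat -> a n = 0%Z) -> (forall n, (n < j)%nat -> b n = 0%Z) ->
  forall n, (n < i + j)%nat -> zconv a b n = 0%Z.
Proof.
  intros Ha Hb n Hn. unfold zconv.
  assert (Z : forall u D, (forall k, (k < D)%nat -> u k = 0%Z) -> zsum u D = 0%Z).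
  { intros u D. induction D; intros H; simpl; auto. rewrite IHD, H; auto. }
  apply Z. intros k Hk. destruct (le_lt_dec i k); [rewrite (Hb (n - k)%nat) by lia; apply Z.mul_0_r|now rewrite Ha].
Qed.

(** Each step multiplies by [E4], [F1] or [F2], which raises the weight by 4 and the exponent by 0,
    1 or 2. The lower coefficients must vanish in Z, not only mod 2, for Sturm's bound to apply
    after elimination. *)
Lemma basis_form m : forall i, (i <= 2 * m)%nat -> exists F a,
  modular_form_G05 (4 * m) F /\ has_qexpansion F a /\ red a = ps_pow r i /\ (forall n, (n < i)%nat -> a n = 0%Z).
Proof.
  induction m as [|m IH]; intros i Hi.
  - replace i with O by lia. exists (fun _ => RtoC 1), onez. repeat split.
    + apply mf_const. + apply mf_const. + apply mf_const.
    + apply qx_one.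
    + apply functional_extensionality. intros n. unfold red, onez, ps_one. simpl. unfold ps_one. destruct (n =? 0)%nat; reflexivity.
    + intros; lia.
  - replace (4 * S m)%nat with (4 * m + 4)%nat by lia.
    assert (ST : forall j k G b, (j <= 2 * m)%nat -> modular_form_G05 4 G -> has_qexpansion G b ->
       red b = ps_pow r k -> (forall n, (n < k)%nat -> b n = 0%Z) -> exists F a,
       modular_form_G05 (4 * m + 4) F /\ has_qexpansion F a /\ red a = ps_pow r (j + k) /\ (forall n, (n < j + k)%nat -> a n = 0%Z)).
    { intros j k G b Hj HG Hb Rb Lb. destruct (IH j Hj) as [F [a [HF [HA [Ra La]]]]].
      exists (fun z => F z * G z)%C, (zconv a b). split; [now apply mf_mult|]. split; [now apply qx_mult|]. split.
      - now rewrite red_zconv, Ra, Rb, ps_pow_add.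
      - now apply zconv_low. }
    destruct (le_lt_dec i (2 * m)) as [L|L].
    + replace i with (i + 0)%nat by lia. apply (ST i O E4 aE4); auto using mf_E4, qx_E4, red_E4. intros; lia.
    + assert (C : i = (2 * m + 1)%nat \/ i = (2 * m + 2)%nat) by lia. destruct C as [->| ->].
      * apply (ST (2 * m)%nat 1%nat F1 aF1); auto using mf_F1, qx_F1.
        -- rewrite red_F1. simpl. now rewrite ps_mul_1_l.
        -- intros n Hn. replace n with O by lia. apply aF1_0.
      * apply (ST (2 * m)%nat 2%nat F2 aF2); auto using mf_F2, qx_F2, aF2_01.
        rewrite red_F2. simpl. now rewrite ps_mul_1_l.
Qed.

Lemma lincomb_bsum c d b n : lincomb c d b n = bsum (fun i => c i && b i n) (S d).
Proof. unfold lincomb. now rewrite xsum_bsum. Qed.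

Lemma Mk_add k f g : Mk k f -> Mk k g -> Mk k (ps_add f g).
Proof.
  intros [F [a [HF [HA Ra]]]] [G [b [HG [HB Rb]]]].
  exists (fun z => F z + G z)%C, (fun n => a n + b n)%Z.
  split; [now apply mf_plus|]. split; [now apply qx_plus|].
  intros n. now rewrite Z.odd_add, Ra, Rb.
Qed.

Lemma Mk_zero k : Mk k (fun _ => false).
Proof.
  exists (fun z => IZR 0 * 1)%C, (fun n => 0 * onez n)%Z. split; [|split].
  - split; [|split].
    + intros z _. apply ex_derive_cder. exists (RtoC 0). apply cder_const.
    + intros. ring.
    + intros. exists 0, 0. intros. rewrite Cmult_0_l, Cmod_0, Rmult_0_l. lra.
  - apply qx_scal, qx_one.
  - reflexivity.
Qed.

Lemma Mk_bsum k c (b : nat -> ps) d : (forall i, (i < d)%nat -> Mk k (b i)) ->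
  Mk k (fun n => bsum (fun i => c i && b i n) d).
Proof.
  induction d as [|d IH]; intros H; [apply Mk_zero|].
  apply (Mk_add k (fun n => bsum (fun i => c i && b i n) d) (fun n => c d && b d n)); [auto|].
  destruct (c d); [apply H; lia|apply Mk_zero].
Qed.

Lemma Mk_r_pow m i : (i <= 2 * m)%nat -> Mk (4 * m) (ps_pow r i).
Proof.
  intros Hi. destruct (basis_form m i Hi) as [F [a [HF [HA [Ra _]]]]]. exists F, a.
  split; auto. split; auto. intros n. now rewrite <- Ra.
Qed.

Lemma Mk_ext k f g : ps_eq f g -> Mk k g -> Mk k f.
Proof.
  intros E [F [a [HF [HA Ra]]]]. exists F, a. split; auto. split; auto. intros n. now rewrite Ra, E.
Qed.

Lemma Mk_lincomb k c (b : nat -> ps) d : (forall i, (i <= d)%nat -> Mk k (b i)) -> Mk k (lincomb c d b).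
Proof.
  intros H. apply Mk_ext with (fun n => bsum (fun i => c i && b i n) (S d)).
  - intros n. apply lincomb_bsum.
  - apply Mk_bsum. intros i Hi. apply H. lia.
Qed.

(** Gaussian elimination over Z on the first 2m + 1 coefficients; by Sturm's bound nothing is left,
    so f is the combination removed on the way. *)
Lemma Mk_in_span m f : Mk (4 * m) f -> exists c, ps_eq f (lincomb c (2 * m) (ps_pow r)).
Proof.
  intros [F [a [HF [HA Ra]]]].
  assert (EL : forall j, (j <= 2 * m + 1)%nat -> exists F' a' c, modular_form_G05 (4 * m) F' /\ has_qexpansion F' a' /\
    (forall n, (n < j)%nat -> a' n = 0%Z) /\ forall n, f n = xorb (Z.odd (a' n)) (bsum (fun i => c i && ps_pow r i n) j)).
  { induction j as [|j IH]; intros Hj.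
    - exists F, a, (fun _ => false). split; auto. split; auto. split; [intros; lia|]. intros n. simpl. now rewrite xorb_false_r, Ra.
    - destruct (IH ltac:(lia)) as [F' [a' [c [HF' [HA' [La Rf]]]]]].
      destruct (basis_form m j ltac:(lia)) as [G [b [HG [HB [Rb Lb]]]]].
      (* Cross-multiplication cancels the j-th coefficient without division. Since [b j] is odd, mod
         2 it only adds the parity of [a' j] times r^j. *)
      exists (fun z => IZR (b j) * F' z + IZR (- a' j) * G z)%C, (fun n => b j * a' n + (- a' j) * b n)%Z,
        (fun i => if (i =? j)%nat then Z.odd (a' j) else c i).
      split; [apply mf_plus; now apply mf_scal|]. split; [apply qx_plus; now apply qx_scal|]. split.
      + intros n Hn. destruct (Nat.eq_dec n j) as [->|Ne]; [ring|]. rewrite (La n), (Lb n) by lia. ring.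
      + intros n. rewrite Rf. simpl bsum. rewrite Nat.eqb_refl.
        rewrite (bsum_ext (fun i => (if (i =? j)%nat then Z.odd (a' j) else c i) && ps_pow r i n) (fun i => c i && ps_pow r i n)).
        2:{ intros k Hk. replace (k =? j)%nat with false; [reflexivity|]. symmetry; apply Nat.eqb_neq; lia. }
        rewrite Z.odd_add, !Z.odd_mul, Z.odd_opp.
        assert (Oj : Z.odd (b j) = true) by (change (red b j = true); rewrite Rb; apply r_pow_low).
        assert (On : Z.odd (b n) = ps_pow r j n) by (change (red b n = ps_pow r j n); now rewrite Rb).
        rewrite Oj, On. set (X := bsum _ j).
        destruct (Z.odd (a' n)), (Z.odd (a' j)), (ps_pow r j n), X; reflexivity. }
  destruct (EL (2 * m + 1)%nat ltac:(lia)) as [F' [a' [c [HF' [HA' [La Rf]]]]]].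
  assert (Z0 : forall n, a' n = 0%Z) by (apply (sturm m F'); auto; intros k Hk; apply La; lia).
  exists c. intros n. rewrite Rf, lincomb_bsum, Z0. simpl Z.odd. rewrite xorb_false_l.
  f_equal. lia.
Qed.

(** At the leading exponent [e k] the later elements vanish and the earlier coefficients are already
    0, so only [c k] is left. *)
Lemma triangular_independent (b : nat -> ps) (e : nat -> nat) d c :
  (forall i j, (i < j)%nat -> (e i < e j)%nat) ->
  (forall k n, (n < e k)%nat -> b k n = false) -> (forall k, b k (e k) = true) ->
  ps_eq (lincomb c d b) (fun _ => false) -> forall k, (k <= d)%nat -> c k = false.
Proof.
  intros He Hlow Hlead H k. induction k as [k IH] using (well_founded_induction lt_wf). intros Hk.
  assert (E := H (e k)). rewrite lincomb_bsum, (bsum_single _ _ k) in E.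
  - replace (k <? S d)%nat with true in E by (symmetry; apply Nat.ltb_lt; lia). rewrite Hlead, andb_true_r in E. exact E.
  - intros i Hi Ne. destruct (le_lt_dec k i).
    + rewrite Hlow; [apply andb_false_r|]. apply He. lia.
    + rewrite IH by lia. reflexivity.
Qed.

Definition bodd (k : nat) : ps := ps_mul (ps_pow r (2 * k)) (ps_add (ps_pow r 2) r).

Lemma bodd_eq k : bodd k = ps_add (ps_pow r (2 * k + 2)) (ps_pow r (2 * k + 1)).
Proof.
  unfold bodd. rewrite ps_mul_add_r, !ps_pow_add. f_equal. f_equal. simpl. now rewrite ps_mul_1_l.
Qed.

Lemma r_pow_even k n : Nat.even n = false -> ps_pow r (2 * k) n = false.
Proof.
  intros H. replace (2 * k)%nat with (k + k)%nat by lia. rewrite ps_pow_add, ps_sqr, H. reflexivity.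
Qed.

(** r^(2k) has only even exponents, and at an even exponent 2i the series r^2 + r has the
    coefficient r(i) + r(2i) = 0. *)
Lemma bodd_odd k n : bodd k (2 * n)%nat = false.
Proof.
  unfold bodd, ps_mul. rewrite xsum_bsum. apply bsum_false. intros j Hj.
  destruct (Nat.even j) eqn:E; [|now rewrite r_pow_even].
  apply Nat.even_spec in E. destruct E as [i Hi]. 
  replace (ps_add (ps_pow r 2) r (2 * n - j)%nat) with false; [apply andb_false_r|].
  replace (2 * n - j)%nat with (2 * (n - i))%nat by lia. unfold ps_add.
  change (ps_pow r 2) with (ps_mul (ps_mul ps_one r) r). rewrite ps_mul_1_l, ps_sqr, r_double.
  replace (Nat.even (2 * (n - i))) with true by (now rewrite Nat.even_mul).
  rewrite Nat.mul_comm, Nat.div_mul by lia. symmetry. apply xorb_nilpotent.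
Qed.

Lemma Mall_span f : Mall f <-> exists d c, ps_eq f (lincomb c d (ps_pow r)).
Proof.
  split.
  - intros [m H]. destruct (Mk_in_span m f H) as [c E]. now exists (2 * m)%nat, c.
  - intros [d [c E]]. exists d. apply Mk_ext with (1 := E). apply Mk_lincomb. intros i Hi. apply Mk_r_pow. lia.
Qed.

Lemma Modd_span f : Modd f <-> exists d c, ps_eq f (lincomb c d bodd).
Proof.
  split.
  - intros [HM Hev]. apply Mall_span in HM. destruct HM as [d [c E]].
    (* Padding by zeros gives 2(d+1) powers, so they can be grouped in pairs 2k, 2k + 1. *)
    set (c' := fun i => if (i <=? d)%nat then c i else false).
    exists d, (fun k => c' (2 * k + 1)%nat). intros n.
    assert (Ec : forall n, f n = bsum (fun i => c' i && ps_pow r i n) (2 * S d)).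
    { intros j. rewrite E, lincomb_bsum. replace (2 * S d)%nat with (S d + S d)%nat by lia.
      assert (G : forall k, bsum (fun i => c i && ps_pow r i j) (S d) = bsum (fun i => c' i && ps_pow r i j) (S d + k)).
      { induction k.
        - rewrite Nat.add_0_r. apply bsum_ext. intros i Hi. unfold c'. replace (i <=? d)%nat with true; [reflexivity|].
          symmetry; apply Nat.leb_le; lia.
        - rewrite Nat.add_succ_r, (bsum_S _ (S d + k)), <- IHk. unfold c'.
          replace (S d + k <=? d)%nat with false by (symmetry; apply Nat.leb_gt; lia). simpl. now rewrite xorb_false_r. }
      apply G. }
    (* The even part: the even powers already present and the r^(2k+2) left over from each odd
       power. *)
    set (ev := fun n => bsum (fun k => xorb (c' (2 * k)%nat && ps_pow r (2 * k) n) (c' (2 * k + 1)%nat && ps_pow r (2 * S k) n)) (S d)).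
    assert (Sp : forall n, f n = xorb (lincomb (fun k => c' (2 * k + 1)%nat) d bodd n) (ev n)).
    { intros j. rewrite Ec, lincomb_bsum, bsum_pairs. unfold ev. rewrite <- bsum_xor. apply bsum_ext. intros k _.
      rewrite bodd_eq. unfold ps_add. replace (2 * S k)%nat with (2 * k + 2)%nat by lia.
      destruct (c' (2 * k)%nat), (c' (2 * k + 1)%nat), (ps_pow r (2 * k) j), (ps_pow r (2 * k + 1) j), (ps_pow r (2 * k + 2) j); reflexivity. }
    (* At even n both f and the combination of [bodd] vanish, hence so does [ev]; at odd n every
       even power of r vanishes. *)
    assert (Z : ev n = false); [|now rewrite Sp, Z, xorb_false_r].
    destruct (Nat.even n) eqn:En.
    + apply Nat.even_spec in En. destruct En as [i ->]. assert (Q := Sp (2 * i)%nat). rewrite Hev in Q.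
      rewrite lincomb_bsum, bsum_false, xorb_false_l in Q; [auto|]. intros k _. rewrite bodd_odd. apply andb_false_r.
    + apply bsum_false. intros k _. rewrite !r_pow_even by auto. now rewrite !andb_false_r.
  - intros [d [c E]]. split.
    (* The highest exponent, 2d + 2, is the bound for weight 4(d+1). *)
    + exists (S d). apply Mk_ext with (1 := E). apply Mk_lincomb. intros k Hk. rewrite bodd_eq.
      apply Mk_add; apply Mk_r_pow; lia.
    + intros n. rewrite E, lincomb_bsum. apply bsum_false. intros k _. rewrite bodd_odd. apply andb_false_r.
Qed.

Theorem theorem1p11 :
  (* r^i, 0 <= i <= 2m, is a Z/2-basis of M_{4m} *)
  (forall m : nat,
     (forall c : nat -> bool,
        ps_eq (lincomb c (2 * m) (ps_pow r)) (fun _ => false) ->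
        forall i, (i <= 2 * m)%nat -> c i = false) /\
     (forall f : ps,
        Mk (4 * m) f <-> exists c : nat -> bool, ps_eq f (lincomb c (2 * m) (ps_pow r)))) /\
  (* M = Z/2[r] *)
  (forall f : ps,
     Mall f <-> exists (d : nat) (c : nat -> bool), ps_eq f (lincomb c d (ps_pow r))) /\
  (* r^{2k}(r^2 + r), k >= 0, is a Z/2-basis of M(odd) *)
  (let b := fun k => ps_mul (ps_pow r (2 * k)) (ps_add (ps_pow r 2) r) in
   (forall (d : nat) (c : nat -> bool),
      ps_eq (lincomb c d b) (fun _ => false) -> forall k, (k <= d)%nat -> c k = false) /\
   (forall f : ps,
      Modd f <-> exists (d : nat) (c : nat -> bool), ps_eq f (lincomb c d b))).
Proof.
  split; [|split].
  - intros m. split.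
    + intros c. apply (triangular_independent (ps_pow r) (fun k => k)).
      * auto.
      * intros k. apply r_pow_low.
      * intros k. apply r_pow_low.
    + intros f. split; [apply Mk_in_span|]. intros [c E].
      apply Mk_ext with (1 := E), Mk_lincomb. intros i Hi. now apply Mk_r_pow.
  - exact Mall_span.
  - split; [|exact Modd_span].
    intros d c. apply (triangular_independent bodd (fun k => 2 * k + 1)%nat).
    + intros; lia.
    + intros k n Hn. rewrite bodd_eq. unfold ps_add. rewrite !(proj1 (r_pow_low _)) by lia. reflexivity.
    + intros k. rewrite bodd_eq. unfold ps_add. rewrite (proj1 (r_pow_low _)), (proj2 (r_pow_low _)) by lia. reflexivity.
Qed.
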